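(* Let $A\in\mathbb{R}^{m\times n}$ ($m\ge n$) have full rank, let $b\in\mathbb{R}^m$, and let $x=\operatorname{argmin}_{y\in\mathbb{R}^n}\|b-Ay\|$. Let $S\in\mathbb{R}^{d\times m}$ be a subspace embedding for $\operatorname{range}([A\ \ b])$ with distortion $\varepsilon\in(0,0.29]$. There exists a constant $c_1>0$ depending polynomially on $m$, $n$, and $d$ (and on no other problem parameters) such that if $c_1\kappa u<1$ and multiplication by $S$ is forward stable (in the sense defined in the context), then the numerically computed iterates $\hat x_i$, $i=0,1,2,\ldots$, of the iterative sketching algorithm (described in the context) satisfy $$\|x-\hat x_i\|\le 20\sqrt{\varepsilon}\,\kappa\,(g_{\rm IS}+c_1\kappa u)^i\,\frac{\|r(x)\|}{\|A\|}+c_1\kappa u\Big[\|x\|+\frac{\kappa}{\|A\|}\|r(x)\|\Big],$$ $$\|r(x)-r(\hat x_i)\|\le 20\sqrt{\varepsilon}\,(g_{\rm IS}+c_1\kappa u)^i\,\|r(x)\|+c_1u\big[\|A\|\|x\|+\kappa\|r(x)\|\big],$$ where $g_{\rm IS}=\dfrac{(2-\varepsilon)\varepsilon}{(1-\varepsilon)^2}$. In particular, if $g_{\rm IS}+c_1\kappa u\le 0.9$ and $S$ is a sparse sign embedding with $d=\mathcal{O}(n\log n)$ and $\zeta=\mathcal{O}(\log n)$, then iterative sketching produces a solution $\hat x$ satisfying the forward stable error guarantee $$\|\hat x-x\|\le c'\kappa\Big(\|x\|+\frac{\kappa}{\|A\|}\|r(x)\|\Big)u,\qquad \|r(\hat x)-r(x)\|\le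 c'\big(\|A\|\|x\|+\kappa\|r(x)\|\big)u,$$ with $c'$ a prefactor depending polynomially on the dimensions, in $q=\mathcal{O}(\log(1/u))$ iterations and $\mathcal{O}(mn\log(n/u)+n^3\log n)$ operations.
   Context: Notation: $\|\cdot\|$ is the Euclidean norm of a vector or the spectral norm of a matrix; $\kappa=\sigma_{\max}(A)/\sigma_{\min}(A)$; $r(y)=b-Ay$; $u$ is the unit roundoff. Computations are in floating point arithmetic with unit roundoff $u$ under the standard model (each basic operation $\circ\in\{+,-,\times,/\}$ and square root is computed with relative error at most $u$, no overflow or underflow); hats denote numerically computed quantities. Subspace embedding: $S\in\mathbb{R}^{d\times m}$ is a subspace embedding with distortion $\varepsilon\in(0,1)$ for a subspace $\mathcal{V}\subseteq\mathbb{R}^m$ if $(1-\varepsilon)\|v\|\le\|Sv\|\le(1+\varepsilon)\|v\|$ for every $v\in\mathcal{V}$. Iterative sketching algorithm (input $A$, $b$, $S$, iteration count $q$): form $B=SA$; compute an economy-size QR factorization $B=QR$ by Householder QR; set $x_0=R^{-1}(Q^\top(Sb))$ (the sketch-and-solve initialization); for $i=0,1,\ldots,q-1$ compute, in this order, $r_i=b-Ax_i$, $c_i=A^\top r_i$, $d_i=R^{-1}(R^{-\top}c_i)$ by two triangular solves, and $x_{i+1}=x_i+d_i$; output $x_q$. The vectors $\hat x_i$ are the versions of $x_i$ computed in floating point arithmetic. Forward stability of multiplication by $S$: the computed versions $\hat B$ of $B=SA$ and $\widehat{Sb}$ of $Sb$ satisfy $\hat B=B+\Delta B$, $\widehat{Sb}=Sb+\delta$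 with $\|\Delta B\|\le c_0\|A\|u$ and $\|\delta\|\le c_0\|b\|u$, where $c_0$ is a constant depending polynomially on $m,n,d$ and on no other problem parameters. The constant $c_1$ may depend on $c_0$. Sparse sign embedding with sparsity $\zeta$: the random matrix $S=\sqrt{1/\zeta}\,[s_1\ \cdots\ s_m]\in\mathbb{R}^{d\times m}$, where each column $s_j\in\mathbb{R}^d$ has exactly $\zeta$ nonzero entries, with uniformly random $\pm1$ values in uniformly random positions. *)

(* Defs.v *)
From HB Require Import structures.
From mathcomp Require Import all_boot all_order all_algebra.
From mathcomp Require Import all_classical all_reals all_analysis.

Set Implicit Arguments.
Unset Strict Implicit.
Unset Printing Implicit Defensive.

Import Order.TTheory GRing.Theory Num.Theory.

Local Open Scope classical_set_scope.
Local Open Scope ring_scope.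

Section LinearAlgebra.
Variable R : realType.

Definition norm2 n (v : 'cV[R]_n) : R := Num.sqrt (\sum_i v i 0 ^+ 2).

Definition opnorm m n (A : 'M[R]_(m, n)) : R :=
  sup [set norm2 (A *m v) | v in [set v : 'cV[R]_n | norm2 v <= 1]].

(* For n <= m these are the n singular values of A (without multiplicity). *)
Definition singular_values m n (A : 'M[R]_(m, n)) : set R :=
  [set s | 0 <= s /\ eigenvalue (A^T *m A) (s ^+ 2)].

Definition sigma_max m n (A : 'M[R]_(m, n)) : R := sup (singular_values A).
Definition sigma_min m n (A : 'M[R]_(m, n)) : R := inf (singular_values A).
Definition cond m n (A : 'M[R]_(m, n)) : R := sigma_max A / sigma_min A.

Definition resid m n (A : 'M[R]_(m, n)) (b : 'cV[R]_m) (y : 'cV[R]_n) :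
  'cV[R]_m := b - A *m y.

Definition is_least_squares_solution m n (A : 'M[R]_(m, n)) (b : 'cV[R]_m)
    (x : 'cV[R]_n) : Prop :=
  forall y, norm2 (resid A b x) <= norm2 (resid A b y).

Definition column_space m k (M : 'M[R]_(m, k)) : set 'cV[R]_m :=
  range (fun y : 'cV[R]_k => M *m y).

Definition subspace_embedding d m (S : 'M[R]_(d, m)) (eps : R)
    (V : set 'cV[R]_m) : Prop :=
  forall v, V v ->
    (1 - eps) * norm2 v <= norm2 (S *m v) /\
    norm2 (S *m v) <= (1 + eps) * norm2 v.

Definition g_IS (eps : R) : R := (2 - eps) * eps / (1 - eps) ^+ 2.

Definition polynomially_bounded (c : nat -> nat -> nat -> R) : Prop :=
  exists (C : R) (k : nat), forall m n d : nat,
    `|c m n d| <= C * (1 + m + n + d)%:R ^+ k.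

End LinearAlgebra.

(* Operations of an arithmetic with values in some set F of floating point
   numbers are represented as functions on all of R (compose the exact operation
   with rounding); nothing is assumed about division by 0 or the square root
   of a negative number.  Sign changes and comparisons are exact. *)
Record fp_arith (R : realType) (u : R) := FpArith {
  fl_add : R -> R -> R;
  fl_sub : R -> R -> R;
  fl_mul : R -> R -> R;
  fl_div : R -> R -> R;
  fl_sqrt : R -> R;
  fl_addP : forall x y, `|fl_add x y - (x + y)| <= u * `|x + y|;
  fl_subP : forall x y, `|fl_sub x y - (x - y)| <= u * `|x - y|;
  fl_mulP : forall x y, `|fl_mul x y - x * y| <= u * `|x * y|;
  fl_divP : forall x y, y != 0 -> `|fl_div x y - x / y| <= u * `|x / y|;
  fl_sqrtP : forall x, 0 <= x ->
    `|fl_sqrt x - Num.sqrt x| <= u * Num.sqrt x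
}.

(* A computed value together with the number of floating point operations spent
   on it. *)
Definition cost (X : Type) : Type := (X * nat)%type.
Definition ret X (x : X) : cost X := (x, 0%N).
Definition bind X Y (p : cost X) (f : X -> cost Y) : cost Y :=
  ((f p.1).1, (p.2 + (f p.1).2)%N).

Local Notation "'let*' x := p 'in' q" := (bind p (fun x => q))
  (at level 200, x name, p at level 100, q at level 200).

Definition loop I X (s : seq I) (body : I -> X -> cost X) (x0 : X) : cost X :=
  foldl (fun p i => bind p (body i)) (ret x0) s.

Section Programs.
Variables (R : realType) (u : R) (fl : fp_arith u).

Definition fadd (x y : R) : cost R := (fl_add fl x y, 1%N).
Definition fsub (x y : R) : cost R := (fl_sub fl x y, 1%N).
Definition fmul (x y : R) : cost R := (fl_mul fl x y, 1%N).
Definition fdiv (x y : R) : cost R := (fl_div fl x y, 1%N).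
Definition fsqrt (x : R) : cost R := (fl_sqrt fl x, 1%N).

Definition vgen n (f : 'I_n -> cost R) : cost 'cV[R]_n :=
  (\col_i (f i).1, (\sum_i (f i).2)%N).

Definition cgen m n (f : 'I_n -> cost 'cV[R]_m) : cost 'M[R]_(m, n) :=
  (\matrix_(i, j) (f j).1 i 0, (\sum_j (f j).2)%N).

Definition fdot I (s : seq I) (f g : I -> R) : cost R :=
  loop s (fun i acc => let* p := fmul (f i) (g i) in fadd acc p) 0.

Definition fmulmxv m n (M : 'M[R]_(m, n)) (v : 'cV[R]_n) : cost 'cV[R]_m :=
  vgen (fun i => fdot (enum 'I_n) (fun j => M i j) (fun j => v j 0)).

(* Only the nonzero entries of S are touched. *)
Definition sparse_mulmx d m k (S : 'M[R]_(d, m)) (X : 'M[R]_(m, k)) :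
    cost 'M[R]_(d, k) :=
  cgen (fun l => vgen (fun i =>
    fdot [seq j <- enum 'I_m | S i j != 0] (fun j => S i j) (fun j => X j l))).

Definition update n (y : 'cV[R]_n) (k : 'I_n) (z : R) : 'cV[R]_n :=
  \col_i (if i == k then z else y i 0).

Definition solve_row n (T : 'M[R]_n) (c : 'cV[R]_n) (J : seq 'I_n) (i : 'I_n)
    (y : 'cV[R]_n) : cost 'cV[R]_n :=
  let* t := fdot J (fun j => T i j) (fun j => y j 0) in
  let* p := fsub (c i 0) t in
  let* z := fdiv p (T i i) in
  ret (update y i z).

Definition forward_subst n (L : 'M[R]_n) (c : 'cV[R]_n) : cost 'cV[R]_n :=
  loop (enum 'I_n)
    (fun i => solve_row L c [seq j : 'I_n <- enum 'I_n | (j < i)%N] i) 0.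

Definition back_subst n (U : 'M[R]_n) (c : 'cV[R]_n) : cost 'cV[R]_n :=
  loop (rev (enum 'I_n))
    (fun i => solve_row U c [seq j : 'I_n <- enum 'I_n | (i < j)%N] i) 0.

(* Entry number k, with the dummy value 0 when k is out of range. *)
Definition entry d (y : 'cV[R]_d) (k : nat) : R :=
  oapp (fun i : 'I_d => y i 0) 0 (insub k).

(* (k, v, beta) stands for the reflector 1 - beta v v^T, where v vanishes above
   row k. *)
Definition reflector d : Type := (nat * 'cV[R]_d * R)%type.

(* The reflector sending the part of y from row k on to - s e_k, with
   s = sign(y_k) || y_(k..) || and sign(0) = 1:
   v = y_(k..) + s e_k and beta = 1 / (s v_k) = 2 / (v^T v). *)
Definition make_reflector d (k : nat) (y : 'cV[R]_d) : cost (reflector d * R) :=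
  let* t := fdot [seq i : 'I_d <- enum 'I_d | (k <= i)%N]
              (fun i => y i 0) (fun i => y i 0) in
  let* r := fsqrt t in
  let s := if entry y k < 0 then - r else r in
  let* p := fadd (entry y k) s in
  let* w := fmul s p in
  let* beta := fdiv 1 w in
  let v := \col_(i < d) (if (i < k)%N then 0
                         else if i == k :> nat then p else y i 0) in
  ret ((k, v, beta), s).

Definition apply_reflector d (h : reflector d) (y : 'cV[R]_d) :
    cost 'cV[R]_d :=
  let: (k, v, beta) := h in
  let* t := fdot [seq i : 'I_d <- enum 'I_d | (k <= i)%N]
              (fun i => v i 0) (fun i => y i 0) in
  let* g := fmul beta t in
  vgen (fun i => if (i < k)%N then ret (y i 0)
                 else let* p := fmul g (v i 0) in fsub (y i 0) p).

Definition householder_step d n (k : 'I_n)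
    (st : 'M[R]_(d, n) * seq (reflector d)) :
    cost ('M[R]_(d, n) * seq (reflector d)) :=
  let: (W, hs) := st in
  let* hk := make_reflector k (col k W) in
  let: (h, s) := hk in
  let* W' := cgen (fun j : 'I_n =>
    if (j < k)%N then ret (col j W)
    else if j == k then
      ret (\col_(i < d) (if (i < k)%N then W i k
                         else if i == k :> nat then - s else 0))
    else apply_reflector h (col j W)) in
  ret (W', rcons hs h).

(* Householder QR of a d x n matrix, d >= n: the n x n triangular factor, and
   the orthogonal factor represented by its n reflectors. *)
Definition householder_qr d n (B : 'M[R]_(d, n)) :
    cost ('M[R]_n * seq (reflector d)) :=
  let* st := loop (enum 'I_n) (@householder_step d n) (B, [::]) in
  ret (\matrix_(i < n, j < n) entry (col j st.1) i, st.2).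

(* Q^T y for the economy-size (d x n) factor Q. *)
Definition apply_QT d n (hs : seq (reflector d)) (y : 'cV[R]_d) :
    cost 'cV[R]_n :=
  let* z := loop hs (@apply_reflector d) y in
  ret (\col_(k < n) entry z k).

Definition refine m n (A : 'M[R]_(m, n)) (b : 'cV[R]_m) (Rf : 'M[R]_n)
    (x : 'cV[R]_n) : cost 'cV[R]_n :=
  let* Ax := fmulmxv A x in
  let* r := vgen (fun i => fsub (b i 0) (Ax i 0)) in
  let* c := fmulmxv A^T r in
  let* w := forward_subst Rf^T c in
  let* dx := back_subst Rf w in
  vgen (fun i => fadd (x i 0) (dx i 0)).

(* mulS is the routine that multiplies by the sketching matrix S. *)
Definition iterative_sketching d m n
    (mulS : forall k, 'M[R]_(m, k) -> cost 'M[R]_(d, k))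
    (A : 'M[R]_(m, n)) (b : 'cV[R]_m) (q : nat) : cost 'cV[R]_n :=
  let* B := mulS n A in
  let* qr := householder_qr B in
  let: (Rf, hs) := qr in
  let* Sb := mulS 1%N b in
  let* z := apply_QT n hs Sb in
  let* x0 := back_subst Rf z in
  loop (iota 0 q) (fun _ => refine A b Rf) x0.

End Programs.

Record sketching_setup (R : realType) (m n d : nat) (c0 : R)
    (A : 'M[R]_(m, n)) (b : 'cV[R]_m) (x : 'cV[R]_n)
    (S : 'M[R]_(d, m)) (eps u : R)
    (mulS : forall k, 'M[R]_(m, k) -> cost 'M[R]_(d, k)) : Prop := {
  setup_n_gt0 : (0 < n)%N;
  setup_tall : (n <= m)%N;
  setup_full_rank : \rank A = n;
  setup_solution : is_least_squares_solution A b x;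
  setup_eps : 0 < eps <= 29 / 100;
  setup_embedding : subspace_embedding S eps (column_space (row_mx A b));
  setup_u : 0 < u;
  setup_stable_mx : opnorm ((mulS n A).1 - S *m A) <= c0 * opnorm A * u;
  setup_stable_vec : norm2 ((mulS 1%N b).1 - S *m b) <= c0 * norm2 b * u
}.

Definition sparse_sign_mx (R : realType) d m (zeta : nat) (S : 'M[R]_(d, m)) :
    Prop :=
  exists2 s : 'M[R]_(d, m), S = Num.sqrt (zeta%:R^-1) *: s &
    forall j, #|[pred i | s i j != 0]| = zeta /\
      (forall i, s i j != 0 -> s i j = 1 \/ s i j = -1).

(* A random matrix S, uniform over the (bin d zeta * 2 ^ zeta) ^ m matrices of
   the above shape; equivalently, independent columns, each with a uniformly
   random support of size zeta and independent uniform signs on it. *)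
Definition sparse_sign_embedding (R : realType) (disp : measure_display)
    (T : measurableType disp) (P : probability T R) d m (zeta : nat)
    (S : T -> 'M[R]_(d, m)) : Prop :=
  (forall w, sparse_sign_mx zeta (S w)) /\
  (forall M, sparse_sign_mx zeta M ->
     measurable (S @^-1` [set M]) /\
     P (S @^-1` [set M]) = ((('C(d, zeta) * 2 ^ zeta) ^ m)%:R^-1)%:E).

(* Main.v *)
Require Import Defs.
From HB Require Import structures.
From mathcomp Require Import all_boot all_order all_algebra.
From mathcomp Require Import all_classical all_reals all_analysis.
From mathcomp Require Import ring lra.

(* Let Q Rf be the computed QR factorization of the sketch S A: Householder QR
   is backward stable, so S A - Q Rf = O(u |A|) for an exactly orthonormal Q.
   The embedding property then makes A Rf^-1 nearly an isometry, with singular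
   values in [1 / (1 + eps + delta), 1 / (1 - eps - delta)], delta = O(kappa u).
   The error is measured by e_i = | Rf (x - x_i) |.  In exact arithmetic
   Rf (x - x_(i+1)) = G Rf (x - x_i) with G = 1 - Rf^-T A^T A Rf^-1 symmetric of
   norm at most g_IS eps + O(delta).  Every rounding error of one step enters
   either as O(delta) e_i or as O(u) (|A| |x| + kappa |r|), the crucial point
   being that A^T r = 0 and that A^T is always applied to the small residual.
   Hence e_i decays geometrically down to that level.  For the starting point,
   e_0 is essentially | Q^T S r |, which is O(eps) |r| because S nearly
   preserves the orthogonality of r and range A. *)

Set Implicit Arguments.
Unset Strict Implicit.
Unset Printing Implicit Defensive.

Import Order.TTheory GRing.Theory Num.Theory.

Local Open Scope ring_scope.

(** * Euclidean norm *)

Section EuclideanNorm.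
Variable R : realType.

(** The limit 29/100 on the distortion gives g_IS eps <= 984/1000, so the contraction tolerates a
    perturbation 50 delta once delta <= 1/10000. This threshold is the origin of the factor 10000 in
    [c1]. The error is measured through Rf because G is symmetric in these coordinates, and because
    an error of size eta |A| |w| becomes a relative one, 2 delta |Rf w|. For the triangular solves
    only residuals of the computed solutions are estimated, never forward errors, so no further
    condition number appears. The computed reflectors are not exactly orthogonal, and they are used
    twice: to form Rf and later to compute Q^T (S b). Both uses are compared with one and the same
    product of exact reflectors, each built from the column actually met. Singular values are given
    through eigenvalues of A^T A. A coercivity argument shows that the extremal stretchings of A are
    singular values, and polarization bounds a symmetric matrix by its quadratic form, so nothing is
    diagonalized. *)

Definition dot n (u v : 'cV[R]_n) : R := \sum_i u i 0 * v i 0.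

Lemma dotC n (u v : 'cV[R]_n) : dot u v = dot v u.
Proof. by apply: eq_bigr => i _; rewrite mulrC. Qed.

Lemma dotDr n (u v w : 'cV[R]_n) : dot u (v + w) = dot u v + dot u w.
Proof. by rewrite -big_split; apply: eq_bigr => i _; rewrite mxE mulrDr. Qed.

Lemma dotZr n a (u v : 'cV[R]_n) : dot u (a *: v) = a * dot u v.
Proof. by rewrite big_distrr; apply: eq_bigr => i _; rewrite mxE mulrCA. Qed.

Lemma dotNr n (u v : 'cV[R]_n) : dot u (- v) = - dot u v.
Proof. by rewrite -scaleN1r dotZr mulN1r. Qed.

Lemma dotBr n (u v w : 'cV[R]_n) : dot u (v - w) = dot u v - dot u w.
Proof. by rewrite dotDr dotNr. Qed.

Lemma dotDl n (u v w : 'cV[R]_n) : dot (u + v) w = dot u w + dot v w.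
Proof. by rewrite dotC dotDr !(dotC w). Qed.

Lemma dotZl n a (u v : 'cV[R]_n) : dot (a *: u) v = a * dot u v.
Proof. by rewrite dotC dotZr dotC. Qed.

Lemma dotNl n (u v : 'cV[R]_n) : dot (- u) v = - dot u v.
Proof. by rewrite dotC dotNr dotC. Qed.

Lemma dotBl n (u v w : 'cV[R]_n) : dot (u - v) w = dot u w - dot v w.
Proof. by rewrite dotDl dotNl. Qed.

Lemma dot_mulmx m n (M : 'M[R]_(m, n)) u v : dot (M *m u) v = dot u (M^T *m v).
Proof.
rewrite /dot; under eq_bigr => i _ do rewrite mxE big_distrl /=.
rewrite exchange_big; apply: eq_bigr => j _; rewrite mxE big_distrr /=.
by apply: eq_bigr => i _; rewrite mxE; ring.
Qed.

Lemma dot_ge0 n (u : 'cV[R]_n) : 0 <= dot u u.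
Proof. by apply: sumr_ge0 => i _; rewrite -expr2 sqr_ge0. Qed.

Lemma sqr_norm2 n (u : 'cV[R]_n) : norm2 u ^+ 2 = dot u u.
Proof.
rewrite /norm2 sqr_sqrtr; last by apply: sumr_ge0 => i _; rewrite sqr_ge0.
by apply: eq_bigr => i _; rewrite expr2.
Qed.

Lemma norm2_ge0 n (u : 'cV[R]_n) : 0 <= norm2 u.
Proof. exact: sqrtr_ge0. Qed.

Lemma ler_norm2_sqr n (u : 'cV[R]_n) (a : R) : 0 <= a ->
  (norm2 u <= a) = (dot u u <= a ^+ 2).
Proof. by move=> a0; rewrite -sqr_norm2 ler_pXn2r // nnegrE norm2_ge0. Qed.

Lemma dot_eq0 n (u : 'cV[R]_n) : dot u u = 0 -> u = 0.
Proof.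
move=> /eqP; rewrite psumr_eq0; last by move=> i _; rewrite -expr2 sqr_ge0.
move=> /allP h; apply/colP => i; rewrite mxE.
by have /= := h i (mem_index_enum i); rewrite -expr2 sqrf_eq0 => /eqP.
Qed.

Lemma norm2_eq0 n (u : 'cV[R]_n) : norm2 u = 0 -> u = 0.
Proof. by move=> h; apply: dot_eq0; rewrite -sqr_norm2 h expr0n. Qed.

Lemma norm2_gt0 n (u : 'cV[R]_n) : u != 0 -> 0 < norm2 u.
Proof.
move=> u0; rewrite lt_def norm2_ge0 andbT.
by apply: contraNneq u0 => /norm2_eq0 ->.
Qed.

Lemma norm20 n : norm2 (0 : 'cV[R]_n) = 0.
Proof.
by rewrite /norm2 big1 ?sqrtr0 // => i _; rewrite mxE expr0n.
Qed.

Lemma norm2Z n a (u : 'cV[R]_n) : norm2 (a *: u) = `|a| * norm2 u.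
Proof.
apply/eqP; rewrite -(@eqrXn2 _ 2) ?norm2_ge0 ?mulr_ge0 ?norm2_ge0 //.
by rewrite exprMn !sqr_norm2 dotZl dotZr mulrA -expr2 real_normK ?num_real.
Qed.

Lemma norm2N n (u : 'cV[R]_n) : norm2 (- u) = norm2 u.
Proof. by rewrite -scaleN1r norm2Z normrN1 mul1r. Qed.

Lemma norm2_subC n (u v : 'cV[R]_n) : norm2 (u - v) = norm2 (v - u).
Proof. by rewrite -norm2N opprB. Qed.

(** The square of [norm2 v *: u - norm2 u *: v] expands to 2 |u| |v| (|u| |v| - u.v). *)
Lemma norm2_dot_le n (u v : 'cV[R]_n) : dot u v <= norm2 u * norm2 v.
Proof.
have [->|v0] := eqVneq v 0.
  by rewrite norm20 mulr0 /dot big1 // => i _; rewrite mxE mulr0.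
have [->|u0] := eqVneq u 0.
  by rewrite norm20 mul0r /dot big1 // => i _; rewrite mxE mul0r.
have pu := norm2_gt0 u0; have pv := norm2_gt0 v0.
have := dot_ge0 (norm2 v *: u - norm2 u *: v).
rewrite dotBl !dotBr !dotZl !dotZr -!sqr_norm2 (dotC v u) => h.
have : 0 <= (2 * norm2 u * norm2 v) * (norm2 u * norm2 v - dot u v).
  by apply: le_trans h _; rewrite le_eqVlt; apply/orP; left; apply/eqP; ring.
by rewrite pmulr_rge0 ?subr_ge0 // !mulr_gt0.
Qed.

Lemma norm2_cauchy n (u v : 'cV[R]_n) : `|dot u v| <= norm2 u * norm2 v.
Proof.
rewrite ler_norml norm2_dot_le andbT lerNl -dotNr -(norm2N v).
exact: norm2_dot_le.
Qed.

Lemma norm2_triangle n (u v : 'cV[R]_n) : norm2 (u + v) <= norm2 u + norm2 v.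
Proof.
rewrite ler_norm2_sqr ?addr_ge0 ?norm2_ge0 // dotDl !dotDr (dotC v u).
have := norm2_dot_le u v; rewrite -!sqr_norm2; lra.
Qed.

Lemma norm2B_triangle n (u v : 'cV[R]_n) : norm2 (u - v) <= norm2 u + norm2 v.
Proof. by rewrite -(norm2N v) norm2_triangle. Qed.

Lemma norm2_sub_ge n (u v : 'cV[R]_n) : norm2 u <= norm2 v + norm2 (u - v).
Proof. by rewrite -{1}(subrK v u) addrC norm2_triangle. Qed.

Lemma norm2_le_entry n (u v : 'cV[R]_n) :
  (forall i, `|u i 0| <= `|v i 0|) -> norm2 u <= norm2 v.
Proof.
move=> h; rewrite /norm2 ler_sqrt; last by apply: sumr_ge0 => i _; rewrite sqr_ge0.
apply: ler_sum => i _; rewrite -(real_normK (num_real (u i 0))).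
by rewrite -(real_normK (num_real (v i 0))) ler_pXn2r ?nnegrE.
Qed.

Lemma norm2_abs n (u : 'cV[R]_n) : norm2 (\col_i `|u i 0|) = norm2 u.
Proof.
by rewrite /norm2; congr Num.sqrt; apply: eq_bigr => i _; rewrite mxE real_normK ?num_real.
Qed.

Lemma sum_abs_cauchy n (u v : 'cV[R]_n) :
  \sum_i `|u i 0| * `|v i 0| <= norm2 u * norm2 v.
Proof.
rewrite -(norm2_abs u) -(norm2_abs v); apply: le_trans (norm2_dot_le _ _).
by rewrite le_eqVlt /dot; apply/orP; left; apply/eqP/eq_bigr => i _; rewrite !mxE.
Qed.

Lemma entry_le_norm2 n (u : 'cV[R]_n) i : `|u i 0| <= norm2 u.
Proof.
rewrite -(@ler_pXn2r _ 2) ?nnegrE ?norm2_ge0 // sqr_norm2 real_normK ?num_real //.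
rewrite /dot (bigD1 i) //= -expr2 lerDl; apply: sumr_ge0 => j _.
by rewrite -expr2 sqr_ge0.
Qed.

Lemma norm2_le_sum n (u : 'cV[R]_n) : norm2 u <= \sum_i `|u i 0|.
Proof.
have s0 : 0 <= \sum_i `|u i 0| by apply: sumr_ge0.
rewrite ler_norm2_sqr // expr2 big_distrl; apply: ler_sum => i _ /=.
apply: le_trans (_ : `|u i 0| * `|u i 0| <= _).
  by rewrite -normrM ler_norm.
by rewrite ler_wpM2l // (bigD1 i) //= lerDl sumr_ge0.
Qed.

Lemma norm2_le_max n (u : 'cV[R]_n) (a : R) :
  (forall i, `|u i 0| <= a) -> norm2 u <= n%:R * a.
Proof.
move=> h; apply: le_trans (norm2_le_sum u) _.
apply: le_trans (_ : \sum_(i < n) a <= _); first exact: ler_sum.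
by rewrite sumr_const card_ord mulr_natl.
Qed.

Lemma sum_abs_le n (u : 'cV[R]_n) : \sum_i `|u i 0| <= n%:R * norm2 u.
Proof.
apply: le_trans (_ : \sum_(i < n) norm2 u <= _).
  by apply: ler_sum => i _; exact: entry_le_norm2.
by rewrite sumr_const card_ord mulr_natl.
Qed.

Lemma norm2_delta n (i : 'I_n) : norm2 (delta_mx i 0 : 'cV[R]_n) = 1.
Proof.
rewrite /norm2 (bigD1 i) //= big1 => [|j /negPf ji]; last by rewrite !mxE ji expr0n.
by rewrite !mxE !eqxx addr0 expr1n sqrtr1.
Qed.

Lemma mulmx_delta m n (M : 'M[R]_(m, n)) j : M *m delta_mx j 0 = col j M.
Proof. by rewrite colE. Qed.

Lemma norm2_orthogonal m n (P : 'M[R]_(m, n)) v :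
  P^T *m P = 1%:M -> norm2 (P *m v) = norm2 v.
Proof.
move=> h; apply/eqP; rewrite -(@eqrXn2 _ 2) ?norm2_ge0 //.
by rewrite !sqr_norm2 dot_mulmx mulmxA h mul1mx.
Qed.

(** |M^T f|^2 is the product of M (M^T f) with f, hence at most K |M^T f| |f|. Bounds on Rf^-1 pass
    to Rf^-T in this way. *)
Lemma trmx_norm2_le m n (M : 'M[R]_(m, n)) (K : R) :
  0 <= K ->
  (forall w, norm2 (M *m w) <= K * norm2 w) ->
  forall f, norm2 (M^T *m f) <= K * norm2 f.
Proof.
move=> K0 h f; have [z|z] := eqVneq (M^T *m f) 0.
  by rewrite z norm20 mulr_ge0 // norm2_ge0.
have p := norm2_gt0 z.
rewrite -(ler_pM2l p) -expr2 sqr_norm2 -dot_mulmx.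
apply: le_trans (norm2_dot_le _ _) _.
have -> : norm2 (M^T *m f) * (K * norm2 f) = K * norm2 (M^T *m f) * norm2 f by ring.
by rewrite ler_wpM2r ?norm2_ge0.
Qed.

(** On unit vectors the sum of squares equals 2; homogeneity in each argument does the rest. *)
Lemma bilinear_polarization n p (B : 'cV[R]_n -> 'cV[R]_p -> R)
    (g : R) :
  (forall a x y, B (a *: x) y = a * B x y) ->
  (forall a x y, B x (a *: y) = a * B x y) ->
  (forall x y, B x y <= g / 2 * (norm2 x ^+ 2 + norm2 y ^+ 2)) ->
  forall x y, B x y <= g * norm2 x * norm2 y.
Proof.
move=> hl hr h x y.
have [->|x0] := eqVneq x 0.
  by rewrite -(scale0r (0 : 'cV_n)) hl norm2Z normr0 !(mul0r,mulr0).
have [->|y0] := eqVneq y 0.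
  by rewrite -(scale0r (0 : 'cV_p)) hr norm2Z normr0 !(mul0r,mulr0).
have px := norm2_gt0 x0; have py := norm2_gt0 y0.
have := h ((norm2 x)^-1 *: x) ((norm2 y)^-1 *: y).
rewrite hl hr !norm2Z !gtr0_norm ?invr_gt0 // !mulVf ?gt_eqF // expr1n.
have -> : g / 2 * (1 + 1) = g by lra.
by rewrite mulrA -invfM mulrC ler_pdivrMr ?mulr_gt0 // mulrA.
Qed.

(** For symmetric [G], 4 (G x).y is the form at x + y minus the form at x - y, and the parallelogram
    law gives the hypothesis of [bilinear_polarization]. The bound then follows by taking y = G
    z. *)
Lemma symmetric_norm2_le n (G : 'M[R]_n) (g : R) :
  G^T = G ->
  (forall z, `|dot (G *m z) z| <= g * norm2 z ^+ 2) ->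
  forall z, norm2 (G *m z) <= g * norm2 z.
Proof.
move=> sG h z.
have [w0|w0] := eqVneq (G *m z) 0.
  rewrite w0 norm20; have := h z; rewrite w0.
  have -> : dot 0 z = 0 by rewrite /dot big1 // => i _; rewrite mxE mul0r.
  have [->|z0] := eqVneq z 0; first by rewrite norm20 mulr0.
  by rewrite normr0 pmulr_lge0 ?exprn_gt0 ?norm2_gt0 // => ?; rewrite mulr_ge0 ?norm2_ge0.
have p := norm2_gt0 w0.
rewrite -(ler_pM2r p) -[X in X <= _]expr2 sqr_norm2.
apply: (@bilinear_polarization _ _ (fun x y => dot (G *m x) y)) => [a x y|a x y|x y].
- by rewrite -scalemxAr dotZl.
- by rewrite dotZr.
have e : dot (G *m x) y = (dot (G *m (x + y)) (x + y) - dot (G *m (x - y)) (x - y)) / 4.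
  rewrite !mulmxDr !mulmxN !dotDl !dotDr !dotNl !dotNr.
  have -> : dot (G *m y) x = dot (G *m x) y by rewrite dot_mulmx sG dotC.
  lra.
rewrite e.
have := h (x + y); have := h (x - y).
rewrite !sqr_norm2 !dotDl !dotDr !dotNl !dotNr (dotC y x).
rewrite !ler_norml => /andP[a1 a2] /andP[a3 a4].
lra.
Qed.

End EuclideanNorm.

(** * Operator norm and condition number *)

Section OperatorNorm.
Variable R : realType.

(** A crude bound by the norms of the rows, which shows that the supremum in [opnorm] is over a
    bounded set. The summand 1 makes [K] positive. *)
Lemma mulmx_norm2_bounded m n (M : 'M[R]_(m, n)) :
  exists2 K : R, 0 < K & forall v, norm2 (M *m v) <= K * norm2 v.
Proof.
exists (1 + \sum_i norm2 (row i M)^T).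
  by rewrite ltr_wpDr // sumr_ge0 // => i _; exact: norm2_ge0.
move=> v; apply: le_trans (norm2_le_sum _) _.
rewrite mulrDl mul1r big_distrl ler_wpDl ?norm2_ge0 //.
apply: ler_sum => i _; apply: le_trans (norm2_cauchy _ _).
by rewrite mxE /dot; under [X in _ <= `|X|]eq_bigr => j _ do rewrite !mxE.
Qed.

Lemma mulmx_norm2_le_opnorm m n (A : 'M[R]_(m, n)) v :
  norm2 (A *m v) <= opnorm A * norm2 v.
Proof.
have [K K0 hK] := mulmx_norm2_bounded A.
have [->|v0] := eqVneq v 0; first by rewrite mulmx0 !norm20 mulr0.
have p := norm2_gt0 v0.
rewrite -ler_pdivrMr //.
have -> : norm2 (A *m v) / norm2 v = norm2 (A *m ((norm2 v)^-1 *: v)).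
  by rewrite -scalemxAr norm2Z gtr0_norm ?invr_gt0 // mulrC.
apply: sup_upper_bound.
  split; first by exists (norm2 (A *m 0)); exists 0; rewrite //= norm20.
  exists K => _ [w /= w1 <-]; apply: le_trans (hK w) _.
  by rewrite ger_pMr.
exists ((norm2 v)^-1 *: v) => //=.
by rewrite norm2Z gtr0_norm ?invr_gt0 // mulVf ?gt_eqF.
Qed.

Lemma opnorm_le m n (A : 'M[R]_(m, n)) (K : R) : 0 <= K ->
  (forall v, norm2 (A *m v) <= K * norm2 v) -> opnorm A <= K.
Proof.
move=> K0 h; apply: ge_sup; first by exists (norm2 (A *m 0)); exists 0; rewrite //= norm20.
move=> _ [w /= w1 <-]; apply: le_trans (h w) _.
by rewrite ler_piMr.
Qed.

Lemma opnorm_ge0 m n (A : 'M[R]_(m, n)) : 0 <= opnorm A.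
Proof.
have [K K0 hK] := mulmx_norm2_bounded A.
apply: le_trans (norm2_ge0 (A *m 0)) _; apply: sup_upper_bound.
  split; first by exists (norm2 (A *m 0)); exists 0; rewrite //= norm20.
  exists K => _ [w /= w1 <-]; apply: le_trans (hK w) _.
  by rewrite ger_pMr.
by exists 0; rewrite //= norm20.
Qed.

Lemma entry_le_opnorm m n (A : 'M[R]_(m, n)) i j : `|A i j| <= opnorm A.
Proof.
have := mulmx_norm2_le_opnorm A (delta_mx j 0).
rewrite norm2_delta mulr1 mulmx_delta; apply: le_trans.
by apply: le_trans (entry_le_norm2 _ i); rewrite mxE.
Qed.

(* Evaluating the form at w - (M w) / K bounds |M w|^2 by the form at w. *)
Lemma psd_unit_coercive n (M : 'M[R]_n) :
  M^T = M -> M \in unitmx -> (forall w, 0 <= dot (M *m w) w) ->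
  exists2 c : R, 0 < c & forall w, c * norm2 w ^+ 2 <= dot (M *m w) w.
Proof.
move=> sM uM pM.
have [K K0 hK] := mulmx_norm2_bounded M.
have [L L0 hL] := mulmx_norm2_bounded (invmx M).
exists (K * L ^+ 2)^-1; first by rewrite invr_gt0 mulr_gt0 ?exprn_gt0.
move=> w.
have h1 : norm2 w ^+ 2 <= L ^+ 2 * norm2 (M *m w) ^+ 2.
  rewrite -exprMn ler_pXn2r ?nnegrE ?norm2_ge0 ?mulr_ge0 ?norm2_ge0 ?(ltW L0) //.
  by have := hL (M *m w); rewrite mulKmx.
set z := M *m w.
have h2 : dot (M *m z) z <= K * dot z z.
  rewrite -sqr_norm2 expr2 mulrA; apply: le_trans (norm2_dot_le _ _) _.
  by rewrite ler_wpM2r ?norm2_ge0.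
have := pM (w - K^-1 *: z).
rewrite mulmxDr mulmxN -scalemxAr dotDl !dotDr !dotNl !dotNr !dotZl !dotZr -/z.
rewrite (dot_mulmx M z w) sM -/z opprK => h3.
have h4 : K^-1 * (K^-1 * dot (M *m z) z) <= K^-1 * dot z z.
  rewrite ler_pM2l ?invr_gt0 // mulrC ler_pdivrMr //; lra.
rewrite mulrC ler_pdivrMr ?mulr_gt0 ?exprn_gt0 //.
apply: le_trans h1 _; rewrite sqr_norm2 -/z mulrA [leRHS]mulrC ler_wpM2l ?sqr_ge0 //.
have : K^-1 * dot z z <= dot z w by lra.
by rewrite mulrC ler_pdivrMr.
Qed.

Lemma eigenvalue_unitmx n (M : 'M[R]_n) a :
  eigenvalue M a = (M - a%:M \notin unitmx).
Proof. by rewrite /eigenvalue /eigenspace kermx_eq0 row_free_unit. Qed.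

Lemma gram_tr m n (A : 'M[R]_(m, n)) : (A^T *m A)^T = A^T *m A.
Proof. by rewrite trmx_mul trmxK. Qed.

Lemma dot_gram_sub m n (A : 'M[R]_(m, n)) (a : R) w :
  dot ((A^T *m A - a%:M) *m w) w = norm2 (A *m w) ^+ 2 - a * norm2 w ^+ 2.
Proof.
by rewrite mulmxBl dotBl mul_scalar_mx dotZl -mulmxA dot_mulmx trmxK !sqr_norm2.
Qed.

Lemma gram_sub_tr m n (A : 'M[R]_(m, n)) (a : R) :
  (A^T *m A - a%:M)^T = A^T *m A - a%:M.
Proof. by rewrite linearB /= gram_tr tr_scalar_mx. Qed.

Lemma singular_value_norm2 m n (A : 'M[R]_(m, n)) s :
  singular_values A s ->
  exists2 v : 'cV_n, v != 0 & norm2 (A *m v) = s * norm2 v.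
Proof.
move=> [s0 /eigenvalueP[v hv v0]]; exists v^T.
  by rewrite -trmx0 (inj_eq trmx_inj).
apply/eqP; rewrite -(@eqrXn2 _ 2) ?norm2_ge0 ?mulr_ge0 ?norm2_ge0 //.
have -> : norm2 (A *m v^T) ^+ 2 = s ^+ 2 * norm2 v^T ^+ 2.
  apply/eqP; rewrite -subr_eq0 -dot_gram_sub mulmxBl -{1}(gram_tr A) -trmx_mul hv.
  by rewrite mul_scalar_mx linearZ /= subrr /dot big1 // => i _; rewrite mxE mul0r.
by rewrite exprMn.
Qed.

(** Otherwise s^2 - A^T A, with s the operator norm, is semidefinite and invertible, hence coercive.
    Then |A w|^2 <= (s^2 - c) |w|^2 for some c > 0, which contradicts the minimality of s. *)
Lemma opnorm_singular_value m n (A : 'M[R]_(m, n)) :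
  (0 < n)%N -> singular_values A (opnorm A).
Proof.
move=> n0; split; first exact: opnorm_ge0.
rewrite eigenvalue_unitmx; apply/negP => hu.
set s := opnorm A in hu *.
have [||w|c c0 hc] := @psd_unit_coercive _ (- (A^T *m A - (s ^+ 2)%:M)).
- by rewrite linearN /= gram_sub_tr.
- have -> : - (A^T *m A - (s ^+ 2)%:M) = (-1) *: (A^T *m A - (s ^+ 2)%:M).
    by rewrite scaleN1r.
  by rewrite unitmxZ // unitrN1.
- rewrite mulNmx dotNl dot_gram_sub opprB subr_ge0 -exprMn.
  by rewrite ler_pXn2r ?nnegrE ?norm2_ge0 ?mulr_ge0 ?norm2_ge0 ?opnorm_ge0 ?mulmx_norm2_le_opnorm.
have h w : norm2 (A *m w) ^+ 2 <= (s ^+ 2 - c) * norm2 w ^+ 2.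
  by have := hc w; rewrite mulNmx dotNl dot_gram_sub; lra.
(* A unit vector exists because n > 0; it shows that the square root below is of a nonnegative
   number. *)
have sc : 0 <= s ^+ 2 - c.
  have := h (delta_mx (Ordinal n0) 0); rewrite norm2_delta expr1n mulr1.
  by apply: le_trans; rewrite sqr_ge0.
have : s <= Num.sqrt (s ^+ 2 - c).
  apply: opnorm_le; first exact: sqrtr_ge0.
  move=> v; rewrite -(@ler_pXn2r _ 2) ?nnegrE ?norm2_ge0 ?mulr_ge0 ?norm2_ge0 ?sqrtr_ge0 //.
  by rewrite exprMn (sqr_sqrtr sc); exact: h.
rewrite -(@ler_pXn2r _ 2) ?nnegrE ?opnorm_ge0 ?sqrtr_ge0 // (sqr_sqrtr sc).
by rewrite lerDl oppr_ge0 leNgt c0.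
Qed.

Lemma full_rank_norm2_lower m n (A : 'M[R]_(m, n)) : \rank A = n ->
  exists2 K : R, 0 < K & forall v, norm2 v <= K * norm2 (A *m v).
Proof.
move=> rA; have /row_fullP[B hB] : row_full A by rewrite /row_full rA.
have [K K0 hK] := mulmx_norm2_bounded B; exists K => // v.
by have := hK (A *m v); rewrite mulmxA hB mul1mx.
Qed.

(** The infimum [s] of |A v| over unit vectors is a singular value: otherwise A^T A - s^2 would be
    coercive and [s] could be raised. Every singular value is attained as |A v| / |v|, hence is at
    least [s] > 0. *)
Lemma sigma_min_bounds m n (A : 'M[R]_(m, n)) : (0 < n)%N -> \rank A = n ->
  0 < sigma_min A /\ forall v, sigma_min A * norm2 v <= norm2 (A *m v).
Proof.
move=> n0 rA; have [K K0 hK] := full_rank_norm2_lower rA.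
pose E : set R := [set norm2 (A *m v) | v in [set v : 'cV[R]_n | norm2 v = 1]]%classic.
have E0 : (E !=set0)%classic.
  by exists (norm2 (A *m delta_mx (Ordinal n0) 0)); exists (delta_mx (Ordinal n0) 0) => //=; exact: norm2_delta.
pose s := inf E.
have K1 : 0 < K^-1 by rewrite invr_gt0.
have s0 : 0 < s.
  apply: lt_le_trans K1 _; apply: lb_le_inf => // _ [v /= v1 <-].
  by rewrite -div1r ler_pdivrMr // mulrC -v1.
have hs v : s * norm2 v <= norm2 (A *m v).
  have [->|v0] := eqVneq v 0; first by rewrite mulmx0 !norm20 mulr0.
  have p := norm2_gt0 v0.
  rewrite -ler_pdivlMr //.
  have -> : norm2 (A *m v) / norm2 v = norm2 (A *m ((norm2 v)^-1 *: v)).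
    by rewrite -scalemxAr norm2Z gtr0_norm ?invr_gt0 // mulrC.
  apply: ge_inf; first by exists 0 => _ [w _ <-]; exact: norm2_ge0.
  exists ((norm2 v)^-1 *: v) => //=.
  by rewrite norm2Z gtr0_norm ?invr_gt0 // mulVf ?gt_eqF.
have ss : singular_values A s.
  split; first exact: ltW.
  rewrite eigenvalue_unitmx; apply/negP => hu.
  have [|w|c c0 hc] := psd_unit_coercive _ hu.
  - exact: gram_sub_tr.
  - rewrite dot_gram_sub subr_ge0 -exprMn.
    by rewrite ler_pXn2r ?nnegrE ?norm2_ge0 ?mulr_ge0 ?norm2_ge0 ?(ltW s0).
  have sc : 0 <= s ^+ 2 + c by rewrite addr_ge0 ?sqr_ge0 ?(ltW c0).
  have : Num.sqrt (s ^+ 2 + c) <= s.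
    apply: lb_le_inf => // _ [v /= v1 <-].
    rewrite -(@ler_pXn2r _ 2) ?nnegrE ?norm2_ge0 ?sqrtr_ge0 //.
    rewrite (sqr_sqrtr sc).
    by have := hc v; rewrite dot_gram_sub v1 expr1n; lra.
  rewrite -(@ler_pXn2r _ 2) ?nnegrE ?sqrtr_ge0 ?(ltW s0) //.
  rewrite (sqr_sqrtr sc).
  by rewrite gerDl leNgt c0.
have lb t : singular_values A t -> s <= t.
  move=> /singular_value_norm2[v v0 hv].
  by rewrite -(ler_pM2r (norm2_gt0 v0)) -hv.
have le : sigma_min A <= s by apply: ge_inf => //; exists s => t /lb.
split.
  by apply: lt_le_trans s0 _; apply: lb_le_inf; [exists s|move=> t /lb].
by move=> v; apply: le_trans (hs v); rewrite ler_wpM2r ?norm2_ge0.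
Qed.

Lemma opnorm_le_sigma_max m n (A : 'M[R]_(m, n)) :
  (0 < n)%N -> opnorm A <= sigma_max A.
Proof.
move=> n0; apply: sup_upper_bound; last exact: opnorm_singular_value.
split; first by exists (opnorm A); exact: opnorm_singular_value.
exists (opnorm A) => t /singular_value_norm2[v v0 hv].
by rewrite -(ler_pM2r (norm2_gt0 v0)) -hv mulmx_norm2_le_opnorm.
Qed.

Lemma opnorm_gt0 m n (A : 'M[R]_(m, n)) : (0 < n)%N -> \rank A = n -> 0 < opnorm A.
Proof.
move=> n0 rA; have [s0 hs] := sigma_min_bounds n0 rA.
apply: lt_le_trans s0 _; have := hs (delta_mx (Ordinal n0) 0).
rewrite norm2_delta mulr1 => h; apply: le_trans h _.
by have := mulmx_norm2_le_opnorm A (delta_mx (Ordinal n0) 0); rewrite norm2_delta mulr1.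
Qed.

(** Since [opnorm A <= sigma_max A], the quotient cond A / |A| is at least 1 / sigma_min. This is
    how the condition number enters the error analysis. *)
Lemma norm2_le_cond m n (A : 'M[R]_(m, n)) v : (0 < n)%N -> \rank A = n ->
  norm2 v <= cond A / opnorm A * norm2 (A *m v).
Proof.
move=> n0 rA; have [s0 hs] := sigma_min_bounds n0 rA.
have a0 := opnorm_gt0 n0 rA.
have h : (sigma_min A)^-1 <= cond A / opnorm A.
  rewrite /cond ler_pdivlMr // mulrC ler_pM2r ?invr_gt0 //.
  exact: opnorm_le_sigma_max.
apply: le_trans (_ : (sigma_min A)^-1 * norm2 (A *m v) <= _).
  by rewrite -(ler_pM2l s0) mulrA divff ?gt_eqF // mul1r.
by rewrite ler_wpM2r ?norm2_ge0.
Qed.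

Lemma cond_ge1 m n (A : 'M[R]_(m, n)) : (0 < n)%N -> \rank A = n -> 1 <= cond A.
Proof.
move=> n0 rA; have a0 := opnorm_gt0 n0 rA.
have [s0 hs] := sigma_min_bounds n0 rA.
rewrite /cond ler_pdivlMr // mul1r; apply: le_trans (opnorm_le_sigma_max A n0).
have := hs (delta_mx (Ordinal n0) 0); rewrite norm2_delta mulr1.
move=> h; apply: le_trans h _.
by have := mulmx_norm2_le_opnorm A (delta_mx (Ordinal n0) 0); rewrite norm2_delta mulr1.
Qed.

End OperatorNorm.

(** * Rounding errors of inner products and triangular solves *)

Section CostMonad.

Lemma bind_val X Y (p : cost X) (f : X -> cost Y) : (bind p f).1 = (f p.1).1.
Proof. by []. Qed.

Lemma loop_val I X (s : seq I) (body : I -> X -> cost X) x0 :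
  (loop s body x0).1 = foldl (fun x i => (body i x).1) x0 s.
Proof. by elim/last_ind: s => [//|s i IH]; rewrite /loop !foldl_rcons /= -IH. Qed.

Lemma loop_rcons I X (s : seq I) i (body : I -> X -> cost X) x0 :
  (loop (rcons s i) body x0).1 = (body i (loop s body x0).1).1.
Proof. by rewrite !loop_val foldl_rcons. Qed.

End CostMonad.

Section RoundingErrors.
(** [K] will exceed every dimension. Then [h] bounds (1 + u)^k - 1 for all k <= K, and serves as a
    single relative error for basic operations and for inner products. *)
Variables (R : realType) (u : R) (fl : fp_arith u) (K : nat) (h : R).
Hypotheses (u_ge0 : 0 <= u) (hE : h = 2 * K%:R * u) (h_le : h <= 1 / 1000)
  (K_gt0 : (0 < K)%N).

Lemma h_ge0 : 0 <= h.
Proof. by rewrite hE !mulr_ge0. Qed.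

Lemma u_le_h : u <= h.
Proof.
have : 1 <= K%:R :> R by rewrite ler1n.
rewrite hE => k1; rewrite ler_peMl //; lra.
Qed.

Lemma expr1D_le (k : nat) : (k <= K)%N -> (1 + u) ^+ k - 1 <= h.
Proof.
move=> kK; suff : (1 + u) ^+ k <= 1 + 2 * k%:R * u.
  have : 2 * k%:R * u <= h by rewrite hE ler_wpM2r // ler_pM2l // ler_nat.
  lra.
elim: k kK => [_|k IH kK]; first by rewrite expr0 mulr0 mul0r addr0.
rewrite exprS; apply: le_trans (_ : (1 + u) * (1 + 2 * k%:R * u) <= _).
  by rewrite ler_wpM2l ?addr_ge0 ?IH // ltnW.
have : 2 * k%:R * u <= 1.
  apply: le_trans (_ : h <= _); last by apply: le_trans h_le _; lra.
  by rewrite hE ler_wpM2r // ler_pM2l // ler_nat ltnW.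
rewrite -natr1 => k1.
have : u * (2 * k%:R * u) <= u * 1 by rewrite ler_wpM2l.
lra.
Qed.

Lemma fl_add_le x y : `|fl_add fl x y - (x + y)| <= h * `|x + y|.
Proof. by apply: le_trans (fl_addP fl x y) _; rewrite ler_wpM2r ?u_le_h. Qed.

Lemma fl_sub_le x y : `|fl_sub fl x y - (x - y)| <= h * `|x - y|.
Proof. by apply: le_trans (fl_subP fl x y) _; rewrite ler_wpM2r ?u_le_h. Qed.

Lemma fl_mul_le x y : `|fl_mul fl x y - x * y| <= h * `|x * y|.
Proof. by apply: le_trans (fl_mulP fl x y) _; rewrite ler_wpM2r ?u_le_h. Qed.

Lemma fl_div_le x y : y != 0 -> `|fl_div fl x y - x / y| <= h * `|x / y|.
Proof.
by move=> y0; apply: le_trans (fl_divP fl x y0) _; rewrite ler_wpM2r ?u_le_h.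
Qed.

Lemma fl_sqrt_le x : 0 <= x ->
  `|fl_sqrt fl x - Num.sqrt x| <= h * Num.sqrt x.
Proof.
by move=> x0; apply: le_trans (fl_sqrtP fl x0) _; rewrite ler_wpM2r ?u_le_h ?sqrtr_ge0.
Qed.

(** The accumulator starts at 0 and even the first addition may round, so a term can pass through
    [size s] additions besides its own product: this gives the exponent [(size s).+1]. *)
Lemma fdot_error I (s : seq I) (f g : I -> R) :
  `|(fdot fl s f g).1 - \sum_(i <- s) f i * g i|
    <= ((1 + u) ^+ (size s).+1 - 1) * \sum_(i <- s) `|f i| * `|g i|.
Proof.
elim/last_ind: s => [|s i IH].
  by rewrite /fdot /= !big_nil subr0 normr0 mulr0.
rewrite /fdot loop_rcons -/(fdot fl s f g) /=.
rewrite -cats1 !big_cat /= !big_seq1 size_cat addn1.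
set S := \sum_(i <- s) f i * g i in IH *.
set T := \sum_(i <- s) `|f i| * `|g i| in IH *.
set a := (fdot fl s f g).1 in IH *; set p := fl_mul fl (f i) (g i).
have hp : `|p - f i * g i| <= u * `|f i * g i| by exact: fl_mulP.
have ha := fl_addP fl a p.
have hT : `|S| <= T.
  by apply: le_trans (ler_norm_sum _ _ _) _; apply: ler_sum => j _; rewrite normrM.
rewrite -normrM; set P := f i * g i in hp *.
set q := (1 + u) ^+ (size s).+1 in IH *.
(* The last term carries only two roundings, (1 + u)^2, which this inequality absorbs into the
   common factor (1 + u) q. *)
have hq : 1 + u <= q.
  rewrite /q exprS -[leLHS]mulr1 ler_wpM2l ?addr_ge0 // exprn_ege1 // lerDl //.
have -> : (1 + u) ^+ (size s).+2 = (1 + u) * q by rewrite exprS.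
have e1 : `|a + p - (S + P)| <= (q - 1) * T + u * `|P|.
  have -> : a + p - (S + P) = (a - S) + (p - P) by ring.
  by apply: le_trans (ler_normD _ _) _; rewrite lerD.
have e2 : `|a + p| <= `|a + p - (S + P)| + `|S| + `|P|.
  have {1}-> : a + p = a + p - (S + P) + S + P by ring.
  by apply: le_trans (ler_normD _ _) _; rewrite lerD2r ler_normD.
have e3 : `|fl_add fl a p - (S + P)| <= `|fl_add fl a p - (a + p)| + `|a + p - (S + P)|.
  have {1}-> : fl_add fl a p - (S + P) = (fl_add fl a p - (a + p)) + (a + p - (S + P)) by ring.
  exact: ler_normD.
apply: le_trans e3 _.
have f1 : u * `|a + p| <= u * ((q - 1) * T + u * `|P| + T + `|P|).
  rewrite ler_wpM2l //; apply: le_trans e2 _; lra.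
have f2 : (1 + u) * (1 + u) * `|P| <= (1 + u) * q * `|P|.
  by rewrite ler_wpM2r // ler_wpM2l // addr_ge0.
lra.
Qed.

Lemma fdot_le I (s : seq I) (f g : I -> R) : (size s < K)%N ->
  `|(fdot fl s f g).1 - \sum_(i <- s) f i * g i|
    <= h * \sum_(i <- s) `|f i| * `|g i|.
Proof.
move=> sK; apply: le_trans (fdot_error s f g) _; rewrite ler_wpM2r ?expr1D_le //.
by apply: sumr_ge0 => i _; rewrite mulr_ge0.
Qed.

Lemma fmulmxv_error m n (M : 'M[R]_(m, n)) v (a : R) : (n < K)%N ->
  (forall i j, `|M i j| <= a) ->
  norm2 ((fmulmxv fl M v).1 - M *m v) <= h * (m%:R * n%:R * a) * norm2 v.
Proof.
move=> nK hM.
apply: le_trans (_ : m%:R * (h * n%:R * a * norm2 v) <= _); last first.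
  by rewrite le_eqVlt; apply/orP; left; apply/eqP; ring.
apply: norm2_le_max => i; rewrite !mxE.
have := @fdot_le _ (enum 'I_n) (fun j => M i j) (fun j => v j 0).
rewrite size_enum_ord !big_enum /= => /(_ nK) H; apply: le_trans H _.
rewrite -!mulrA ler_wpM2l ?h_ge0 //.
apply: le_trans (_ : \sum_j a * `|v j 0| <= _).
  by apply: ler_sum => j _; rewrite ler_wpM2r.
rewrite -big_distrr /= mulrCA.
(* The sign of [a] is read off an entry of the first column, so the matrix without columns is
   treated apart. *)
case: n M v nK hM => [M v _ _|n M v nK hM]; first by rewrite big_ord0 mulr0 mul0r mulr0.
by rewrite ler_wpM2l ?sum_abs_le // (le_trans _ (hM i ord0)).
Qed.

End RoundingErrors.

Section TriangularSolve.
Variables (R : realType) (u : R) (fl : fp_arith u) (K : nat) (h : R).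
Hypotheses (u_ge0 : 0 <= u) (hE : h = 2 * K%:R * u) (h_le : h <= 1 / 1000)
  (K_gt0 : (0 < K)%N).

Let h0 : 0 <= h := h_ge0 u_ge0 hE.

(** Covers both substitutions: [s] is the order of solution and [J i] lists the unknowns that row i
    reads, all solved earlier. A later step changes none of the unknowns of row i, so its residual
    is settled when the row is solved. *)
Lemma solve_rows_residual n (T : 'M[R]_n) (c : 'cV_n) (J : 'I_n -> seq 'I_n) s :
  uniq s -> (forall i, i \in s -> T i i != 0) ->
  (forall s1 i s2, s = s1 ++ i :: s2 -> {subset J i <= s1}) ->
  (forall i, (size (J i) < K)%N) ->
  let y := (loop s (fun i => solve_row fl T c (J i) i) 0).1 in
  forall i, i \in s ->
  `|c i 0 - (\sum_(j <- J i) T i j * y j 0 + T i i * y i 0)| <=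
    7 * h * (\sum_(j <- J i) `|T i j| * `|y j 0| + `|T i i| * `|y i 0|).
Proof.
elim/last_ind: s => [//|s k IH].
rewrite rcons_uniq => /andP[ks us] dT sJ hJ y i.
have dTs j : j \in s -> T j j != 0 by move=> js; apply: dT; rewrite mem_rcons inE js orbT.
have sJ' s1 i' s2 : s = s1 ++ i' :: s2 -> {subset J i' <= s1}.
  by move=> es; apply: (sJ s1 i' (rcons s2 k)); rewrite es rcons_cat.
have Jk : {subset J k <= s} by apply: (sJ s k [::]); rewrite cats1.
have {}IH := IH us dTs sJ' hJ.
rewrite /y loop_rcons.
set y0 := (loop s _ 0).1 in IH *; cbn zeta in IH.
rewrite mem_rcons inE => /orP[/eqP->|is_].
- rewrite /solve_row /=.
  set t := (fdot fl (J k) _ _).1; set p := fl_sub fl (c k 0) t.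
  set z := fl_div fl p (T k k).
  have eqJ (F : R -> 'I_n -> R) : \sum_(j <- J k) F (update y0 k z j 0) j =
      \sum_(j <- J k) F (y0 j 0) j.
    apply: eq_big_seq => j /Jk js; rewrite mxE.
    by case: eqP => // jk; rewrite -jk js in ks.
  rewrite (eqJ (fun w j => T k j * w)) (eqJ (fun w j => `|T k j| * `|w|)).
  rewrite mxE eqxx.
  have Tk : T k k != 0 by apply: dT; rewrite mem_rcons inE eqxx.
  have ht := fdot_le fl u_ge0 hE h_le (fun j => T k j) (fun j => y0 j 0) (hJ k).
  rewrite -/t in ht.
  have hp := fl_sub_le fl u_ge0 hE K_gt0 (c k 0) t; rewrite -/p in hp.
  have hz := fl_div_le fl u_ge0 hE K_gt0 p Tk; rewrite -/z in hz.
  have hz' : `|T k k * z - p| <= h * `|p|.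
    have -> : T k k * z - p = T k k * (z - p / T k k) by rewrite mulrBr mulrCA divff ?mulr1.
    rewrite normrM; apply: le_trans (_ : `|T k k| * (h * `|p / T k k|) <= _).
      by rewrite ler_wpM2l.
    by rewrite mulrCA -normrM mulrCA divff ?mulr1.
  rewrite -normrM.
  set X := T k k * z in hz' *; set d := c k 0 - t in hp.
  set S := \sum_(j <- J k) T k j * y0 j 0 in ht *.
  set A := \sum_(j <- J k) `|T k j| * `|y0 j 0| in ht *.
  have -> : c k 0 - (S + X) = (t - S) - ((p - d) + (X - p)) by rewrite /d; ring.
  apply: le_trans (ler_normB _ _) _.
  have := ler_normD (p - d) (X - p).
  have pX : `|p| <= `|X| + `|X - p|.
    have {1}-> : p = X - (X - p) by ring.
    exact: ler_normB.
  have dp : `|d| <= `|p| + `|p - d|.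
    have {1}-> : d = p - (p - d) by ring.
    exact: ler_normB.
  have X0 := normr_ge0 X.
  have A0 : 0 <= A by apply: sumr_ge0 => j _; rewrite mulr_ge0.
  have p1 : h * `|p| <= 1 / 1000 * `|p| by rewrite ler_wpM2r.
  have d1 : h * `|d| <= 1 / 1000 * `|d| by rewrite ler_wpM2r.
  (* All intermediate values are comparable with |T_kk z|. The inner product then contributes h A,
     the subtraction 4 h |X| and the division 2 h |X|, which the factor 7 covers. *)
  have p2 : `|p| <= 2 * `|X| by lra.
  have d2 : `|d| <= 4 * `|X| by lra.
  have p3 : h * `|p| <= h * (2 * `|X|) by rewrite ler_wpM2l.
  have d3 : h * `|d| <= h * (4 * `|X|) by rewrite ler_wpM2l.
  have hA : 0 <= h * A by rewrite mulr_ge0.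
  have hX : 0 <= h * `|X| by rewrite mulr_ge0.
  lra.
(* A row solved before: the update at k touches neither y_i nor any y_j with j in [J i]. *)
- rewrite /solve_row /=; set z := fl_div _ _ _.
  have ik : (i == k) = false by apply/eqP => ik; rewrite -ik is_ in ks.
  have Ji : {subset J i <= s}.
    case/splitPr: (is_) (sJ') => s1 s2 sJ'' j /(sJ'' s1 i s2 erefl).
    by rewrite mem_cat => ->.
  have eqJ (F : R -> 'I_n -> R) : \sum_(j <- J i) F (update y0 k z j 0) j =
      \sum_(j <- J i) F (y0 j 0) j.
    apply: eq_big_seq => j /Ji js; rewrite mxE.
    by case: eqP => // jk; rewrite -jk js in ks.
  rewrite (eqJ (fun w j => T i j * w)) (eqJ (fun w j => `|T i j| * `|w|)).
  by rewrite mxE ik; apply: IH.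
Qed.

Lemma sum_support n (J : seq 'I_n) i (F : 'I_n -> R) : uniq J -> i \notin J ->
  (forall j, j \notin J -> j != i -> F j = 0) ->
  \sum_(j <- J) F j + F i = \sum_j F j.
Proof.
move=> uJ iJ hF; rewrite (bigD1 i) //= addrC; congr (_ + _).
rewrite big_uniq // [LHS]big_mkcond [RHS]big_mkcond; apply: eq_bigr => j _ /=.
have [jJ|jJ] := boolP (j \in J); first by case: eqP => // ji; rewrite -ji jJ in iJ.
by have [->//|ji] := eqVneq j i; rewrite hF.
Qed.

Lemma triangular_solve_residual n (T : 'M[R]_n) (c : 'cV_n) (J : 'I_n -> seq 'I_n) s (t : R) :
  uniq s -> (forall i, i \in s) -> (forall i, T i i != 0) ->
  (forall s1 i s2, s = s1 ++ i :: s2 -> {subset J i <= s1}) ->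
  (forall i, uniq (J i)) -> (forall i, i \notin J i) ->
  (forall i j, j \notin J i -> j != i -> T i j = 0) ->
  (n < K)%N -> (forall i j, `|T i j| <= t) ->
  forall y, y = (loop s (fun i => solve_row fl T c (J i) i) 0).1 ->
  norm2 (T *m y - c) <= h * (7 * n%:R ^+ 2 * t) * norm2 y.
Proof.
move=> us ss dT sJ uJ iJ zT nK hT y yE.
have hJ i : (size (J i) < K)%N.
  apply: leq_ltn_trans nK.
  by rewrite -[X in (_ <= X)%N]size_enum_ord; apply: uniq_leq_size => // j; rewrite mem_enum.
apply: le_trans (_ : n%:R * (7 * h * (n%:R * t * norm2 y)) <= _); last first.
  by rewrite le_eqVlt; apply/orP; left; apply/eqP; ring.
apply: norm2_le_max => i.
have := solve_rows_residual c us (fun i _ => dT i) sJ hJ (ss i).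
rewrite -yE (@sum_support _ (J i) i (fun j => T i j * y j 0)) //; last first.
  by move=> j j1 j2; rewrite zT ?mul0r.
rewrite (@sum_support _ (J i) i (fun j => `|T i j| * `|y j 0|)) //; last first.
  by move=> j j1 j2; rewrite zT ?normr0 ?mul0r.
rewrite !mxE distrC => H; apply: le_trans H _.
rewrite ler_wpM2l ?mulr_ge0 //.
apply: le_trans (_ : \sum_j t * `|y j 0| <= _).
  by apply: ler_sum => j _; rewrite ler_wpM2r.
rewrite -big_distrr /= mulrAC [leRHS]mulrC ler_wpM2l ?sum_abs_le //.
by rewrite (le_trans _ (hT i i)).
Qed.

Lemma enum_ord_split n (s1 s2 : seq 'I_n) i :
  enum 'I_n = s1 ++ i :: s2 -> forall j : 'I_n, (j \in s1) = (j < i)%N.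
Proof.
move=> e j.
have us : uniq (s1 ++ i :: s2) by rewrite -e enum_uniq.
have hi : size s1 = i.
  have := index_enum_ord i; rewrite e index_cat.
  move: us; rewrite cat_uniq => /and3P[_ /= + _]; rewrite negb_or => /andP[/negPf -> _].
  by rewrite eqxx addn0.
have := index_enum_ord j; rewrite e index_cat.
case: ifP => [js|js] <-; first by rewrite -hi index_mem js.
by rewrite -hi ltnNge leq_addr.
Qed.

Lemma forward_subst_residual n (L : 'M[R]_n) c (t : R) : (n < K)%N ->
  (forall i, L i i != 0) -> (forall i j : 'I_n, (i < j)%N -> L i j = 0) ->
  (forall i j, `|L i j| <= t) ->
  forall y, y = (forward_subst fl L c).1 ->
  norm2 (L *m y - c) <= h * (7 * n%:R ^+ 2 * t) * norm2 y.
Proof.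
move=> nK dL zL hL y yE; apply: (triangular_solve_residual _ _ _ _ _ _ _ _ _ yE) => //.
- exact: enum_uniq.
- by move=> i; rewrite mem_enum.
- by move=> s1 i s2 /enum_ord_split e j; rewrite mem_filter e => /andP[].
- by move=> i; rewrite filter_uniq // enum_uniq.
- by move=> i; rewrite mem_filter ltnn.
move=> i j; rewrite mem_filter mem_enum andbT -leqNgt => ij ji; apply: zL.
by rewrite ltn_neqAle eq_sym ji.
Qed.

Lemma back_subst_residual n (U : 'M[R]_n) c (t : R) : (n < K)%N ->
  (forall i, U i i != 0) -> (forall i j : 'I_n, (j < i)%N -> U i j = 0) ->
  (forall i j, `|U i j| <= t) ->
  forall y, y = (back_subst fl U c).1 ->
  norm2 (U *m y - c) <= h * (7 * n%:R ^+ 2 * t) * norm2 y.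
Proof.
move=> nK dU zU hU y yE; apply: (triangular_solve_residual _ _ _ _ _ _ _ _ _ yE) => //.
- by rewrite rev_uniq enum_uniq.
- by move=> i; rewrite mem_rev mem_enum.
- move=> s1 i s2 e j; rewrite mem_filter mem_enum andbT => ij.
  have e' : enum 'I_n = rev s2 ++ i :: rev s1.
    by rewrite -[LHS]revK e rev_cat rev_cons cat_rcons.
  have : j \in enum 'I_n by rewrite mem_enum.
  rewrite e' mem_cat (enum_ord_split e') inE mem_rev ltnNge (ltnW ij) /=.
  by case: eqP ij => // ->; rewrite ltnn.
- by move=> i; rewrite filter_uniq // enum_uniq.
- by move=> i; rewrite mem_filter ltnn.
move=> i j; rewrite mem_filter mem_enum andbT -leqNgt => ij ji; apply: zU.
by rewrite ltn_neqAle ji.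
Qed.

End TriangularSolve.

(** * Householder QR *)

Section Householder.
Variables (R : realType) (u : R) (fl : fp_arith u) (K : nat) (h : R).
Hypotheses (u_ge0 : 0 <= u) (hE : h = 2 * K%:R * u) (h_le : h <= 1 / 1000)
  (K_gt0 : (0 < K)%N).

Lemma tail_sum d (k : nat) (F : 'I_d -> R) :
  \sum_(i <- [seq i : 'I_d <- enum 'I_d | (k <= i)%N]) F i =
  \sum_(i < d) (if (i < k)%N then 0 else F i).
Proof.
rewrite big_filter big_enum_cond big_mkcond; apply: eq_bigr => i _ /=.
by rewrite leqNgt; case: (i < k)%N.
Qed.

Lemma size_tail d (k : nat) : (size [seq i : 'I_d <- enum 'I_d | (k <= i)%N] <= d)%N.
Proof. by rewrite size_filter (leq_trans (count_size _ _)) // size_enum_ord. Qed.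

Lemma dot_delta d (v : 'cV[R]_d) k : dot v (delta_mx k 0) = v k 0.
Proof.
rewrite /dot (bigD1 k) //= big1 => [|i /negPf ik]; first by rewrite mxE !eqxx mulr1 addr0.
by rewrite mxE ik mulr0.
Qed.

Lemma entryE d (y : 'cV[R]_d) (k : 'I_d) : entry y k = y k 0.
Proof. by rewrite /entry valK. Qed.

Lemma reflection_mulmx d (v : 'cV[R]_d) (beta : R) w :
  (1%:M - beta *: (v *m v^T)) *m w = w - (beta * dot v w) *: v.
Proof.
rewrite mulmxBl mul1mx -scalemxAl -mulmxA.
have -> : v^T *m w = (dot v w)%:M.
  apply/matrixP => i j; rewrite !ord1 !mxE /dot eqxx mulr1n.
  by apply: eq_bigr => l _; rewrite mxE.
by rewrite mul_mx_scalar scalerA.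
Qed.

Lemma reflection_orthogonal d (v : 'cV[R]_d) (beta : R) : beta * dot v v = 2 ->
  let H := 1%:M - beta *: (v *m v^T) in H^T *m H = 1%:M.
Proof.
move=> bv H.
have HT : H^T = H.
  by rewrite /H linearB /= trmx1 linearZ /= trmx_mul trmxK.
rewrite HT; apply/matrixP => i j.
have -> : (H *m H) i j = (H *m (H *m delta_mx j (0 : 'I_1))) i 0.
  by rewrite mulmxA mulmx_delta [RHS]mxE.
rewrite !reflection_mulmx dotBr dotZr dot_delta !mxE.
rewrite eqxx andbT.
have -> : beta * v j 0 * dot v v = 2 * v j 0 by rewrite mulrAC bv.
ring.
Qed.

Lemma relative_error_mul (x x' y y' a b : R) : 0 <= a ->
  `|x' - x| <= a * `|x| -> `|y' - y| <= b * `|y| ->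
  `|x' * y' - x * y| <= (a + b + a * b) * `|x * y|.
Proof.
move=> a0 hx hy.
have -> : x' * y' - x * y = (x' - x) * y + x * (y' - y) + (x' - x) * (y' - y) by ring.
apply: le_trans (ler_normD _ _) _; rewrite [leRHS]mulrDl lerD //; last first.
  by rewrite !normrM mulrACA ler_pM.
apply: le_trans (ler_normD _ _) _; rewrite [leRHS]mulrDl lerD // !normrM.
  by rewrite mulrA ler_wpM2r.
by rewrite mulrCA ler_wpM2l.
Qed.

Lemma error_trans (x y z a b : R) :
  `|x - y| <= a -> `|y - z| <= b -> `|x - z| <= a + b.
Proof.
move=> h1 h2; have -> : x - z = (x - y) + (y - z) by ring.
by apply: le_trans (ler_normD _ _) _; rewrite lerD.
Qed.

Lemma abs_le_error (x y a b : R) : `|x - y| <= a -> `|y| <= b -> `|x| <= a + b.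
Proof.
move=> h1 h2; have -> : x = (x - y) + y by ring.
by apply: le_trans (ler_normD _ _) _; rewrite lerD.
Qed.

(** t - T factors as (sqrt t - sqrt T) (sqrt t + sqrt T), and the second factor is at least sqrt T,
    so the relative error does not grow. *)
Lemma sqrt_error (t T : R) : 0 <= T -> `|t - T| <= h * T ->
  `|Num.sqrt t - Num.sqrt T| <= h * Num.sqrt T.
Proof.
have h0 : 0 <= h := h_ge0 u_ge0 hE.
move=> T0; have [->|Tn0] := eqVneq T 0.
  by rewrite mulr0 normr_le0 subr0 => /eqP ->; rewrite subrr normr0 sqrtr0 mulr0.
move=> ht; have t0 : 0 <= t.
  have : h * T <= 1 / 1000 * T by rewrite ler_wpM2r.
  move: ht; rewrite ler_norml => /andP[h1 h2]; lra.
have s0 : 0 < Num.sqrt T by rewrite sqrtr_gt0 lt_def Tn0.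
rewrite -(ler_pM2r s0) -mulrA -[X in h * X]expr2 sqr_sqrtr //; apply: le_trans ht.
have -> : t - T = (Num.sqrt t - Num.sqrt T) * (Num.sqrt t + Num.sqrt T).
  by rewrite -subr_sqr !sqr_sqrtr.
rewrite normrM ler_wpM2l // ger0_norm ?addr_ge0 ?sqrtr_ge0 //.
by rewrite lerDr sqrtr_ge0.
Qed.

(** The hypothesis on [a] gives w' >= 49/50 w, and 50/49 <= 26/25. *)
Lemma inv_error (w w' a : R) : 0 < w -> 0 <= a <= 1 / 50 -> `|w' - w| <= a * w ->
  0 < w' /\ `|1 / w' - 1 / w| <= (26 / 25 * a) * w^-1.
Proof.
move=> w0 /andP[a0 a1] hw.
have aw : a * w <= 1 / 50 * w by rewrite ler_wpM2r // ltW.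
have w1 : 49 / 50 * w <= w' by move: hw; rewrite ler_norml => /andP[h1 h2]; lra.
have w'0 : 0 < w' by lra.
split => //.
have -> : 1 / w' - 1 / w = - (w' - w) / (w' * w).
  by field; rewrite !gt_eqF.
rewrite normrM normrN normfV (gtr0_norm (mulr_gt0 w'0 w0)).
rewrite ler_pdivrMr ?mulr_gt0 //.
have -> : 26 / 25 * a / w * (w' * w) = 26 / 25 * a * w' by field; rewrite gt_eqF.
apply: le_trans hw _.
have : a * (49 / 50 * w) <= a * w' by rewrite ler_wpM2l.
have : 0 <= a * w by rewrite mulr_ge0 // ltW.
lra.
Qed.

(** Every error is of order h beta |v|^2 |w|, and [beta * dot v v = 2] turns this into a multiple of
    h |w| whatever the length of v. The tolerances 5 h and 12 h are those that [make_reflector]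
    achieves; the factor d comes from bounding entry by entry. *)
Lemma apply_reflector_error d (k : nat) (v v' : 'cV[R]_d) (beta beta' : R) w :
  (d < K)%N -> 0 < beta -> beta * dot v v = 2 ->
  (forall i : 'I_d, (i < k)%N -> v i 0 = 0) ->
  (forall i, `|v' i 0 - v i 0| <= 5 * h * `|v i 0|) ->
  `|beta' - beta| <= 12 * h * beta ->
  norm2 ((apply_reflector fl (k, v', beta') w).1
         - (1%:M - beta *: (v *m v^T)) *m w) <= 100 * d%:R * h * norm2 w.
Proof.
have h0 : 0 <= h := h_ge0 u_ge0 hE.
move=> dK b0 bv vz hv hb.
rewrite reflection_mulmx /=.
set V := norm2 v; set Y := norm2 w.
have V0 : 0 <= V by exact: norm2_ge0.
have Y0 : 0 <= Y by exact: norm2_ge0.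
have VY0 : 0 <= V * Y by rewrite mulr_ge0.
set s := [seq i : 'I_d <- _ | _]; set t := (fdot fl s _ _).1.
have v'z (i : 'I_d) : (i < k)%N -> v' i 0 = 0.
  by move=> ik; apply/eqP; have := hv i; rewrite vz // normr0 mulr0 normr_le0 subr0.
have hv' i : `|v' i 0| <= (1 + 5 * h) * `|v i 0|.
  apply: le_trans (abs_le_error (hv i) (lexx _)) _; lra.
have S0 : \sum_i `|v i 0| * `|w i 0| <= V * Y by exact: sum_abs_cauchy.
have ht : `|t - dot v w| <= 7 * h * (V * Y).
  have e1 : `|t - \sum_i v' i 0 * w i 0| <= h * ((1 + 5 * h) * (V * Y)).
    have := fdot_le fl u_ge0 hE h_le (fun i => v' i 0) (fun i => w i 0)
      (leq_ltn_trans (size_tail d k) dK).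
    rewrite !tail_sum -/s -/t.
    rewrite (eq_bigr (fun i => v' i 0 * w i 0)); last first.
      by move=> i _; case: ifP => // ik; rewrite v'z // mul0r.
    move=> H; apply: le_trans H _; rewrite ler_wpM2l //.
    apply: le_trans (_ : \sum_i (1 + 5 * h) * (`|v i 0| * `|w i 0|) <= _).
      apply: ler_sum => i _; case: ifP => _; first by rewrite !mulr_ge0 //; lra.
      by rewrite mulrA ler_wpM2r.
    by rewrite -big_distrr /= ler_wpM2l //; lra.
  have e2 : `|\sum_i v' i 0 * w i 0 - dot v w| <= 5 * h * (V * Y).
    rewrite /dot -sumrB; apply: le_trans (ler_norm_sum _ _ _) _.
    apply: le_trans (_ : \sum_i 5 * h * (`|v i 0| * `|w i 0|) <= _).
      by apply: ler_sum => i _; rewrite -mulrBl normrM mulrA ler_wpM2r.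
    by rewrite -big_distrr /= ler_wpM2l //; lra.
  apply: le_trans (error_trans e1 e2) _.
  have : h * (h * (V * Y)) <= 1 / 1000 * (h * (V * Y)) by rewrite ler_wpM2r // mulr_ge0.
  have : 0 <= h * (V * Y) by rewrite mulr_ge0.
  lra.
have hd : `|dot v w| <= V * Y by exact: norm2_cauchy.
set g := beta * dot v w.
set Z := beta * (V * Y).
have Z0 : 0 <= Z by rewrite mulr_ge0 // ltW.
have hZ0 : 0 <= h * Z by rewrite mulr_ge0.
have hhZ : h * (h * Z) <= 1 / 1000 * (h * Z) by rewrite ler_wpM2r.
have hg : `|g| <= Z by rewrite /g normrM (gtr0_norm b0) /Z ler_wpM2l // ltW.
set g' := fl_mul fl beta' t.
have hg' : `|g' - g| <= 22 * h * Z.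
  have e1 : `|beta' * t - g| <= 20 * h * Z.
    have -> : beta' * t - g = (beta' - beta) * t + beta * (t - dot v w).
      by rewrite /g; ring.
    apply: le_trans (ler_normD _ _) _; rewrite !normrM (gtr0_norm b0).
    have f1 : `|beta' - beta| * `|t| <= 12 * h * beta * (7 * h * (V * Y) + V * Y).
      by apply: ler_pM => //; exact: (abs_le_error ht hd).
    have f2 : beta * `|t - dot v w| <= beta * (7 * h * (V * Y)).
      by rewrite ler_wpM2l // ltW.
    rewrite /Z in hhZ hZ0 *; lra.
  have e2 := fl_mul_le fl u_ge0 hE K_gt0 beta' t; rewrite -/g' in e2.
  have e3 : h * `|beta' * t| <= h * (20 * h * Z + Z).
    by rewrite ler_wpM2l //; exact: (abs_le_error e1 hg).
  apply: le_trans (error_trans e2 e1) _; lra.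
have VV i : `|v i 0| <= V by exact: entry_le_norm2.
have ZV : Z * V = 2 * Y.
  by rewrite /Z -bv -sqr_norm2 -/V; ring.
have hY0 : 0 <= h * Y by rewrite mulr_ge0.
have hhY : h * (h * Y) <= 1 / 1000 * (h * Y) by rewrite ler_wpM2r.
apply: le_trans (_ : d%:R * (100 * h * Y) <= _); last first.
  by rewrite le_eqVlt; apply/orP; left; apply/eqP; ring.
apply: norm2_le_max => i; rewrite !mxE -/g.
case: ifP => ik.
  by rewrite /= vz // mulr0 subr0 subrr normr0 !mulr_ge0.
rewrite /=.
have hgv : `|g * v i 0| <= 2 * Y by rewrite normrM -ZV ler_pM.
have p1 : `|g' * v' i 0 - g * v i 0| <= 56 * h * Y.
  have -> : g' * v' i 0 - g * v i 0 = (g' - g) * v' i 0 + g * (v' i 0 - v i 0) by ring.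
  apply: le_trans (ler_normD _ _) _; rewrite (normrM (g' - g)) (normrM g).
  have f1 : `|g' - g| * `|v' i 0| <= 22 * h * Z * ((1 + 5 * h) * V).
    apply: ler_pM => //; apply: le_trans (hv' i) _; rewrite ler_wpM2l //; lra.
  have f2 : `|g| * `|v' i 0 - v i 0| <= Z * (5 * h * V).
    apply: ler_pM => //; apply: le_trans (hv i) _; rewrite ler_wpM2l //; lra.
  have f3 : 22 * h * Z * ((1 + 5 * h) * V) = 44 * h * Y + 220 * (h * (h * Y)).
    have -> : 22 * h * Z * ((1 + 5 * h) * V) = 22 * h * (1 + 5 * h) * (Z * V) by ring.
    rewrite ZV; ring.
  have f4 : Z * (5 * h * V) = 10 * h * Y.
    have -> : Z * (5 * h * V) = 5 * h * (Z * V) by ring.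
    rewrite ZV; ring.
  lra.
have p2 := fl_mul_le fl u_ge0 hE K_gt0 g' (v' i 0).
have p3 := abs_le_error p1 hgv.
have p4 : h * `|g' * v' i 0| <= h * (56 * h * Y + 2 * Y) by rewrite ler_wpM2l.
set p := fl_mul fl g' (v' i 0) in p2 *.
have p5 : `|p - g * v i 0| <= 59 * h * Y.
  apply: le_trans (error_trans p2 p1) _; lra.
have p6 : `|(w i 0 - p) - (w i 0 - g * v i 0)| <= 59 * h * Y.
  have -> : (w i 0 - p) - (w i 0 - g * v i 0) = - (p - g * v i 0) by ring.
  by rewrite normrN.
have wY : `|w i 0| <= Y by exact: entry_le_norm2.
have p7 : `|w i 0 - p| <= 59 * h * Y + 3 * Y.
  apply: le_trans (abs_le_error p6 (lexx _)) _.
  have := ler_normB (w i 0) (g * v i 0); lra.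
have p8 := fl_sub_le fl u_ge0 hE K_gt0 (w i 0) p.
have p9 : h * `|w i 0 - p| <= h * (59 * h * Y + 3 * Y) by rewrite ler_wpM2l.
apply: le_trans (error_trans p8 p6) _; lra.
Qed.

End Householder.

(** * Accuracy of a computed reflector *)

Section HouseholderStep.
Variables (R : realType) (u : R) (fl : fp_arith u) (K : nat) (h : R).
Hypotheses (u_ge0 : 0 <= u) (hE : h = 2 * K%:R * u) (h_le : h <= 1 / 1000)
  (K_gt0 : (0 < K)%N).

(** [H] is the exact reflector for the vector [y] at hand, or the identity if its tail vanishes. The
    sign choice gives |v_k| = |y_k| + |y_(k..)|, so the addition forming v_k suffers no cancellation
    and v, s v_k and beta all have relative errors O(h). *)
Lemma make_reflector_error d (k : 'I_d) (y : 'cV[R]_d) hs : (d < K)%N ->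
  hs = (make_reflector fl k y).1 ->
  exists H : 'M[R]_d, [/\ H^T *m H = 1%:M,
    (forall w : 'cV_d, (forall i : 'I_d, (k <= i)%N -> w i 0 = 0) -> H *m w = w),
    (forall w, norm2 ((apply_reflector fl hs.1 w).1 - H *m w)
      <= 100 * d%:R * h * norm2 w)
  & norm2 (\col_(i < d) (if (i < k)%N then y i 0
                         else if i == k :> nat then - hs.2 else 0) - H *m y)
      <= 100 * d%:R * h * norm2 y].
Proof.
have h0 : 0 <= h := h_ge0 u_ge0 hE.
move=> dK -> /=; rewrite entryE.
set s := [seq i : 'I_d <- _ | _]; set t := (fdot fl s _ _).1.
set r := fl_sqrt fl t; set s' := if _ then - r else r.
set p := fl_add fl (y k 0) s'; set w' := fl_mul fl s' p.
set beta' := fl_div fl 1 w'; set v' := \col_i _.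
have h50 : 10 * h <= 1 / 50 by have := h_le; lra.
have d0 : 1 <= d%:R :> R by rewrite ler1n (leq_trans _ (ltn_ord k)).
pose yt : 'cV[R]_d := \col_i (if (i < k)%N then 0 else y i 0).
pose T := dot yt yt.
have T0 : 0 <= T by exact: dot_ge0.
have ht : `|t - T| <= h * T.
  have := fdot_le fl u_ge0 hE h_le (fun i => y i 0) (fun i => y i 0)
      (leq_ltn_trans (size_tail d k) dK).
  rewrite !tail_sum -/s -/t.
  have e1 : \sum_(i < d) (if (i < k)%N then 0 else y i 0 * y i 0) = T.
    by apply: eq_bigr => i _; rewrite !mxE; case: ifP => _ //; rewrite mul0r.
  have e2 : \sum_(i < d) (if (i < k)%N then 0 else `|y i 0| * `|y i 0|) = T.
    rewrite -e1; apply: eq_bigr => i _; case: ifP => _ //.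
    by rewrite -expr2 real_normK ?num_real // expr2.
  by rewrite e1 e2.
have hsq := sqrt_error u_ge0 hE h_le T0 ht.
have t0 : 0 <= t.
  have : h * T <= 1 / 1000 * T by rewrite ler_wpM2r.
  move: ht; rewrite ler_norml => /andP[h1 h2]; lra.
have hr := fl_sqrt_le fl u_ge0 hE K_gt0 t0; rewrite -/r in hr.
pose sg := Num.sqrt T; rewrite -/sg in hsq.
have sg0 : 0 <= sg by exact: sqrtr_ge0.
have hsg0 : 0 <= h * sg by rewrite mulr_ge0.
have hhsg : h * (h * sg) <= 1 / 1000 * (h * sg) by rewrite ler_wpM2r.
have hrs : `|r - sg| <= 3 * h * sg.
  apply: le_trans (error_trans hr hsq) _.
  have : Num.sqrt t <= h * sg + sg.
    by apply: le_trans (abs_le_error hsq (_ : `|sg| <= sg)); rewrite ?ler_norm // ger0_norm.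
  move=> /(ler_wpM2l h0); lra.
pose sx := if y k 0 < 0 then - sg else sg.
have hs' : `|s' - sx| <= 3 * h * sg.
  by rewrite /s' /sx; case: ifP => // _; rewrite -opprD normrN.
have sx2 : sx * sx = T.
  have -> : sx * sx = sg ^+ 2 by rewrite /sx; case: ifP => _; ring.
  by rewrite sqr_sqrtr.
have ytk : yt k 0 = y k 0 by rewrite mxE ltnn.
have [Tz|Tn0] := eqVneq T 0.
  (* The reflector computed from a zero tail has v = 0: it acts as the identity,
     whatever the value of the division 1 / 0. *)
  have yz : yt = 0 by exact: dot_eq0.
  have yk0 : y k 0 = 0 by rewrite -ytk yz mxE.
  have sz : sg = 0 by rewrite /sg Tz sqrtr0.
  have s'z : s' = 0.
    by apply/eqP; move: hs'; rewrite /sx yk0 ltxx sz mulr0 subr0 normr_le0.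
  have pz : p = 0.
    by apply/eqP; have := fl_addP fl (y k 0) s'; rewrite -/p yk0 s'z addr0 normr0 mulr0 subr0 normr_le0.
  have v'z : v' = 0.
    apply/colP => i; rewrite !mxE; case: ifP => // ik; case: ifP => // _.
    by have := congr1 (fun z : 'cV_d => z i 0) yz; rewrite !mxE ik.
  exists 1%:M; split.
  - by rewrite trmx1 mul1mx.
  - by move=> w _; rewrite mul1mx.
  - move=> w; rewrite mul1mx v'z /=.
    apply: le_trans (_ : h * norm2 w <= _); last first.
      rewrite ler_wpM2r ?norm2_ge0 //.
      have : h * 1 <= h * d%:R by rewrite ler_wpM2l.
      by lra.
    set t1 := (fdot fl s _ _).1.
    have t1z : t1 = 0.
      have := fdot_le fl u_ge0 hE h_le (fun i => (0 : 'cV[R]_d) i 0) (fun i => w i 0)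
        (leq_ltn_trans (size_tail d k) dK).
      rewrite !tail_sum big1; last by move=> i _; rewrite !mxE mul0r if_same.
      rewrite big1; last by move=> i _; rewrite !mxE normr0 mul0r if_same.
      by rewrite mulr0 subr0 normr_le0 => /eqP.
    have gz : fl_mul fl beta' t1 = 0.
      by apply/eqP; have := fl_mulP fl beta' t1; rewrite t1z mulr0 normr0 mulr0 subr0 normr_le0.
    rewrite (_ : h * norm2 w = norm2 (h *: w)); last by rewrite norm2Z ger0_norm.
    apply: norm2_le_entry => i; rewrite !mxE /= gz.
    case: ifP => _ /=; first by rewrite subrr normr0.
    have -> : fl_mul fl 0 0 = 0.
      by apply/eqP; have := fl_mulP fl 0 0; rewrite mulr0 normr0 mulr0 subr0 normr_le0.
    (* Subtracting 0 may still round, so the application is the identity only up to h |w|. *)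
    have := fl_sub_le fl u_ge0 hE K_gt0 (w i 0) 0; rewrite subr0 => H.
    by rewrite normrM (ger0_norm h0).
  - rewrite mul1mx; set c := \col_i _; have -> : c = y.
      apply/colP => i; rewrite !mxE; case: ifP => // ik; case: eqP => [/val_inj ->|_].
        by rewrite s'z oppr0 yk0.
      by have := congr1 (fun z : 'cV_d => z i 0) yz; rewrite !mxE ik.
    by rewrite subrr norm20 !mulr_ge0 // norm2_ge0.
have Tp : 0 < T by rewrite lt_def Tn0.
have sgp : 0 < sg by rewrite sqrtr_gt0.
pose v : 'cV[R]_d := yt + sx *: delta_mx k 0.
have vk : v k 0 = y k 0 + sx by rewrite !mxE ltnn !eqxx mulr1.
have v_other (i : 'I_d) : i != k -> v i 0 = yt i 0.
  by move=> /negPf ik; rewrite !mxE ik /= mulr0 addr0.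
have vka : `|v k 0| = `|y k 0| + sg.
  rewrite vk /sx; case: ltP => hy.
    by rewrite ltr0_norm ?(ltr0_norm hy) ?opprD //; lra.
  by rewrite ger0_norm ?(ger0_norm hy) //; lra.
pose w := sx * v k 0.
have wE : w = sg * `|v k 0|.
  rewrite vka /w vk /sx; case: ltP => hy.
    by rewrite (ltr0_norm hy); ring.
  by rewrite (ger0_norm hy).
have vkp : 0 < `|v k 0| by rewrite vka ltr_wpDl.
have wp : 0 < w by rewrite wE mulr_gt0.
have vv : dot v v = 2 * w.
  rewrite dotDl !dotDr !dotZl !dotZr (dotC (delta_mx k 0) yt) !dot_delta -/T ytk mxE !eqxx /=.
  rewrite /w vk -sx2; ring.
(* With beta = 1 / w this yields H y = y - v, the vector with -s in row k and zeros below. *)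
have vy : dot v y = w.
  have -> : dot v y = dot yt y + sx * y k 0.
    by rewrite dotDl dotZl (dotC (delta_mx k 0)) dot_delta.
  have -> : dot yt y = T.
    by apply: eq_bigr => i _; rewrite !mxE; case: ifP => _ //; rewrite !mul0r.
  rewrite /w vk -sx2; ring.
set a := `|v k 0| in vka wE vkp.
(* The sign choice pays off here: an error relative to [sg] in s is also small relative to v_k. *)
have sga : sg <= a by rewrite vka lerDr.
have hha : h * (h * a) <= 1 / 1000 * (h * a).
  by rewrite ler_wpM2r // mulr_ge0 // ltW.
have ha : h * sg <= h * a by rewrite ler_wpM2l.
have ha0 : 0 <= h * a by rewrite mulr_ge0 // ltW.
have hp : `|p - v k 0| <= 5 * h * a.
  have e1 : `|(y k 0 + s') - v k 0| <= 3 * h * a.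
    rewrite vk; have -> : y k 0 + s' - (y k 0 + sx) = s' - sx by ring.
    apply: le_trans hs' _; lra.
  have e2 := fl_add_le fl u_ge0 hE K_gt0 (y k 0) s'; rewrite -/p in e2.
  have e3 : h * `|y k 0 + s'| <= h * (3 * h * a + a).
    by rewrite ler_wpM2l //; exact: (abs_le_error e1 (lexx _)).
  apply: le_trans (error_trans e2 e1) _; lra.
have hw : `|w' - w| <= 10 * h * w.
  have sgE : `|sx| = sg by rewrite /sx; case: ifP => _; rewrite ?normrN ger0_norm.
  have hs2 : `|s' - sx| <= 3 * h * `|sx| by rewrite sgE.
  have e1 := relative_error_mul (_ : 0 <= 3 * h) hs2 hp.
  rewrite -/w (gtr0_norm wp) in e1.
  have {}e1 : `|s' * p - w| <= (8 * h + 15 * (h * h)) * w.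
    apply: le_trans (e1 _) _; first by rewrite mulr_ge0.
    by rewrite ler_wpM2r ?(ltW wp) //; lra.
  have e2 := fl_mul_le fl u_ge0 hE K_gt0 s' p; rewrite -/w' in e2.
  have e3 : h * `|s' * p| <= h * ((8 * h + 15 * (h * h)) * w + w).
    by rewrite ler_wpM2l //; apply: (abs_le_error e1); rewrite gtr0_norm.
  apply: le_trans (error_trans e2 e1) _.
  have hw0 : 0 <= h * w by rewrite mulr_ge0 // ltW.
  have hhw : h * (h * w) <= 1 / 1000 * (h * w) by rewrite ler_wpM2r.
  have hhhw : h * (h * (h * w)) <= 1 / 1000 * (h * (h * w)) by rewrite ler_wpM2r // mulr_ge0.
  lra.
pose beta := w^-1.
have bp : 0 < beta by rewrite invr_gt0.
(* The 10 h of w' is amplified by 26/25 in the inversion, and the division adds about one more h. *)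
have hb : `|beta' - beta| <= 12 * h * beta.
  have [|w'0 e1] := inv_error wp _ hw; first by rewrite h50 mulr_ge0.
  rewrite div1r -/beta in e1.
  have e2 := fl_div_le fl u_ge0 hE K_gt0 1 (lt0r_neq0 w'0); rewrite -/beta' div1r in e2.
  rewrite div1r in e1.
  have e3 : h * `|w'^-1| <= h * (26 / 25 * (10 * h) * beta + beta).
    by rewrite ler_wpM2l //; apply: (abs_le_error e1); rewrite gtr0_norm.
  apply: le_trans (error_trans e2 e1) _.
  have hw0 : 0 <= h * beta by rewrite mulr_ge0 // ltW.
  have hhw : h * (h * beta) <= 1 / 1000 * (h * beta) by rewrite ler_wpM2r.
  lra.
have bv2 : beta * dot v v = 2 by rewrite vv /beta mulrCA mulVf ?mulr1 // gt_eqF.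
exists (1%:M - beta *: (v *m v^T)); split.
- exact: reflection_orthogonal.
- move=> z hz; rewrite reflection_mulmx.
  have -> : dot v z = 0.
    apply: big1 => i _; have [ki|ik] := leqP k i; first by rewrite hz ?mulr0.
    by rewrite v_other ?mxE ?ik ?mul0r // neq_ltn ik.
  by rewrite mulr0 scale0r subr0.
- move=> z; apply: (apply_reflector_error fl u_ge0 hE h_le K_gt0) => //.
    by move=> i ik; rewrite v_other ?mxE ?ik // neq_ltn ik.
  move=> i; have [->|ik] := eqVneq i k.
    by rewrite [v' k 0]mxE ltnn eqxx.
  rewrite v_other // !mxE (negPf ik : (i == k :> nat) = false) subrr normr0.
  by rewrite !mulr_ge0.
- rewrite reflection_mulmx vy /beta mulVf ?gt_eqF // scale1r.
  apply: le_trans (_ : d%:R * (3 * h * norm2 y) <= _); last first.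
    have : 0 <= d%:R * (h * norm2 y) by rewrite !mulr_ge0 ?norm2_ge0.
    lra.
  have sgy : sg <= norm2 y.
    rewrite /sg /T -sqr_norm2 sqrtr_sqr ger0_norm ?norm2_ge0 //.
    by apply: norm2_le_entry => i; rewrite mxE; case: ifP => // _; rewrite normr0.
  have hy0 : h * sg <= h * norm2 y by rewrite ler_wpM2l.
  set c := \col_i _.
  have sub_entry (a1 a2 : 'cV[R]_d) i : (a1 - a2) i 0 = a1 i 0 - a2 i 0 by rewrite !mxE.
  apply: norm2_le_max => i; rewrite !sub_entry [c i 0]mxE.
  have [->|ik] := eqVneq i k.
    rewrite ltnn eqxx vk.
    have -> : - s' - (y k 0 - (y k 0 + sx)) = - (s' - sx) by ring.
    rewrite normrN; apply: le_trans hs' _; lra.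
  rewrite (negPf ik : (i == k :> nat) = false) v_other // mxE.
  have -> : (if (i < k)%N then y i 0 else 0) - (y i 0 - (if (i < k)%N then 0 else y i 0)) = 0.
    by case: ifP => _; ring.
  by rewrite normr0 !mulr_ge0 ?norm2_ge0.
Qed.

End HouseholderStep.

(** * Backward error of the whole factorization *)

Section QR.
Variables (R : realType) (u : R) (fl : fp_arith u) (K : nat) (h : R).
Hypotheses (u_ge0 : 0 <= u) (hE : h = 2 * K%:R * u) (h_le : h <= 1 / 1000)
  (K_gt0 : (0 < K)%N).

Lemma enum_ord_prefix n (s1 s2 : seq 'I_n) i :
  enum 'I_n = s1 ++ i :: s2 -> size s1 = i.
Proof.
move=> e; have us : uniq (s1 ++ i :: s2) by rewrite -e enum_uniq.
have := index_enum_ord i; rewrite e index_cat.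
move: us; rewrite cat_uniq => /and3P[_ /= + _]; rewrite negb_or => /andP[/negPf -> _].
by rewrite eqxx addn0.
Qed.

Lemma foldl_enum_ind n X (f : X -> 'I_n -> X) (I : nat -> X -> Prop) x0 :
  I 0%N x0 -> (forall (k : 'I_n) x, I k x -> I k.+1 (f x k)) ->
  I n (foldl f x0 (enum 'I_n)).
Proof.
move=> I0 IS; rewrite -[X in I X]size_enum_ord.
suff H s1 s2 : enum 'I_n = s1 ++ s2 -> I (size s1) (foldl f x0 s1).
  by apply: (H _ [::]); rewrite cats0.
elim/last_ind: s1 s2 => [//|s1 k IH] s2 e.
rewrite cat_rcons in e; rewrite size_rcons foldl_rcons (enum_ord_prefix e).
by apply: IS; rewrite -(enum_ord_prefix e); apply: IH e.
Qed.

Lemma norm2_sum (I : Type) (s : seq I) m (F : I -> 'cV[R]_m) :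
  norm2 (\sum_(i <- s) F i) <= \sum_(i <- s) norm2 (F i).
Proof.
elim: s => [|i s IH]; first by rewrite !big_nil norm20.
by rewrite !big_cons; apply: le_trans (norm2_triangle _ _) _; rewrite lerD2l.
Qed.

Lemma norm2_mulmx_col m n (M : 'M[R]_(m, n)) (c : R) w :
  (forall j, norm2 (col j M) <= c) -> norm2 (M *m w) <= n%:R * c * norm2 w.
Proof.
move=> hM.
have -> : M *m w = \sum_j w j 0 *: col j M.
  apply/colP => i; rewrite mxE summxE; apply: eq_bigr => j _.
  by rewrite !mxE mulrC.
apply: le_trans (norm2_sum _ _) _.
apply: le_trans (_ : \sum_(j < n) norm2 w * c <= _).
  by apply: ler_sum => j _; rewrite norm2Z ler_pM ?norm2_ge0 // entry_le_norm2.
by rewrite sumr_const card_ord mulr_natl -mulrnAl mulrC mulrnAr -mulrnAl.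
Qed.

(** The new error z - H y1 is pulled back by the transpose of the orthogonal H P, which preserves
    its norm. Since |y1| = |y + e| <= q |y|, the growth factors multiply. *)
Lemma backward_error_step d (H P : 'M[R]_d) (a q : R) (y e y1 z : 'cV[R]_d) :
  0 <= a -> H^T *m H = 1%:M -> P^T *m P = 1%:M ->
  y1 = P *m (y + e) -> norm2 e <= (q - 1) * norm2 y ->
  norm2 (z - H *m y1) <= a * norm2 y1 ->
  exists e', z = (H *m P) *m (y + e') /\ norm2 e' <= (q * (1 + a) - 1) * norm2 y.
Proof.
move=> a0 hH hP -> he hz.
have hHP : (H *m P)^T *m (H *m P) = 1%:M.
  by rewrite trmx_mul -mulmxA (mulmxA H^T) hH mul1mx hP.
have hHP' := mulmx1C hHP.
exists (e + (H *m P)^T *m (z - H *m (P *m (y + e)))); split.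
  by rewrite addrA mulmxDr (mulmxA (H *m P) (H *m P)^T) hHP' mul1mx -mulmxA subrKC.
apply: le_trans (norm2_triangle _ _) _.
rewrite norm2_orthogonal ?trmxK //.
rewrite norm2_orthogonal // in hz.
have := norm2_triangle y e.
have := norm2_ge0 y => y0 t.
have : a * norm2 (y + e) <= a * (q * norm2 y) by rewrite ler_wpM2l //; lra.
lra.
Qed.

(** [P] is the product of the exact reflectors so far. The same [P] must describe the columns
    already transformed and the action of the stored reflectors on an arbitrary later vector; only
    the backward error [e] may depend on the vector. *)
Definition qr_invariant d n (B : 'M[R]_(d, n)) (k : nat)
    (st : 'M[R]_(d, n) * seq (reflector R d)) : Prop :=
  let q := (1 + 100 * d%:R * h) ^+ k in
  exists P : 'M[R]_d, [/\ P^T *m P = 1%:M,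
    (forall j, exists e, col j st.1 = P *m (col j B + e) /\
      norm2 e <= (q - 1) * norm2 (col j B)),
    (forall (j : 'I_n) (i : 'I_d), (j < k)%N -> (j < i)%N -> st.1 i j = 0)
  & (forall y, exists e, (loop st.2 (@apply_reflector R u fl d) y).1 = P *m (y + e) /\
      norm2 e <= (q - 1) * norm2 y)].

Lemma householder_step_invariant d n (B : 'M[R]_(d, n)) (k : 'I_n) st :
  (n <= d)%N -> (d < K)%N ->
  qr_invariant B k st -> qr_invariant B k.+1 (householder_step fl k st).1.
Proof.
move=> nd dK; case: st => W hs [P [hP hW hz hQ]].
have h0 := h_ge0 u_ge0 hE.
set a := 100 * d%:R * h in hW hQ.
have a0 : 0 <= a by rewrite !mulr_ge0.
pose kd := widen_ord nd k.
have [H [hH Hfix Happ Hcol]] :=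
  make_reflector_error (fl := fl) u_ge0 hE h_le K_gt0 (k := kd) (y := col k W) dK erefl.
have -> : (householder_step fl k (W, hs)).1 =
  (let hk := (make_reflector fl k (col k W)).1 in
   (\matrix_(i, j) (if (j < k)%N then ret (col j W)
    else if j == k then
      ret (\col_(i < d) (if (i < k)%N then W i k
                         else if i == k :> nat then - hk.2 else 0))
    else apply_reflector fl hk.1 (col j W)).1 i 0, rcons hs hk.1)).
  by rewrite /householder_step /=; case: (make_reflector fl k (col k W)) => [[h1 s] c].
move: Happ Hcol; rewrite -/a.
set hk := (make_reflector fl kd (col k W)).1 => Happ Hcol.
cbv zeta.
exists (H *m P); split.
- by rewrite trmx_mul -mulmxA (mulmxA H^T) hH mul1mx hP.
- move=> j; have [e [e1 e2]] := hW j.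
  rewrite [X in (X - 1)](_ : _ = (1 + a) ^+ k * (1 + a)) ?exprSr //.
  apply: (backward_error_step a0 hH hP e1 e2).
  set z := col j _; have -> : z = (if (j < k)%N then ret (col j W)
    else if j == k then
      ret (\col_(i < d) (if (i < k)%N then W i k
                         else if i == k :> nat then - hk.2 else 0))
    else apply_reflector fl hk.1 (col j W)).1.
    by apply/colP => i; rewrite !mxE.
  (* A finished column vanishes from row k on, so the exact [H] fixes it, just as the program leaves
     it alone. *)
  case: ifP => jk.
    rewrite /= Hfix ?subrr ?norm20 ?mulr_ge0 ?norm2_ge0 // => i ki.
    by rewrite mxE /= hz // (leq_trans jk).
  case: eqP => [->|_]; last exact: Happ.
  have -> : \col_(i < d) (if (i < k)%N then W i k
     else if i == k :> nat then - hk.2 else 0) =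
   \col_(i < d) (if (i < k)%N then col k W i 0
     else if i == k :> nat then - hk.2 else 0).
    by apply/colP => i; rewrite !mxE.
  exact: Hcol.
- move=> j i; rewrite ltnS leq_eqVlt => /orP[/eqP/val_inj ->|jk] ji /=.
    by rewrite !mxE ltnn eqxx /= mxE ltnNge (ltnW ji) /= gtn_eqF.
  by rewrite !mxE jk /= mxE hz.
- move=> y; have [e [e1 e2]] := hQ y; rewrite /= in e1 *.
  rewrite loop_rcons [X in (X - 1)](_ : _ = (1 + a) ^+ k * (1 + a)) ?exprSr //.
  by apply: (backward_error_step a0 hH hP e1 e2); exact: Happ.
Qed.

(** [Q] consists of the first n columns of P^T. The transformed matrix W vanishes below row n, so Q
    times its upper block is P^T W, and the columns of B - P^T W are the backward errors up to
    sign. *)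
Lemma householder_qr_backward_error d n (B : 'M[R]_(d, n)) (c : R) qr :
  (n <= d)%N -> (d < K)%N -> (forall j, norm2 (col j B) <= c) ->
  qr = (householder_qr fl B).1 ->
  let q := (1 + 100 * d%:R * h) ^+ n in
  exists Q : 'M[R]_(d, n), [/\ Q^T *m Q = 1%:M,
    (forall i j : 'I_n, (j < i)%N -> qr.1 i j = 0),
    (forall w, norm2 (B *m w - Q *m (qr.1 *m w)) <= n%:R * ((q - 1) * c) * norm2 w)
  & (forall y, norm2 ((apply_QT fl n qr.2 y).1 - Q^T *m y) <= (q - 1) * norm2 y)].
Proof.
move=> nd dK hB -> q.
have h0 := h_ge0 u_ge0 hE.
have a0 : 0 <= 100 * d%:R * h by rewrite !mulr_ge0.
have q1 : 1 <= q by rewrite exprn_ege1 // lerDl.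
have : qr_invariant B n (loop (enum 'I_n) (@householder_step R u fl d n) (B, [::])).1.
  rewrite loop_val; apply: (@foldl_enum_ind _ _ _ (qr_invariant B)).
    exists 1%:M; split => //.
    - by rewrite trmx1 mul1mx.
    - by move=> j; exists 0; rewrite addr0 mul1mx expr0 subrr mul0r norm20.
    - by move=> y; exists 0; rewrite addr0 mul1mx expr0 subrr mul0r norm20.
  by move=> k st hst; apply: householder_step_invariant.
have -> : (householder_qr fl B).1 =
  (let st := (loop (enum 'I_n) (@householder_step R u fl d n) (B, [::])).1 in
   (\matrix_(i < n, j < n) entry (col j st.1) i, st.2)) by [].
case: (loop _ _ _).1 => W hs; cbv zeta.
rewrite /qr_invariant -/q => -[P [hP hW hz hQ]] /=.
have hP' := mulmx1C hP.
pose w := widen_ord nd.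
have eW (i j : 'I_n) : entry (col j W) i = W (w i) j.
  by rewrite -[X in entry _ X]/(nat_of_ord (w i)) entryE mxE.
pose Q := \matrix_(i < d, j < n) P (w j) i.
have hQQ : Q^T *m Q = 1%:M.
  apply/matrixP => i j; rewrite !mxE.
  have := congr1 (fun M : 'M[R]_d => M (w i) (w j)) hP'; rewrite !mxE => H.
  transitivity (\sum_j0 P (w i) j0 * P^T j0 (w j)).
    by apply: eq_bigr => k _; rewrite !mxE.
  by rewrite H.
have nQ v : norm2 (Q *m v) = norm2 v by exact: norm2_orthogonal.
exists Q; split => //.
- by move=> i j ji; rewrite !mxE eW hz.
- move=> v.
  have -> : B *m v - Q *m ((\matrix_(i, j) entry (col j W) i) *m v) =
      (B - P^T *m W) *m v.
    rewrite mulmxBl; congr (_ - _); rewrite mulmxA; congr (_ *m v).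
    apply/matrixP => i j; rewrite !mxE.
    rewrite [RHS](bigID (fun k : 'I_d => (k < n)%N)) /= (big_ord_narrow nd) /=.
    rewrite [X in _ = _ + X]big1 ?addr0.
      by apply: eq_bigr => k _; rewrite !mxE eW.
    move=> k; rewrite -leqNgt => nk; rewrite hz ?mulr0 //.
    exact: leq_trans (ltn_ord j) nk.
  apply: norm2_mulmx_col => j.
  have [e [/= e1 e2]] := hW j.
  have -> : col j (B - P^T *m W) = - e.
    rewrite linearB /= [in X in _ - X]colE -mulmxA -colE e1 mulmxA hP mul1mx.
    by rewrite opprD addNKr.
  rewrite norm2N; apply: le_trans e2 _.
  by rewrite ler_wpM2l ?subr_ge0.
- move=> y; have [e [e1 e2]] := hQ y; rewrite /= in e1; rewrite e1.
  have -> : \col_k entry (P *m (y + e)) k = Q^T *m (y + e).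
    apply/colP => k; rewrite mxE -[X in entry _ X]/(nat_of_ord (w k)) entryE !mxE.
    by apply: eq_bigr => l _; rewrite !mxE.
  rewrite mulmxDr addrAC subrr add0r; apply: le_trans e2.
  have := @trmx_norm2_le _ _ _ Q 1 ler01 (fun v => _) e.
  by rewrite mul1r; apply => v; rewrite mul1r nQ.
Qed.

End QR.

(** * Perturbed sketching in exact arithmetic *)

Section LeastSquares.
Variable R : realType.

Lemma normal_equations m n (A : 'M[R]_(m, n)) b x :
  is_least_squares_solution A b x -> A^T *m resid A b x = 0.
Proof.
move=> hx; set r := resid A b x; set w := A^T *m r.
have [//|w0] := eqVneq w 0.
have p := norm2_gt0 w0.
have h t : 0 <= t ^+ 2 * norm2 (A *m w) ^+ 2 - 2 * t * norm2 w ^+ 2.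
  have := hx (x + t *: w).
  rewrite -(@ler_pXn2r _ 2) ?nnegrE ?norm2_ge0 // !sqr_norm2.
  have -> : resid A b (x + t *: w) = r - t *: (A *m w).
    by rewrite /r /resid mulmxDr -scalemxAr opprD addrA.
  have ex (v1 v2 : 'cV[R]_m) : dot (v1 - t *: v2) (v1 - t *: v2) =
      dot v1 v1 - 2 * t * dot v1 v2 + t ^+ 2 * dot v2 v2.
    by rewrite dotBl !dotBr !dotZl !dotZr (dotC v2 v1); ring.
  rewrite -/r ex.
  have -> : dot r (A *m w) = dot w w by rewrite dotC dot_mulmx.
  lra.
set N := norm2 (A *m w) ^+ 2 in h.
have N0 : 0 <= N by rewrite sqr_ge0.
have W0 : 0 < norm2 w ^+ 2 by rewrite exprn_gt0.
set W := norm2 w ^+ 2 in h W0.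
have N1 : 0 < N + 1 by lra.
(* A step along A^T r that would decrease the residual; the denominator N + 1 stays positive even if
   A w = 0. *)
have := h (W / (N + 1)).
have -> : (W / (N + 1)) ^+ 2 * N - 2 * (W / (N + 1)) * W =
   - (W ^+ 2 * (N + 2)) / (N + 1) ^+ 2.
  by field; rewrite gt_eqF.
rewrite mulNr oppr_ge0 leNgt divr_gt0 ?exprn_gt0 // mulr_gt0 ?exprn_gt0 //; lra.
Qed.

Lemma column_space_row_mx m n (A : 'M[R]_(m, n)) b y t :
  column_space (row_mx A b) (A *m y + t *: b).
Proof.
exists (col_mx y (t%:M : 'M[R]_1)) => //.
by rewrite mul_row_col mul_mx_scalar.
Qed.

(** As r is orthogonal to range A, A y + t r and A y - t r have equal norms. Their sketched squared
    norms thus differ by at most (1 + eps)^2 - (1 - eps)^2 = 4 eps times the common square, and this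
    difference is four times the product sought, times t. *)
Lemma embedding_dot d m n (S : 'M[R]_(d, m)) (A : 'M[R]_(m, n)) b x (eps : R) w :
  0 < eps -> eps < 1 ->
  subspace_embedding S eps (column_space (row_mx A b)) ->
  is_least_squares_solution A b x ->
  forall r, r = resid A b x ->
  `|dot (S *m r) (S *m (A *m w))| <= 2 * eps * norm2 r * norm2 (A *m w).
Proof.
move=> e0 e1 hS hx r rE.
have rA y : dot (A *m y) r = 0.
  by rewrite rE dot_mulmx normal_equations // /dot big1 // => i _; rewrite mxE mulr0.
have hin y t : column_space (row_mx A b) (A *m y + t *: r).
  have -> : A *m y + t *: r = A *m (y - t *: x) + t *: b.
    rewrite rE /resid scalerBr mulmxBr -scalemxAr addrA addrAC.
    by rewrite -!addrA; congr (_ + _); rewrite addrC.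
  exact: column_space_row_mx.
have sq y t : (1 - eps) ^+ 2 * (norm2 (A *m y) ^+ 2 + t ^+ 2 * norm2 r ^+ 2) <=
      norm2 (S *m (A *m y + t *: r)) ^+ 2 <=
    (1 + eps) ^+ 2 * (norm2 (A *m y) ^+ 2 + t ^+ 2 * norm2 r ^+ 2).
  have [h1 h2] := hS _ (hin y t).
  have -> : norm2 (A *m y) ^+ 2 + t ^+ 2 * norm2 r ^+ 2 = norm2 (A *m y + t *: r) ^+ 2.
    rewrite [RHS]sqr_norm2 dotDl !dotDr !dotZl !dotZr (dotC r) rA !sqr_norm2; ring.
  have e10 : 0 <= 1 - eps by lra.
  have e20 : 0 <= 1 + eps by lra.
  rewrite -!exprMn !ler_pXn2r ?nnegrE ?norm2_ge0 ?mulr_ge0 ?norm2_ge0 //.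
  by rewrite h1 h2.
have half y t : dot (S *m r) (S *m (A *m y)) * t <=
    eps * (norm2 (A *m y) ^+ 2 + t ^+ 2 * norm2 r ^+ 2).
  have /andP[_ h1] := sq y t; have /andP[h2 _] := sq y (- t).
  rewrite !mulmxDr -!scalemxAr !sqr_norm2 !dotDl !dotDr !dotZl !dotZr (dotC (S *m (A *m y))) in h1.
  rewrite !mulmxDr -!scalemxAr !sqr_norm2 !dotDl !dotDr !dotZl !dotZr (dotC (S *m (A *m y))) in h2.
  rewrite !sqr_norm2; lra.
have half' y t : `|dot (S *m r) (S *m (A *m y)) * t| <=
    eps * (norm2 (A *m y) ^+ 2 + t ^+ 2 * norm2 r ^+ 2).
  rewrite ler_norml half andbT lerNl -mulrN.
  by apply: le_trans (half _ _) _; rewrite sqrrN.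
set p := norm2 (A *m w); set q := norm2 r.
have [r0|r0] := eqVneq r 0.
  rewrite r0 mulmx0 /dot big1 ?normr0 ?mulr_ge0 ?norm2_ge0 //; last by move=> i _; rewrite mxE mul0r.
  by lra.
have [w0|w0] := eqVneq (A *m w) 0.
  rewrite w0 mulmx0 /dot big1 ?normr0 ?mulr_ge0 ?norm2_ge0 //; last by move=> i _; rewrite [X in _ * X]mxE mulr0.
  by lra.
have p0 : 0 < p by exact: norm2_gt0.
have q0 : 0 < q by exact: norm2_gt0.
(* Scaling w by |r| and r by |A w| makes the two squares equal, which is the optimal balance. *)
have := half' (q *: w) p.
rewrite -!scalemxAr dotZr norm2Z (gtr0_norm q0) -/p -/q.
have -> : eps * ((q * p) ^+ 2 + p ^+ 2 * q ^+ 2) = (2 * eps * q * p) * (q * p) by ring.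
set D := dot _ _.
have -> : q * D * p = D * (q * p) by ring.
by rewrite normrM (gtr0_norm (mulr_gt0 q0 p0)) (ler_pM2r (mulr_gt0 q0 p0)).
Qed.

End LeastSquares.

(** * Scalar inequalities *)

Section Arithmetic.
Variable R : realType.
Implicit Types (eps delta eta a kappa rho X s : R).

Lemma sketch_lower_arith eps delta N Z :
  eps <= 29 / 100 -> delta <= 1 / 10000 -> 0 <= N ->
  (1 - eps - delta) * N <= Z -> N <= 3 / 2 * Z.
Proof.
move=> e1 d1 N0.
have : 7 / 10 * N <= (1 - eps - delta) * N by rewrite ler_wpM2r //; lra.
lra.
Qed.

Lemma g_IS_ge0 eps : 0 < eps <= 29 / 100 -> 0 <= g_IS eps.
Proof.
by move=> /andP[e0 e1]; rewrite divr_ge0 ?sqr_ge0 // mulr_ge0 //; lra.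
Qed.

(** At eps = 29/100 the rate is about 0.9837; the margin up to 99/100 is left for 50 delta <=
    1/200. *)
Lemma g_IS_le eps : 0 < eps <= 29 / 100 -> g_IS eps <= 984 / 1000.
Proof.
move=> /andP[e0 e1]; have p1 : 0 < 1 - eps by lra.
rewrite /g_IS ler_pdivrMr ?exprn_gt0 //.
(* The tangent to eps^2 at 29/100 makes the inequality linear in eps. *)
have : 0 <= (eps - 29 / 100) ^+ 2 by rewrite sqr_ge0.
lra.
Qed.

(** g_IS eps = (1 - eps)^-2 - 1, so the left side is g_IS at eps + delta; 6 bounds the slope, which
    is about 2 / 0.71^3. *)
Lemma g_IS_perturbed eps delta : 0 < eps <= 29 / 100 -> 0 <= delta <= 1 / 10000 ->
  ((1 - (eps + delta)) ^+ 2)^-1 - 1 <= g_IS eps + 6 * delta.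
Proof.
move=> /andP[e0 e1] /andP[d0 d1]; rewrite /g_IS.
have p1 : 0 < 1 - eps by lra.
have p2 : 0 < 1 - (eps + delta) by lra.
have -> : (2 - eps) * eps / (1 - eps) ^+ 2 = ((1 - eps) ^+ 2)^-1 - 1.
  by field; rewrite gt_eqF.
have -> : ((1 - (eps + delta)) ^+ 2)^-1 = ((1 - eps) ^+ 2)^-1 +
    delta * ((2 * (1 - eps) - delta) / ((1 - eps) ^+ 2 * (1 - (eps + delta)) ^+ 2)).
  by field; rewrite !gt_eqF.
suff : (2 * (1 - eps) - delta) / ((1 - eps) ^+ 2 * (1 - (eps + delta)) ^+ 2) <= 6.
  by move=> /(ler_wpM2l d0); rewrite addrAC lerD2l [6 * _]mulrC.
rewrite ler_pdivrMr ?mulr_gt0 ?exprn_gt0 //.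
set t := 1 - (eps + delta) in p2 *; have t0 : 709 / 1000 <= t by rewrite /t; lra.
set z := 1 - eps in p1 *; have z0 : 71 / 100 <= z by rewrite /z; lra.
move: t p2 t0 z p1 z0 => t p2 t0 z p1 z0.
have f1 : 709 / 1000 * t <= t * t by rewrite ler_pM2r.
have f2 : 71 / 100 * (t * t) <= z * (t * t) by rewrite ler_pM2r ?mulr_gt0.
have f3 : z * (355 / 1000) <= z * (z * (t * t)) by rewrite ler_pM2l //; lra.
have -> : z ^+ 2 * t ^+ 2 = z * (z * (t * t)) by ring.
by move: (z * (z * (t * t))) f3 => y f3; clear -p1 f3 d0; lra.
Qed.

(** The ratio Z^2 / Y^2 lies between (1 + e)^-2 and (1 - e)^-2, and the upper end is the one farther
    from 1. *)
Lemma contraction_arith (e Y Z : R) : 0 <= e <= 1 / 2 -> 0 <= Y -> 0 <= Z ->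
  (1 - e) * Z <= Y -> Y <= (1 + e) * Z ->
  `|Y ^+ 2 - Z ^+ 2| <= (((1 - e) ^+ 2)^-1 - 1) * Y ^+ 2.
Proof.
move=> /andP[e0 e1] Y0 Z0 h1 h2.
set c := ((1 - e) ^+ 2)^-1.
have e1p : 0 < 1 - e by lra.
have e2p : 0 <= 1 + e by lra.
have c0 : 0 < c by rewrite invr_gt0 exprn_gt0.
have s1 : (1 - e) ^+ 2 * Z ^+ 2 <= Y ^+ 2.
  by rewrite -exprMn ler_pXn2r ?nnegrE ?mulr_ge0 ?(ltW e1p).
have s2 : Y ^+ 2 <= (1 + e) ^+ 2 * Z ^+ 2.
  by rewrite -exprMn ler_pXn2r ?nnegrE ?mulr_ge0.
have s3 : Z ^+ 2 <= c * Y ^+ 2.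
  by rewrite /c mulrC ler_pdivlMr ?exprn_gt0 // mulrC.
have s4 : (2 - c) * Y ^+ 2 <= Z ^+ 2.
  have e2 : 0 < (1 + e) ^+ 2 by rewrite exprn_gt0 //; lra.
  rewrite -(ler_pM2l e2); apply: le_trans s2.
  rewrite mulrA ler_piMl ?sqr_ge0 //.
  have -> : (1 + e) ^+ 2 * (2 - c) =
     1 - e ^+ 2 * (6 - 2 * e ^+ 2) / (1 - e) ^+ 2.
    by rewrite /c; field; rewrite gt_eqF.
  rewrite gerBl divr_ge0 ?sqr_ge0 // mulr_ge0 ?sqr_ge0 //.
  have : e ^+ 2 <= 1 by rewrite -(expr1n _ 2) ler_pXn2r ?nnegrE //; lra.
  by move: (e ^+ 2) => y; lra.
clear c0; move: (Y ^+ 2) (Z ^+ 2) c s3 s4 => y z c s3 s4; clear -s3 s4.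
rewrite ler_norml; apply/andP; split; lra.
Qed.

(** Passes from the O(eps) bound on the sketch-and-solve error to the sqrt(eps) of the statement. *)
Lemma le_sqrt eps : 0 < eps <= 1 -> eps <= Num.sqrt eps.
Proof.
move=> /andP[e0 e1].
have s1 : Num.sqrt eps <= 1 by rewrite -sqrtr1 ler_sqrt // ler01.
have := ler_wpM2l (sqrtr_ge0 eps) s1.
by rewrite -[X in X <= _]expr2 (sqr_sqrtr (ltW e0)) mulr1.
Qed.

(** [E] is the initial error and q1, ..., q4 are the terms of its decomposition in [ps_initial]:
    sketched residual, QR error, error of Q^T (S b), back substitution. The last one involves |x_0|,
    hence 2 delta E, which the left side absorbs. *)
Lemma initial_arith eps delta eta a kappa rho X (E q1 q2 q3 q4 nb n0 s : R) :
  delta = eta * kappa -> 0 <= delta <= 1 / 10000 -> 0 <= eta <= delta ->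
  0 <= rho -> 0 <= E -> 0 <= X -> 0 <= a -> 0 <= s -> eps <= s ->
  E <= q1 + q2 + q3 + q4 ->
  q1 <= (3 * eps + 26 / 10 * delta) * rho -> q2 <= eta * a * X ->
  q3 <= eta * nb -> nb <= rho + a * X -> q4 <= eta * a * n0 ->
  eta * a * n0 <= eta * a * X + 2 * delta * E ->
  E <= 4 * s * rho + 5 * (eta * (a * X + kappa * rho)).
Proof.
move=> dE /andP[d0 d1] /andP[eta0 ed] r0 E0 X0 a0 s0 es t1 hq1 t2 i1 hb i2 hx0.
have hEd : delta * E <= 1 / 10000 * E by rewrite ler_wpM2r.
have hb' := ler_wpM2l eta0 hb.
have er : eta * rho <= delta * rho by rewrite ler_wpM2r.
have dr0 : 0 <= delta * rho by rewrite mulr_ge0.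
have eax0 : 0 <= eta * a * X by rewrite !mulr_ge0.
have esr : eps * rho <= s * rho by rewrite ler_wpM2r.
have es0 : 0 <= s * rho by rewrite mulr_ge0.
have -> : eta * (a * X + kappa * rho) = eta * a * X + delta * rho by rewrite dE; ring.
clear d1 d0 dE ed eta0 hb; lra.
Qed.

(** [e] is the old error and [y] the new one, [F] the error of the computed residual, [Om] the
    deviation of [wh] from its exact value, [W] = |wh|, [D] = |Rf dh|, [P] the residual of the back
    substitution and [t] the error of the update. The bounds for Om and W, and those for P and D,
    refer to each other; the loops close since delta is at most 1/10000. *)
Lemma step_arith delta eta a kappa rho X (g e F Om W D P t nrh nres nxi nxd y : R) :
  delta = eta * kappa -> 0 <= delta <= 1 / 10000 -> 0 <= eta <= delta ->
  0 <= a -> 0 <= X -> 0 <= rho -> 0 <= e -> 0 <= F -> 0 <= Om -> 0 <= P ->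
  eta * a * nxi <= eta * a * X + 2 * delta * e ->
  nres <= rho + 3 / 2 * e ->
  F <= eta * (a * nxi + nres) ->
  nrh <= nres + F ->
  Om <= 3 / 2 * F + 2 * delta * nrh + 2 * delta * W ->
  W <= 2 * e + Om ->
  P <= 2 * delta * D -> D <= W + P ->
  t <= 13 / 10 * (a * (eta * nxd)) ->
  eta * a * nxd <= eta * a * X + 2 * delta * (e + D) ->
  y <= (g + 6 * delta) * e + Om + P + t ->
  y <= (g + 50 * delta) * e + 10 * (eta * (a * X + kappa * rho)).
Proof.
move=> dE /andP[d0 d1] /andP[eta0 ed] a0 X0 r0 e0 F0 Om0 P0 hxi hres hF hrh hOm hW hP hD ht hxd hy.
have er : eta * rho <= delta * rho by rewrite ler_wpM2r.
have ee : eta * e <= delta * e by rewrite ler_wpM2r.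
have dr0 : 0 <= delta * rho by rewrite mulr_ge0.
have de0 : 0 <= delta * e by rewrite mulr_ge0.
have hres' := ler_wpM2l eta0 hres.
have hF' : F <= eta * a * X + delta * rho + 7 / 2 * (delta * e).
  clear -hF hres' hxi er ee; lra.
have dF : delta * F <= 1 / 10000 * F by rewrite ler_wpM2r.
have drh := ler_wpM2l d0 hrh.
have dres := ler_wpM2l d0 hres.
have dW := ler_wpM2l d0 hW.
have dOm : delta * Om <= 1 / 10000 * Om by rewrite ler_wpM2r.
have dD := ler_wpM2l d0 hD.
have dP : delta * P <= 1 / 10000 * P by rewrite ler_wpM2r.
have u0 : 0 <= eta * a * X by rewrite !mulr_ge0.
have -> : eta * (a * X + kappa * rho) = eta * a * X + delta * rho by rewrite dE; ring.
have w1 : Om <= 4 * (eta * a * X + delta * rho) + 15 * (delta * e).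
  clear -hOm hF' dF drh dres dW dOm u0 dr0 de0 Om0; lra.
have w2 : delta * W <= 1 / 1000 * (eta * a * X + delta * rho) + 21 / 10 * (delta * e).
  clear -dW dOm w1 u0 dr0 de0; lra.
have w3 : P <= 1 / 100 * (eta * a * X + delta * rho) + 5 * (delta * e).
  clear -hP dD dP w2 u0 dr0 de0; lra.
have w4 : delta * D <= 1 / 100 * (eta * a * X + delta * rho) + 3 * (delta * e).
  clear -dD dP w2 w3 u0 dr0 de0; lra.
clear -hy w1 w3 w4 ht hxd u0 dr0 de0; lra.
Qed.

(** 1000 Z = 10 Z / (1 - 99/100) is the fixed point of the recurrence at the worst admissible
    rate. *)
Lemma geometric_iterates (e : nat -> R) (s Z G : R) :
  0 <= s -> 0 <= Z -> 0 <= G -> G <= 99 / 100 ->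
  e 0%N <= 4 * s + 5 * Z ->
  (forall i, e i.+1 <= G * e i + 10 * Z) ->
  forall i, e i <= 4 * G ^+ i * s + 1000 * Z.
Proof.
move=> s0 Z0 G0 G1 h0 hS; elim=> [|i IH].
  by rewrite expr0 mulr1; lra.
have k1 := ler_wpM2l G0 IH; have k2 := ler_wpM2r Z0 G1.
by have := hS i; rewrite exprS; clear hS h0 IH; lra.
Qed.

End Arithmetic.

(** * Error propagation with a perturbed triangular factor *)

Section PerturbedSketching.
Variables (R : realType) (m n d : nat) (A : 'M[R]_(m, n)) (b : 'cV[R]_m)
  (x : 'cV[R]_n) (S : 'M[R]_(d, m)) (eps : R) (Rf : 'M[R]_n) (Q : 'M[R]_(d, n))
  (eta a kappa delta : R) (r : 'cV[R]_m).

(* a and kappa stand for |A| and cond A, Rf for the computed triangular factor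
   and eta for a common bound on all relative rounding errors. *)
Record perturbed_sketch : Prop := PerturbedSketch {
  ps_a : 0 < a;
  ps_kappa : 1 <= kappa;
  ps_eps : 0 < eps <= 29 / 100;
  ps_eta : 0 <= eta;
  ps_deltaE : delta = eta * kappa;
  ps_delta_le : delta <= 1 / 10000;
  ps_A : forall v, norm2 (A *m v) <= a * norm2 v;
  ps_cond : forall v, norm2 v <= kappa / a * norm2 (A *m v);
  ps_S : subspace_embedding S eps (column_space (row_mx A b));
  ps_x : is_least_squares_solution A b x;
  ps_r : r = resid A b x;
  ps_Q : Q^T *m Q = 1%:M;
  ps_QR : forall w, norm2 (S *m (A *m w) - Q *m (Rf *m w)) <= eta * a * norm2 w
}.

Hypothesis H : perturbed_sketch.

Lemma ps_delta_ge0 : 0 <= delta.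
Proof. by rewrite (ps_deltaE H) mulr_ge0 ?(ps_eta H) // (le_trans ler01 (ps_kappa H)). Qed.

Lemma ps_delta : 0 <= delta <= 1 / 10000.
Proof. by rewrite ps_delta_ge0 (ps_delta_le H). Qed.

Lemma ps_eta_delta : 0 <= eta <= delta.
Proof. by rewrite (ps_eta H) (ps_deltaE H) ler_peMr ?(ps_eta H) ?(ps_kappa H). Qed.

Lemma ps_eps_le : eps <= 29 / 100.
Proof. by have /andP[] := ps_eps H. Qed.

Lemma ps_embedding_A w :
  (1 - eps) * norm2 (A *m w) <= norm2 (S *m (A *m w)) /\
  norm2 (S *m (A *m w)) <= (1 + eps) * norm2 (A *m w).
Proof.
by apply: (ps_S H); have := column_space_row_mx A b w 0; rewrite scale0r addr0.
Qed.

Lemma ps_eta_a_scale (c N : R) : eta * a * (c * (kappa / a) * N) = c * delta * N.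
Proof. by rewrite (ps_deltaE H); field; rewrite gt_eqF // (ps_a H). Qed.

(** The exchange used throughout: a factor kappa turns an error on the scale |A| |w| into one
    relative to |A w|, or to |Rf w| in [ps_eta_a_R]. *)
Lemma ps_eta_a w : eta * a * norm2 w <= delta * norm2 (A *m w).
Proof.
have h := ler_wpM2l (mulr_ge0 (ps_eta H) (ltW (ps_a H))) (ps_cond H w).
by apply: le_trans h _; rewrite -[kappa / a]mul1r ps_eta_a_scale mul1r.
Qed.

Lemma ps_norm_R w : (1 - eps - delta) * norm2 (A *m w) <= norm2 (Rf *m w) /\
  norm2 (Rf *m w) <= (1 + eps + delta) * norm2 (A *m w).
Proof.
have h3 := le_trans (ps_QR H w) (ps_eta_a w).
have [h1 h2] := ps_embedding_A w.
have h4 := norm2_sub_ge (S *m (A *m w)) (Q *m (Rf *m w)).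
have h5 := norm2_sub_ge (Q *m (Rf *m w)) (S *m (A *m w)).
rewrite norm2_subC in h5.
rewrite -(norm2_orthogonal (Rf *m w) (ps_Q H)).
move: (norm2 (A *m w)) (norm2 (S *m (A *m w))) (norm2 (Q *m (Rf *m w)))
  (norm2 _) h1 h2 h3 h4 h5 => N1 N2 N3 N4.
by move=> *; split; lra.
Qed.

Lemma ps_A_le w : norm2 (A *m w) <= 3 / 2 * norm2 (Rf *m w).
Proof.
exact: sketch_lower_arith ps_eps_le (ps_delta_le H) (norm2_ge0 _) (ps_norm_R w).1.
Qed.

Lemma ps_ka : 0 <= kappa / a.
Proof. by rewrite divr_ge0 ?(ltW (ps_a H)) // (le_trans ler01 (ps_kappa H)). Qed.

Lemma ps_vec_le w : norm2 w <= 2 * (kappa / a) * norm2 (Rf *m w).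
Proof.
apply: le_trans (ps_cond H _) _.
have := ler_wpM2l ps_ka (ps_A_le w); have := mulr_ge0 ps_ka (norm2_ge0 (Rf *m w)).
by move: (kappa / a) (norm2 _) (norm2 _) => *; lra.
Qed.

Lemma ps_unit : Rf \in unitmx.
Proof.
rewrite -unitmx_tr -row_free_unit; apply/inj_row_free => v hv.
have h0 : Rf *m v^T = 0 by rewrite -[LHS]trmxK trmx_mul trmxK hv trmx0.
have := ps_vec_le v^T; rewrite h0 norm20 mulr0 => h3.
apply: trmx_inj; rewrite trmx0; apply: norm2_eq0.
by apply/eqP; rewrite eq_le norm2_ge0 h3.
Qed.

Let T := invmx Rf.

Lemma ps_RT (z : 'cV[R]_n) : Rf *m (T *m z) = z.
Proof. by rewrite /T mulKVmx // ps_unit. Qed.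

Lemma ps_TR (z : 'cV[R]_n) : T *m (Rf *m z) = z.
Proof. by rewrite /T mulKmx // ps_unit. Qed.

Lemma ps_AT_le z : norm2 (A *m (T *m z)) <= 3 / 2 * norm2 z.
Proof. by have := ps_A_le (T *m z); rewrite ps_RT. Qed.

Lemma ps_T_le z : norm2 (T *m z) <= 2 * (kappa / a) * norm2 z.
Proof. by have := ps_vec_le (T *m z); rewrite ps_RT. Qed.

Lemma ps_eta_a_R w : eta * a * norm2 w <= 2 * delta * norm2 (Rf *m w).
Proof.
have h := ler_wpM2l (mulr_ge0 (ps_eta H) (ltW (ps_a H))) (ps_vec_le w).
by apply: le_trans h _; rewrite ps_eta_a_scale.
Qed.

Lemma ps_tAT_le (f : 'cV[R]_m) : norm2 (T^T *m (A^T *m f)) <= 3 / 2 * norm2 f.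
Proof.
rewrite mulmxA -trmx_mul; apply: trmx_norm2_le => [|w]; first by rewrite divr_ge0.
by rewrite -mulmxA ps_AT_le.
Qed.

(** Applied with [c] the norm of the computed residual or of [wh]. The first case produces delta |r|
    = eta kappa |r|, the source of the term kappa |r| in the error bounds. *)
Lemma ps_tT_le v (c : R) : norm2 v <= eta * a * c -> norm2 (T^T *m v) <= 2 * delta * c.
Proof.
move=> hv; apply: le_trans (_ : 2 * (kappa / a) * norm2 v <= _).
  by apply: trmx_norm2_le => [|w]; [rewrite mulr_ge0 ?ps_ka|exact: ps_T_le].
have := ler_wpM2l (mulr_ge0 (ler0n R 2) ps_ka) hv => hh; apply: le_trans hh _.
by rewrite mulrCA ps_eta_a_scale.
Qed.

Lemma ps_R_le w : norm2 (Rf *m w) <= 13 / 10 * (a * norm2 w).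
Proof.
apply: le_trans (ps_norm_R w).2 _; apply: ler_pM (norm2_ge0 _) _ (ps_A H w).
  by rewrite -addrA addr_ge0 // addr_ge0 ?ps_delta_ge0 //; have /andP[/ltW] := ps_eps H.
by have := ps_eps_le; have := ps_delta_le H; lra.
Qed.

(** The form of G at y is |y|^2 - |A T y|^2, and [ps_norm_R] at T y confines the ratio of the two
    norms. *)
Lemma ps_contraction (z : 'cV[R]_n) :
  norm2 (z - T^T *m (A^T *m (A *m (T *m z)))) <= (g_IS eps + 6 * delta) * norm2 z.
Proof.
have he : 0 <= eps + delta <= 1 / 2.
  have /andP[d0 d1] := ps_delta; have /andP[e0 e1] := ps_eps H.
  by apply/andP; split; lra.
apply: le_trans (_ : (((1 - (eps + delta)) ^+ 2)^-1 - 1) * norm2 z <= _); last first.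
  by rewrite ler_wpM2r ?norm2_ge0 // g_IS_perturbed ?(ps_eps H) ?ps_delta.
set G := 1%:M - T^T *m A^T *m A *m T.
have -> : z - T^T *m (A^T *m (A *m (T *m z))) = G *m z.
  by rewrite mulmxBl mul1mx !mulmxA.
have GT : G^T = G.
  by rewrite /G linearB /= trmx1 !trmx_mul !trmxK !mulmxA.
apply: (symmetric_norm2_le GT) => y.
have -> : dot (G *m y) y = norm2 y ^+ 2 - norm2 (A *m (T *m y)) ^+ 2.
  by rewrite mulmxBl mul1mx dotBl -!mulmxA dot_mulmx trmxK dot_mulmx trmxK -!sqr_norm2.
have := ps_norm_R (T *m y); rewrite ps_RT -[1 + eps + delta]addrA -[1 - eps - delta]addrA -opprD.
by move=> [h1 h2]; apply: contraction_arith => //; exact: norm2_ge0.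
Qed.

Lemma ps_initial zh x0 :
  norm2 (zh - Q^T *m (S *m b)) <= eta * norm2 b ->
  norm2 (Rf *m x0 - zh) <= eta * a * norm2 x0 ->
  norm2 (Rf *m (x - x0)) <=
    4 * Num.sqrt eps * norm2 r + 5 * (eta * (a * norm2 x + kappa * norm2 r)).
Proof.
move=> i1 i2.
have /andP[e0 e1] := ps_eps H.
have e1' : eps <= 1 by lra.
have e1'' : eps < 1 by lra.
have e1''' : 1 + eps <= 13 / 10 by lra.
have rho0 : 0 <= norm2 r by exact: norm2_ge0.
have nQ v : norm2 (Q *m v) = norm2 v by exact: norm2_orthogonal (ps_Q H).
have nQT v : norm2 (Q^T *m v) <= norm2 v.
  by have := @trmx_norm2_le _ _ _ Q 1 ler01 _ v; rewrite mul1r; apply => w; rewrite mul1r nQ.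
have hSr : norm2 (S *m r) <= 13 / 10 * norm2 r.
  have hin : column_space (row_mx A b) r.
    have := column_space_row_mx A b (- x) 1.
    by rewrite mulmxN scale1r addrC (ps_r H).
  apply: le_trans (ps_S H hin).2 _; by rewrite ler_wpM2r.
have hQS : norm2 (Q^T *m (S *m r)) <= (3 * eps + 26 / 10 * delta) * norm2 r.
  set q := Q^T *m (S *m r).
  have [q0|q0] := eqVneq q 0.
    by rewrite q0 norm20 mulr_ge0 // addr_ge0 // mulr_ge0 ?ps_delta_ge0 ?divr_ge0 ?(ltW e0).
  rewrite -(ler_pM2r (norm2_gt0 q0)) -[X in X <= _]expr2 sqr_norm2 {1}/q.
  rewrite dot_mulmx trmxK.
  (* Up to the QR error, Q q is the sketch of A (T q), an element of range A, so near orthogonality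
     to S r applies. The constants are 3 = 2 * 3/2 and 26/10 = 2 * 13/10. *)
  have -> : Q *m q = S *m (A *m (T *m q)) - (S *m (A *m (T *m q)) - Q *m (Rf *m (T *m q))).
    by rewrite opprB addrC subrK ps_RT.
  rewrite dotBr.
  have k1 : dot (S *m r) (S *m (A *m (T *m q))) <= 3 * eps * norm2 r * norm2 q.
    apply: le_trans (ler_norm _) _.
    apply: le_trans (embedding_dot _ e0 e1'' (ps_S H) (ps_x H) (ps_r H)) _.
    apply: le_trans (ler_wpM2l (mulr_ge0 (mulr_ge0 (ler0n R 2) (ltW e0)) rho0) (ps_AT_le q)) _.
    by rewrite le_eqVlt; apply/orP; left; apply/eqP; field.
  have k2 : - dot (S *m r) (S *m (A *m (T *m q)) - Q *m (Rf *m (T *m q)))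
      <= 26 / 10 * delta * norm2 r * norm2 q.
    rewrite -dotNr; apply: le_trans (norm2_dot_le _ _) _; rewrite norm2N.
    have j1 := le_trans (ps_QR H (T *m q)) (ps_eta_a_R _).
    rewrite ps_RT in j1; rewrite ps_RT.
    apply: le_trans (ler_pM (norm2_ge0 _) (norm2_ge0 _) hSr j1) _.
    by rewrite le_eqVlt; apply/orP; left; apply/eqP; field.
  by apply: le_trans (lerD k1 k2) _; rewrite -!mulrDl.
(* From b = r + A x and Q^T Q = 1: in exact arithmetic only -Q^T S r would remain. *)
have id1 : Rf *m (x - x0) = - (Q^T *m (S *m r))
    - Q^T *m (S *m (A *m x) - Q *m (Rf *m x))
    - (zh - Q^T *m (S *m b)) - (Rf *m x0 - zh).
  rewrite (ps_r H) /resid !mulmxBr (mulmxA Q^T Q) (ps_Q H) mul1mx.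
  move: (Q^T *m (S *m b)) (Q^T *m (S *m (A *m x))) (Rf *m x) (Rf *m x0).
  by move=> u1 u2 u3 u4; apply/colP => i; rewrite !mxE; ring.
apply: (@initial_arith _ eps delta eta a kappa (norm2 r) (norm2 x)
  (norm2 (Rf *m (x - x0))) (norm2 (Q^T *m (S *m r)))
  (norm2 (Q^T *m (S *m (A *m x) - Q *m (Rf *m x))))
  (norm2 (zh - Q^T *m (S *m b))) (norm2 (Rf *m x0 - zh)) (norm2 b) (norm2 x0) _
  (ps_deltaE H) ps_delta ps_eta_delta rho0 (norm2_ge0 _) (norm2_ge0 _) (ltW (ps_a H))
  (sqrtr_ge0 _) _ _ hQS _ i1 _ i2 _).
- by rewrite le_sqrt // e0.
- rewrite id1.
  apply: le_trans (norm2B_triangle _ _) _; rewrite lerD2r.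
  apply: le_trans (norm2B_triangle _ _) _; rewrite lerD2r.
  by apply: le_trans (norm2B_triangle _ _) _; rewrite lerD2r norm2N.
- exact: le_trans (nQT _) (ps_QR H x).
- have {1}-> : b = r + A *m x by rewrite (ps_r H) /resid subrK.
  by apply: le_trans (norm2_triangle _ _) _; rewrite lerD2l (ps_A H).
have t1 : norm2 x0 <= norm2 x + norm2 (x - x0).
  by rewrite norm2_subC; exact: norm2_sub_ge.
have := ler_wpM2l (mulr_ge0 (ps_eta H) (ltW (ps_a H))) t1.
move=> h; apply: le_trans h _; rewrite mulrDr lerD2l; exact: ps_eta_a_R.
Qed.

(** Each hypothesis bounds the error of one line of the refinement, the two solves entering through
    their residuals. *)
Lemma ps_step xi rh ch wh dh xn :
  norm2 (rh - resid A b xi) <= eta * (a * norm2 xi + norm2 (resid A b xi)) ->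
  norm2 (ch - A^T *m rh) <= eta * a * norm2 rh ->
  norm2 (Rf^T *m wh - ch) <= eta * a * norm2 wh ->
  norm2 (Rf *m dh - wh) <= eta * a * norm2 dh ->
  norm2 (xn - (xi + dh)) <= eta * norm2 (xi + dh) ->
  norm2 (Rf *m (x - xn)) <=
    (g_IS eps + 50 * delta) * norm2 (Rf *m (x - xi))
    + 10 * (eta * (a * norm2 x + kappa * norm2 r)).
Proof.
have g1 : g_IS eps + 6 * delta <= 1.
  by have := g_IS_le (ps_eps H); have := ps_delta_le H; lra.
move=> s1 s2 s3 s4 s5.
have a0 := ltW (ps_a H).
set E := Rf *m (x - xi).
have TE : T *m E = x - xi by exact: ps_TR.
pose f := rh - resid A b xi; pose k := ch - A^T *m rh.
pose r1 := Rf^T *m wh - ch; pose r2 := Rf *m dh - wh.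
pose tau := xn - (xi + dh).
(* The exact value of both [wh] and Rf dh for the current iterate; E - C is thus the error after an
   exact step, and [om] below collects the errors made up to the forward substitution. *)
pose C := T^T *m (A^T *m (A *m (T *m E))).
have rE : resid A b xi = r + A *m (x - xi).
  by rewrite (ps_r H) /resid mulmxBr addrA subrK.
pose om := wh - C.
have omE : om = T^T *m (A^T *m f) + T^T *m k + T^T *m r1.
  have -> : T^T *m r1 = wh - T^T *m ch.
    by rewrite mulmxBr mulmxA -trmx_mul /T mulmxV ?ps_unit // trmx1 mul1mx.
  have -> : T^T *m k = T^T *m ch - T^T *m (A^T *m rh) by rewrite mulmxBr.
  (* The normal equations remove r, so the exact part of A^T rh is A^T A (x - xi). *)
  have -> : A^T *m f = A^T *m rh - A^T *m (A *m (T *m E)).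
    by rewrite /f rE mulmxBr mulmxDr (ps_r H) (normal_equations (ps_x H)) add0r TE.
  rewrite mulmxBr /om -/C; clear om; move: C (T^T *m (A^T *m rh)) (T^T *m ch) => u1 u2 u3.
  by apply/colP => i; rewrite !mxE; ring.
have EE : Rf *m (x - xn) = (E - C) - om - r2 - Rf *m tau.
  rewrite /om /r2 /tau /E !mulmxBr !mulmxDr.
  clear om omE; move: C (Rf *m xn) (Rf *m x) (Rf *m xi) (Rf *m dh) => u1 u2 u3 u4 u5.
  by apply/colP => i; rewrite !mxE; ring.
have hcon : norm2 (E - C) <= (g_IS eps + 6 * delta) * norm2 E by exact: ps_contraction.
apply: (@step_arith _ delta eta a kappa (norm2 r) (norm2 x) (g_IS eps) (norm2 E)
  (norm2 f) (norm2 om) (norm2 wh) (norm2 (Rf *m dh)) (norm2 r2) (norm2 (Rf *m tau))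
  (norm2 rh) (norm2 (resid A b xi)) (norm2 xi) (norm2 (xi + dh)) (norm2 (Rf *m (x - xn)))
  (ps_deltaE H) ps_delta ps_eta_delta a0 (norm2_ge0 _) (norm2_ge0 _) (norm2_ge0 _)
  (norm2_ge0 _) (norm2_ge0 _) (norm2_ge0 _) _ _ s1 _ _ _ _ _ _ _ _).
- have t1 : norm2 xi <= norm2 x + norm2 (x - xi).
    by rewrite norm2_subC; exact: norm2_sub_ge.
  have h := ler_wpM2l (mulr_ge0 (ps_eta H) a0) t1; apply: le_trans h _.
  by rewrite mulrDr lerD2l; exact: ps_eta_a_R.
- by rewrite rE; apply: le_trans (norm2_triangle _ _) _; rewrite lerD2l; exact: ps_A_le.
- exact: norm2_sub_ge.
- rewrite omE; apply: le_trans (norm2_triangle _ _) _.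
  apply: lerD; last exact: (ps_tT_le s3).
  apply: le_trans (norm2_triangle _ _) _.
  by apply: lerD; [exact: ps_tAT_le|exact: (ps_tT_le s2)].
- have {1}-> : wh = om + (E - (E - C)).
    by rewrite subKr /om subrK.
  apply: le_trans (norm2_triangle _ _) _; rewrite addrC lerD2r.
  apply: le_trans (norm2B_triangle _ _) _; rewrite mulr_natl mulr2n lerD2l.
  apply: le_trans hcon _; by rewrite ler_piMl ?norm2_ge0.
- exact: le_trans s4 (ps_eta_a_R dh).
- exact: norm2_sub_ge.
- apply: le_trans (ps_R_le tau) _; rewrite ler_wpM2l ?divr_ge0 //.
  by rewrite ler_wpM2l.
- have t1 : norm2 (xi + dh) <= norm2 x + norm2 (x - (xi + dh)).
    by rewrite norm2_subC; exact: norm2_sub_ge.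
  have h := ler_wpM2l (mulr_ge0 (ps_eta H) a0) t1; apply: le_trans h _.
  rewrite mulrDr lerD2l; apply: le_trans (ps_eta_a_R _) _.
  rewrite ler_wpM2l ?mulr_ge0 ?ps_delta_ge0 //.
  have -> : Rf *m (x - (xi + dh)) = E - Rf *m dh.
    by rewrite /E !mulmxBr mulmxDr opprD addrA.
  exact: norm2B_triangle.
- rewrite EE; apply: le_trans (norm2B_triangle _ _) _; rewrite lerD2r.
  apply: le_trans (norm2B_triangle _ _) _; rewrite lerD2r.
  by apply: le_trans (norm2B_triangle _ _) _; rewrite lerD2r.
Qed.

(** The factor 3/2 for returning from Rf to A turns 4 and 1000 into 6 and 1500. *)
Lemma ps_iterates (xs : nat -> 'cV[R]_n) (Z : R) : 0 <= Z ->
  norm2 (Rf *m (x - xs 0%N)) <= 4 * Num.sqrt eps * norm2 r + 5 * Z ->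
  (forall i, norm2 (Rf *m (x - xs i.+1)) <=
    (g_IS eps + 50 * delta) * norm2 (Rf *m (x - xs i)) + 10 * Z) ->
  forall i, norm2 (A *m (x - xs i)) <=
    6 * Num.sqrt eps * (g_IS eps + 50 * delta) ^+ i * norm2 r + 1500 * Z.
Proof.
have g0 := g_IS_ge0 (ps_eps H); have g1 := g_IS_le (ps_eps H).
have /andP[d0 d1] := ps_delta.
set G := g_IS eps + 50 * delta.
have G0 : 0 <= G by rewrite addr_ge0 // mulr_ge0.
have G1 : G <= 99 / 100 by rewrite /G; lra.
move=> Z0 h0 hS i.
have := geometric_iterates (mulr_ge0 (sqrtr_ge0 eps) (norm2_ge0 r)) Z0 G0 G1 _ hS i.
rewrite mulrA => /(_ h0) hi; apply: le_trans (ps_A_le _) _.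
apply: le_trans (_ : 3 / 2 * (4 * G ^+ i * (Num.sqrt eps * norm2 r) + 1000 * Z) <= _).
  by rewrite ler_wpM2l ?divr_ge0.
by rewrite le_eqVlt; apply/orP; left; apply/eqP; field.
Qed.

End PerturbedSketching.

(** * The computed iterates *)

Section ComputedIterates.
Variable R : realType.

Lemma expr1D_linear_le (t : R) k : 0 <= t -> 2 * k%:R * t <= 1 ->
  (1 + t) ^+ k <= 1 + 2 * k%:R * t.
Proof.
move=> t0; elim: k => [_|k IH]; first by rewrite expr0 mulr0 mul0r addr0.
rewrite -natr1 => hk.
have hk' : 2 * k%:R * t <= 1 by lra.
rewrite exprS; apply: le_trans (ler_wpM2l _ (IH hk')) _; first by rewrite addr_ge0.
have := ler_wpM2l t0 hk'; lra.
Qed.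

Lemma norm2_relative_error n (v' v : 'cV[R]_n) (h : R) : 0 <= h ->
  (forall i, `|v' i 0 - v i 0| <= h * `|v i 0|) -> norm2 (v' - v) <= h * norm2 v.
Proof.
move=> h0 hv; rewrite (_ : h * norm2 v = norm2 (h *: v)); last by rewrite norm2Z ger0_norm.
by apply: norm2_le_entry => i; rewrite !mxE normrM (ger0_norm h0).
Qed.

(** Guarantees that the substitutions divide only by nonzero numbers, where the rounding model gives
    information. *)
Lemma upper_triangular_diag_neq0 n (U : 'M[R]_n) :
  U \in unitmx -> (forall i j : 'I_n, (j < i)%N -> U i j = 0) -> forall i, U i i != 0.
Proof.
move=> hu hz i.
have ht : is_trig_mx U^T by apply/is_trig_mxP => k l kl; rewrite mxE hz.
have := hu; rewrite unitmxE unitfE -det_tr (det_trig ht) => /prodf_neq0 /(_ i isT).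
by rewrite mxE.
Qed.

Lemma loop_iota_iter X (f : X -> cost X) x0 i :
  (loop (iota 0 i) (fun _ => f) x0).1 = iter i (fun x => (f x).1) x0.
Proof.
elim: i => [//|i IH].
by rewrite -addn1 iotaD cats1 loop_rcons IH addn1.
Qed.

Lemma iterative_sketching_val d m n u (fl : fp_arith u)
    (mulS : forall k, 'M[R]_(m, k) -> cost 'M[R]_(d, k)) (A : 'M[R]_(m, n)) b q :
  let qr := (householder_qr fl (mulS n A).1).1 in
  let z := (apply_QT fl n qr.2 (mulS 1%N b).1).1 in
  (iterative_sketching fl mulS A b q).1 =
    iter q (fun x => (refine fl A b qr.1 x).1) (back_subst fl qr.1 z).1.
Proof.
move=> qr z; rewrite /iterative_sketching bind_val bind_val.
rewrite /z /qr; case: (householder_qr _ _).1 => [Rf hs].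
by rewrite -loop_iota_iter.
Qed.

(** Since 1 - eps > 0, S A inherits injectivity from A. This supplies the shape condition of
    Householder QR. *)
Lemma embedding_dim d m n (S : 'M[R]_(d, m)) (A : 'M[R]_(m, n)) (b : 'cV[R]_m) (eps : R) :
  \rank A = n -> eps < 1 -> subspace_embedding S eps (column_space (row_mx A b)) ->
  (n <= d)%N.
Proof.
move=> rA e1 hS.
have : row_free (S *m A)^T.
  apply/inj_row_free => v hv.
  have h0 : S *m (A *m v^T) = 0.
    by rewrite mulmxA -[LHS]trmxK trmx_mul trmxK hv trmx0.
  have := (hS (A *m v^T) _).1; rewrite h0 norm20 => h1.
  have h2 : norm2 (A *m v^T) = 0.
    apply/eqP; rewrite eq_le norm2_ge0 andbT.
    have e2 : 0 < 1 - eps by lra.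
    by rewrite -(pmulr_rle0 _ e2) h1 //; have := column_space_row_mx A b v^T 0; rewrite scale0r addr0.
  have [K K0 hK] := full_rank_norm2_lower rA.
  apply: trmx_inj; rewrite trmx0; apply: norm2_eq0; apply/eqP.
  by rewrite eq_le norm2_ge0 andbT; have := hK v^T; rewrite h2 mulr0.
by rewrite /row_free => /eqP <-; rewrite rank_leq_col.
Qed.

(* 800 K^4: the computed sketch has n columns of norm at most 2 |A|, each with
   relative backward error 400 K^3 u from Householder QR. *)
Lemma iterates_error m n d (c0 : R) (A : 'M[R]_(m, n)) b x (S : 'M[R]_(d, m))
    (eps u : R) (fl : fp_arith u) mulS (c : R) :
  sketching_setup c0 A b x S eps u mulS -> `|c0| <= c ->
  forall (K : nat) (alpha : R), K = (1 + m + n + d)%N -> alpha = c + 800 * K%:R ^+ 4 ->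
  alpha * cond A * u <= 1 / 10000 ->
  forall i, norm2 (A *m (x - (iterative_sketching fl mulS A b i).1)) <=
    6 * Num.sqrt eps * (g_IS eps + 50 * (alpha * u * cond A)) ^+ i
      * norm2 (resid A b x)
    + 1500 * (alpha * u * (opnorm A * norm2 x + cond A * norm2 (resid A b x))).
Proof.
move=> [n0 nm rA hx heps hS u0 hB hb] hc K alpha KE alphaE hak.
have /andP[eps0 eps1] := heps.
have eps_lt1 : eps < 1 by clear - eps1; lra.
have ope : 1 + eps <= 13 / 10 by clear - eps1; lra.
have nd := embedding_dim rA eps_lt1 hS.
have a0 := opnorm_gt0 n0 rA; set a := opnorm A in hB a0 *.
have k1 := cond_ge1 n0 rA; set kappa := cond A in hak k1 *.
have dK : (d < K)%N by rewrite KE -{1}[d]add0n ltn_add2r.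
have nK : (n < K)%N by rewrite KE ltn_addr // -{1}[n]add0n ltn_add2r.
have mK : (m < K)%N by rewrite KE -addnA ltn_addr // add1n.
have K0 : (0 < K)%N by exact: leq_ltn_trans dK.
pose k : R := K%:R.
have kge1 : 1 <= k by rewrite ler1n.
have kn : n%:R <= k by rewrite ler_nat ltnW.
have kd : d%:R <= k by rewrite ler_nat ltnW.
have km : m%:R <= k by rewrite ler_nat ltnW.
have k_ge0 : 0 <= k by exact: le_trans ler01 kge1.
have c_ge0 : 0 <= c by exact: le_trans (normr_ge0 _) hc.
have kk i : k ^+ i <= k ^+ i.+1 by rewrite exprS ler_peMl ?exprn_ge0.
have k12 : k <= k ^+ 2 by exact: (kk 1%N).
have k23 := kk 2%N; have k34 := kk 3%N.
have u_ge0 := ltW u0.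
pose eta := alpha * u.
have alpha_ge0 : 0 <= alpha.
  rewrite alphaE; apply: addr_ge0 c_ge0 _; apply: mulr_ge0 (ler0n _ _) _.
  exact: exprn_ge0.
have eta0 : 0 <= eta by rewrite mulr_ge0.
have eta_le : eta <= 1 / 10000.
  apply: le_trans hak; rewrite mulrAC -/eta ler_peMr //.
have etaE : eta = c * u + 800 * (k ^+ 4 * u) by rewrite /eta alphaE -/k; ring.
have cu0 : 0 <= c * u by rewrite mulr_ge0.
(* As K >= 1, [t] dominates every lower power of K times u; all rounding bounds below are compared
   with c u + 800 t = eta. *)
pose t := k ^+ 4 * u; have t0 : 0 <= t by rewrite mulr_ge0 ?exprn_ge0.
rewrite -/t in etaE.
have t3 : k ^+ 3 * u <= t by rewrite ler_wpM2r.
have t2 : k ^+ 2 * u <= t by apply: le_trans t3; rewrite ler_wpM2r.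
have t1 : k * u <= t by apply: le_trans t2; rewrite ler_wpM2r.
pose h := 2 * K%:R * u.
have hE : h = 2 * K%:R * u by [].
have h_t : h <= 2 * t by rewrite hE -mulrA ler_wpM2l.
have h_le : h <= 1 / 1000.
  by clear - h_t etaE eta_le cu0 t0; lra.
have h0 : 0 <= h := h_ge0 u_ge0 hE.
have h_eta : h <= eta by clear - h_t etaE cu0 t0; lra.
have c0u : c0 * u <= c * u by rewrite ler_wpM2r // (le_trans (ler_norm _) hc).
have hin : column_space (row_mx A b) b.
  by have := column_space_row_mx A b 0 1; rewrite mulmx0 scale1r add0r.
have hinA w : column_space (row_mx A b) (A *m w).
  by have := column_space_row_mx A b w 0; rewrite scale0r addr0.
set B := (mulS n A).1 in hB.
have hBw w : norm2 (B *m w - S *m (A *m w)) <= c * u * (a * norm2 w).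
  rewrite mulmxA -mulmxBl; apply: le_trans (mulmx_norm2_le_opnorm _ _) _.
  rewrite mulrA ler_wpM2r ?norm2_ge0 //; apply: le_trans hB _.
  by rewrite mulrAC ler_wpM2r ?(ltW a0).
have hSA w : norm2 (S *m (A *m w)) <= 13 / 10 * (a * norm2 w).
  apply: le_trans (hS _ (hinA w)).2 _; apply: ler_pM => //.
  - by rewrite addr_ge0 // ltW.
  - exact: norm2_ge0.
  - exact: mulmx_norm2_le_opnorm.
have hcol j : norm2 (col j B) <= 2 * a.
  rewrite -mulmx_delta.
  have := norm2_sub_ge (B *m delta_mx j 0) (S *m (A *m delta_mx j 0)).
  have := hBw (delta_mx j 0); have := hSA (delta_mx j 0); rewrite norm2_delta mulr1.
  have : c * u * a <= 1 / 10 * a.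
    by rewrite ler_wpM2r ?(ltW a0) //; clear - etaE eta_le t0; lra.
  move: (norm2 _) (norm2 _) (norm2 _) => N1 N2 N3; move: a0; clear; move: a => z *; lra.
move qrE : (householder_qr fl B).1 => qr.
have [Q [hQ hUz hQR hQT]] :=
  householder_qr_backward_error u_ge0 hE h_le K0 nd dK hcol (esym qrE).
set q := (1 + 100 * d%:R * h) ^+ n in hQR hQT.
(* Linearizing the power gives 2 n (100 d h) with h = 2 K u, that is 400 n d K u. *)
have hq : q - 1 <= 400 * (k ^+ 3 * u).
  have e1 : 2 * n%:R * (100 * d%:R * h) <= 400 * (k ^+ 3 * u).
    have -> : 2 * n%:R * (100 * d%:R * h) = 400 * (n%:R * d%:R * (k * u)) by rewrite hE -/k; ring.
    have -> : k ^+ 3 * u = k * k * (k * u) by ring.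
    apply: ler_wpM2l (ler0n _ _) _ _ _; apply: ler_wpM2r; first exact: mulr_ge0.
    exact: ler_pM.
  rewrite lerBlDl; apply: le_trans (expr1D_linear_le _ _) _.
  - by rewrite !mulr_ge0.
  - apply: le_trans e1 _; clear - t3 etaE eta_le cu0; lra.
  - by rewrite lerD2l.
have q1 : 0 <= q - 1 by rewrite subr_ge0 exprn_ege1 // lerDl !mulr_ge0.
pose r := resid A b x.
have ps : perturbed_sketch A b x S eps qr.1 Q eta a kappa (eta * kappa) r.
  split => //.
  - by rewrite /eta mulrAC.
  - exact: mulmx_norm2_le_opnorm.
  - by move=> v; exact: norm2_le_cond.
  move=> w.
  have -> : S *m (A *m w) - Q *m (qr.1 *m w) =
     (B *m w - Q *m (qr.1 *m w)) - (B *m w - S *m (A *m w)).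
    by rewrite opprB [RHS]addrC addrA subrK.
  apply: le_trans (norm2B_triangle _ _) _.
  apply: le_trans (lerD (hQR w) (hBw w)) _.
  have -> : n%:R * ((q - 1) * (2 * a)) * norm2 w + c * u * (a * norm2 w) =
     (2 * ((q - 1) * n%:R) + c * u) * (a * norm2 w) by ring.
  rewrite -[eta * a * _]mulrA ler_wpM2r ?mulr_ge0 ?norm2_ge0 ?(ltW a0) // etaE addrC lerD2l.
  have : (q - 1) * n%:R <= 400 * (k ^+ 3 * u) * k by apply: ler_pM.
  have -> : 400 * (k ^+ 3 * u) * k = 400 * t by rewrite /t; ring.
  by move=> hh; clear - hh; lra.
have hunit := ps_unit ps.
have hdiag := upper_triangular_diag_neq0 hunit hUz.
(* The substitution bounds need a bound on the entries of the computed factor; it comes from |Rf w|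
   <= 13/10 |A| |w| on basis vectors. *)
have hent i j : `|qr.1 i j| <= 13 / 10 * a.
  have := ps_R_le ps (delta_mx j 0); rewrite norm2_delta mulr1; apply: le_trans.
  by rewrite mulmx_delta; apply: le_trans (entry_le_norm2 _ i); rewrite mxE.
have htri : h * (7 * n%:R ^+ 2 * (13 / 10 * a)) <= eta * a.
  have -> : h * (7 * n%:R ^+ 2 * (13 / 10 * a)) = 91 / 10 * (h * n%:R ^+ 2) * a by field.
  rewrite ler_wpM2r ?(ltW a0) //.
  have : h * n%:R ^+ 2 <= h * k ^+ 2.
    by rewrite ler_wpM2l // ler_pXn2r ?nnegrE.
  have -> : h * k ^+ 2 = 2 * (k ^+ 3 * u) by rewrite hE -/k; ring.
  by move=> hh; clear - hh t3 etaE cu0 t0; lra.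
have hmv : h * (m%:R * n%:R * a) <= 2 * t * a.
  rewrite mulrA ler_wpM2r ?(ltW a0) //.
  have : m%:R * n%:R <= k * k by apply: ler_pM.
  move=> /(ler_wpM2l h0) hh; apply: le_trans hh _.
  have -> : h * (k * k) = 2 * (k ^+ 3 * u) by rewrite hE -/k; ring.
  by rewrite ler_wpM2l.
have back c1 : norm2 (qr.1 *m (back_subst fl qr.1 c1).1 - c1) <=
    eta * a * norm2 (back_subst fl qr.1 c1).1.
  apply: le_trans (back_subst_residual u_ge0 hE h_le K0 nK hdiag hUz hent erefl) _.
  by rewrite ler_wpM2r ?norm2_ge0.
have forw c1 : norm2 (qr.1^T *m (forward_subst fl qr.1^T c1).1 - c1) <=
    eta * a * norm2 (forward_subst fl qr.1^T c1).1.
  apply: le_trans (_ : h * (7 * n%:R ^+ 2 * (13 / 10 * a)) *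
      norm2 (forward_subst fl qr.1^T c1).1 <= _); last first.
    by rewrite ler_wpM2r ?norm2_ge0.
  apply: (forward_subst_residual u_ge0 hE h_le K0 nK _ _ _ erefl).
  - by move=> i; rewrite mxE.
  - by move=> i j ij; rewrite mxE hUz.
  - by move=> i j; rewrite mxE.
set z := (apply_QT fl n qr.2 (mulS 1%N b).1).1.
pose xs i := iter i (fun x => (refine fl A b qr.1 x).1) (back_subst fl qr.1 z).1.
have Z0 : 0 <= eta * (a * norm2 x + kappa * norm2 r).
  by rewrite mulr_ge0 // addr_ge0 // mulr_ge0 ?norm2_ge0 ?(ltW a0) // (le_trans ler01 k1).
have hinit : norm2 (qr.1 *m (x - xs 0%N)) <=
    4 * Num.sqrt eps * norm2 r + 5 * (eta * (a * norm2 x + kappa * norm2 r)).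
  apply: (ps_initial ps (zh := z)); last exact: back.
  set Sb := (mulS 1%N b).1 in hb *.
  have -> : z - Q^T *m (S *m b) = (z - Q^T *m Sb) + Q^T *m (Sb - S *m b).
    by rewrite mulmxBr addrA subrK.
  apply: le_trans (norm2_triangle _ _) _.
  have e1 : norm2 (Q^T *m (Sb - S *m b)) <= norm2 (Sb - S *m b).
    have := @trmx_norm2_le _ _ _ Q 1 ler01 _ (Sb - S *m b); rewrite mul1r.
    by apply => w; rewrite mul1r (norm2_orthogonal _ hQ).
  have e2 : norm2 (Sb - S *m b) <= c * u * norm2 b.
    by apply: le_trans hb _; rewrite mulrAC ler_wpM2r ?norm2_ge0.
  have e3 : norm2 Sb <= 2 * norm2 b.
    apply: le_trans (norm2_sub_ge Sb (S *m b)) _.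
    have e4 : norm2 (S *m b) <= 13 / 10 * norm2 b.
      by apply: le_trans (hS b hin).2 _; rewrite ler_wpM2r ?norm2_ge0.
    apply: le_trans (lerD e4 e2) _; rewrite -mulrDl ler_wpM2r ?norm2_ge0 //.
    by clear - etaE eta_le t0; lra.
  have e5 : norm2 (z - Q^T *m Sb) <= 800 * t * norm2 b.
    apply: le_trans (hQT Sb) _.
    apply: le_trans (ler_pM q1 (norm2_ge0 _) hq e3) _.
    have -> : 400 * (k ^+ 3 * u) * (2 * norm2 b) = 800 * (k ^+ 3 * u) * norm2 b by ring.
    apply: ler_wpM2r (norm2_ge0 _) _ _ _.
    exact: ler_wpM2l (ler0n _ _) _ _ t3.
  apply: le_trans (lerD e5 (le_trans e1 e2)) _.
  by rewrite etaE -mulrDl addrC.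
have hstep i : norm2 (qr.1 *m (x - xs i.+1)) <=
    (g_IS eps + 50 * (eta * kappa)) * norm2 (qr.1 *m (x - xs i)) +
    10 * (eta * (a * norm2 x + kappa * norm2 r)).
  rewrite -[xs i.+1]/((refine fl A b qr.1 (xs i)).1); set xi := xs i.
  pose Ax := (fmulmxv fl A xi).1.
  pose rh : 'cV[R]_m := \col_j fl_sub fl (b j 0) (Ax j 0).
  pose ch := (fmulmxv fl A^T rh).1.
  pose wh := (forward_subst fl qr.1^T ch).1.
  pose dh := (back_subst fl qr.1 wh).1.
  have -> : (refine fl A b qr.1 xi).1 = \col_j fl_add fl (xi j 0) (dh j 0) by [].
  apply: (ps_step ps (rh := rh) (ch := ch) (wh := wh) (dh := dh)).
  - have e1 : norm2 (Ax - A *m xi) <= 2 * t * (a * norm2 xi).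
      apply: le_trans (fmulmxv_error fl u_ge0 hE h_le xi nK (entry_le_opnorm A)) _.
      by rewrite [leRHS]mulrA ler_wpM2r ?norm2_ge0.
    have e2 : norm2 (rh - (b - Ax)) <= h * norm2 (b - Ax).
      apply: norm2_relative_error => // j; rewrite !mxE.
      exact: fl_sub_le u_ge0 hE K0 _ _.
    have e3 : norm2 (b - Ax) <= norm2 (resid A b xi) + norm2 (Ax - A *m xi).
      have -> : b - Ax = resid A b xi - (Ax - A *m xi).
        by rewrite /resid opprB addrA subrK.
      exact: norm2B_triangle.
    have -> : rh - resid A b xi = (rh - (b - Ax)) - (Ax - A *m xi).
      by rewrite /resid; apply/colP => j; rewrite !mxE; ring.
    apply: le_trans (norm2B_triangle _ _) _.
    have hh0 : h <= 1 by clear - h_le; lra.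
    have e4 := ler_wpM2l h0 e3.
    have e5 := ler_wpM2r (norm2_ge0 (Ax - A *m xi)) hh0.
    have e6 := ler_wpM2r (norm2_ge0 (resid A b xi)) h_eta.
    have e7 : 4 * t * (a * norm2 xi) <= eta * (a * norm2 xi).
      rewrite ler_wpM2r ?mulr_ge0 ?norm2_ge0 ?(ltW a0) //.
      by clear - etaE cu0 t0; lra.
    rewrite mulrDr.
    move: (norm2 (resid A b xi)) (norm2 (Ax - A *m xi)) (norm2 (b - Ax)) (norm2 (rh - (b - Ax)))
      (a * norm2 xi) e1 e2 e3 e4 e5 e6 e7 => N1 N2 N3 N4 N5; clear => *; lra.
  - apply: le_trans (fmulmxv_error fl u_ge0 hE h_le rh mK (a := a) _) _.
      by move=> i1 j; rewrite mxE; exact: entry_le_opnorm.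
    rewrite ler_wpM2r ?norm2_ge0 // [n%:R * _]mulrC; apply: le_trans hmv _.
    by rewrite ler_wpM2r ?(ltW a0) //; clear - etaE cu0 t0; lra.
  - exact: forw.
  - exact: back.
  - apply: le_trans (norm2_relative_error h0 _) _; last by rewrite ler_wpM2r ?norm2_ge0 ?h_eta.
    by move=> j; rewrite !mxE; exact: fl_add_le u_ge0 hE K0 _ _.
move=> i; rewrite iterative_sketching_val -/B qrE -/z -/(xs i).
exact: (ps_iterates ps Z0 hinit hstep i).
Qed.

End ComputedIterates.

(** * Operation counts *)

Section Cost.
Variables (R : realType) (u : R) (fl : fp_arith u).

Lemma bind_cost X Y (p : cost X) (f : X -> cost Y) :
  (bind p f).2 = (p.2 + (f p.1).2)%N.
Proof. by []. Qed.

Lemma loop_cost I X (s : seq I) (body : I -> X -> cost X) x0 c :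
  (forall i x, (body i x).2 <= c)%N -> ((loop s body x0).2 <= size s * c)%N.
Proof.
move=> hb; elim/last_ind: s => [//|s i IH].
by rewrite /loop foldl_rcons bind_cost size_rcons mulSn addnC leq_add.
Qed.

Lemma fdot_cost I (s : seq I) (f g : I -> R) : ((fdot fl s f g).2 <= 2 * size s)%N.
Proof. by rewrite mulnC; apply: loop_cost. Qed.

Lemma vgen_cost n (f : 'I_n -> cost R) c :
  (forall i, (f i).2 <= c)%N -> ((vgen f).2 <= n * c)%N.
Proof.
move=> hf; apply: leq_trans (_ : \sum_(i < n) c <= _)%N; first exact: leq_sum.
by rewrite sum_nat_const card_ord.
Qed.

Lemma cgen_cost m n (f : 'I_n -> cost 'cV[R]_m) c :
  (forall i, (f i).2 <= c)%N -> ((cgen f).2 <= n * c)%N.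
Proof.
move=> hf; apply: leq_trans (_ : \sum_(i < n) c <= _)%N; first exact: leq_sum.
by rewrite sum_nat_const card_ord.
Qed.

Lemma fmulmxv_cost m n (M : 'M[R]_(m, n)) v : ((fmulmxv fl M v).2 <= m * (2 * n))%N.
Proof.
apply: vgen_cost => i; apply: leq_trans (fdot_cost _ _ _) _.
by rewrite size_enum_ord.
Qed.

Lemma solve_row_cost n (T : 'M[R]_n) c (J : seq 'I_n) i y : (size J <= n)%N ->
  ((solve_row fl T c J i y).2 <= 2 * n + 2)%N.
Proof.
move=> hJ; rewrite /solve_row !bind_cost /= !addn0 !addnA -addnA leq_add //.
by apply: leq_trans (fdot_cost _ _ _) _; rewrite leq_mul2l.
Qed.

Lemma size_filter_ord n (p : pred 'I_n) : (size [seq i <- enum 'I_n | p i] <= n)%N.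
Proof. by rewrite size_filter (leq_trans (count_size _ _)) // size_enum_ord. Qed.

Lemma forward_subst_cost n (L : 'M[R]_n) c :
  ((forward_subst fl L c).2 <= n * (2 * n + 2))%N.
Proof.
apply: leq_trans (_ : size (enum 'I_n) * (2 * n + 2) <= _)%N; last by rewrite size_enum_ord.
by apply: loop_cost => i y; exact: solve_row_cost (size_filter_ord _).
Qed.

Lemma back_subst_cost n (U : 'M[R]_n) c :
  ((back_subst fl U c).2 <= n * (2 * n + 2))%N.
Proof.
apply: leq_trans (_ : size (rev (enum 'I_n)) * (2 * n + 2) <= _)%N; last first.
  by rewrite size_rev size_enum_ord.
by apply: loop_cost => i y; exact: solve_row_cost (size_filter_ord _).
Qed.

Lemma make_reflector_cost d k (y : 'cV[R]_d) :
  ((make_reflector fl k y).2 <= 2 * d + 4)%N.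
Proof.
rewrite /make_reflector !bind_cost /=; rewrite leq_add //.
by apply: leq_trans (fdot_cost _ _ _) _; rewrite leq_mul2l size_filter_ord.
Qed.

Lemma apply_reflector_cost d (h : reflector R d) (y : 'cV[R]_d) :
  ((apply_reflector fl h y).2 <= 4 * d + 1)%N.
Proof.
case: h => [[k v] beta]; rewrite /apply_reflector !bind_cost.
apply: leq_trans (_ : 2 * d + (1 + d * 2) <= _)%N.
  apply: leq_add; last apply: leq_add => //.
    by apply: leq_trans (fdot_cost _ _ _) _; rewrite leq_mul2l size_filter_ord.
  by apply: vgen_cost => i; case: ifP.
by rewrite addnCA addnC leq_add2r (mulnC d) -mulnDl.
Qed.

Lemma householder_step_cost d n (k : 'I_n) st :
  ((householder_step (d := d) fl k st).2 <= 2 * d + 4 + n * (4 * d + 1))%N.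
Proof.
case: st => W hs; rewrite /householder_step bind_cost; apply: leq_add.
  exact: make_reflector_cost.
case: (make_reflector _ _ _).1 => h s; rewrite bind_cost /= addn0.
apply: cgen_cost => j; case: ifP => // _; case: ifP => // _.
exact: apply_reflector_cost.
Qed.

Lemma householder_qr_cost d n (B : 'M[R]_(d, n)) :
  ((householder_qr fl B).2 <= n * (2 * d + 4 + n * (4 * d + 1)))%N.
Proof.
rewrite /householder_qr bind_cost /= addn0.
apply: leq_trans (_ : size (enum 'I_n) * (2 * d + 4 + n * (4 * d + 1)) <= _)%N; last first.
  by rewrite size_enum_ord.
by apply: loop_cost => i st; exact: householder_step_cost.
Qed.

(** The cost of applying Q^T is proportional to the number of stored reflectors. *)
Lemma householder_qr_size d n (B : 'M[R]_(d, n)) :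
  size (householder_qr fl B).1.2 = n.
Proof.
rewrite /householder_qr bind_val /= loop_val.
apply: (@foldl_enum_ind _ _ _ (fun k (st : 'M[R]_(d, n) * seq (reflector R d)) => size st.2 = k)) => // k [W hs] /= <-.
rewrite /householder_step /=; case: (make_reflector fl k (col k W)) => [[h s] c] /=.
by rewrite size_rcons.
Qed.

Lemma apply_QT_cost d n hs (y : 'cV[R]_d) :
  ((apply_QT fl n hs y).2 <= size hs * (4 * d + 1))%N.
Proof.
rewrite /apply_QT bind_cost /= addn0; apply: loop_cost => h z.
exact: apply_reflector_cost.
Qed.

Lemma refine_cost m n (A : 'M[R]_(m, n)) b Rf x :
  ((refine fl A b Rf x).2 <=
    m * (2 * n) + (m + (n * (2 * m) + (n * (2 * n + 2) + (n * (2 * n + 2) + n)))))%N.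
Proof.
rewrite /refine !bind_cost; apply: leq_add; first exact: fmulmxv_cost.
apply: leq_add.
  by rewrite -[leqRHS]muln1; apply: vgen_cost.
apply: leq_add; first exact: fmulmxv_cost.
apply: leq_add; first exact: forward_subst_cost.
apply: leq_add; first exact: back_subst_cost.
by rewrite -[leqRHS]muln1; apply: vgen_cost.
Qed.

Lemma iterative_sketching_cost d m n
    (mulS : forall k, 'M[R]_(m, k) -> cost 'M[R]_(d, k)) (A : 'M[R]_(m, n)) b q :
  ((iterative_sketching fl mulS A b q).2 <=
    (mulS n A).2 + (n * (2 * d + 4 + n * (4 * d + 1)) + ((mulS 1%N b).2 +
    (n * (4 * d + 1) + (n * (2 * n + 2) +
    q * (m * (2 * n) + (m + (n * (2 * m) + (n * (2 * n + 2) + (n * (2 * n + 2) + n))))))))))%N.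
Proof.
rewrite /iterative_sketching bind_cost leq_add2l bind_cost; apply: leq_add.
  exact: householder_qr_cost.
have := householder_qr_size (mulS n A).1.
case: (householder_qr fl (mulS n A).1).1 => Rf hs hsz.
rewrite bind_cost leq_add2l bind_cost; apply: leq_add.
  by rewrite -[X in (_ <= X * _)%N]hsz; exact: apply_QT_cost.
rewrite bind_cost; apply: leq_add; first exact: back_subst_cost.
rewrite -[X in (_ <= X * _)%N](size_iota 0 q).
by apply: loop_cost => i x; exact: refine_cost.
Qed.

(** The inner products run along rows, whose numbers of nonzeros vary. Exchanging the sums counts
    them by columns, at most zeta in each. *)
Lemma sparse_mulmx_cost d m k zeta (S : 'M[R]_(d, m)) (X : 'M[R]_(m, k)) :
  sparse_sign_mx zeta S -> ((sparse_mulmx fl S X).2 <= k * (2 * (m * zeta)))%N.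
Proof.
move=> [s -> hs]; apply: cgen_cost => l.
set S' := _ *: s.
apply: leq_trans (_ : \sum_(i < d) 2 * (\sum_(j < m) (S' i j != 0%R)) <= _)%N.
  apply: leq_sum => i _; apply: leq_trans (fdot_cost _ _ _) _.
  rewrite leq_mul2l /= size_filter -sum1_count big_enum_cond /= big_mkcond /=.
  by apply: leq_sum => j _; case: (S' i j != 0).
rewrite -big_distrr leq_mul2l /= exchange_big /=.
apply: leq_trans (_ : \sum_(j < m) zeta <= _)%N; last first.
  by rewrite sum_nat_const card_ord.
apply: leq_sum => j _; have [<- _] := hs j.
rewrite -sum1_card [leqRHS]big_mkcond; apply: leq_sum => i _.
rewrite !mxE inE; case: (s i j =P 0) => [->|] //=; first by rewrite mulr0 eqxx.
by case: (_ != 0).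
Qed.

End Cost.

(** * Number of iterations, final error and operation bounds *)

Section FinalEstimates.
Variable R : realType.

(** The integer part of the logarithm of 1 / u in base 10/9, plus one, so that (9/10)^q falls below
    u. *)
Definition iteration_count (u : R) : nat := (Num.truncn (ln (1 / u) / ln (10 / 9))).+1.

(** The second term pays for the added iteration: ln (1 / u) / ln 2 >= 1 as soon as u <= 1/2. *)
Definition iteration_rate : R := 1 / ln (10 / 9) + 1 / ln 2.

Lemma iteration_rate_ge0 : 0 <= iteration_rate.
Proof.
have l1 : 0 < ln (10 / 9 : R) by rewrite ln_gt0 //; lra.
have l2 : 0 < ln (2 : R) by rewrite ln_gt0 //; lra.
by rewrite addr_ge0 // divr_ge0 // ltW.
Qed.

Lemma ln_half_le (u : R) : 0 < u -> u <= 1 / 2 -> ln 2 <= ln (1 / u).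
Proof.
move=> u0 u1; rewrite ler_ln ?posrE ?divr_gt0 //.
by rewrite ler_pdivlMr //; lra.
Qed.

Lemma iteration_count_le (u : R) : 0 < u -> u <= 1 / 2 ->
  (iteration_count u)%:R <= iteration_rate * ln (1 / u).
Proof.
move=> u0 u1; have := ln_half_le u0 u1.
have l1 : 0 < ln (10 / 9 : R) by rewrite ln_gt0 //; lra.
have l2 : 0 < ln (2 : R) by rewrite ln_gt0 //; lra.
move=> hl; have l0 := le_trans (ltW l2) hl.
have q0 : 0 <= ln (1 / u) / ln (10 / 9) by rewrite divr_ge0 // ltW.
have /andP[t1 _] := Num.Theory.truncn_itv q0.
have -> : (iteration_count u)%:R = (Num.truncn (ln (1 / u) / ln (10 / 9)))%:R + 1 :> R.
  by rewrite natr1.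
rewrite /iteration_rate [leRHS]mulrDl; apply: lerD.
  by rewrite (div1r (ln (10 / 9))) [leRHS]mulrC.
by rewrite (div1r (ln 2)) [leRHS]mulrC ler_pdivlMr // [leLHS]mul1r.
Qed.

Lemma iteration_count_pow (u : R) : 0 < u -> u <= 1 / 2 ->
  (9 / 10) ^+ iteration_count u <= u.
Proof.
move=> u0 u1.
have l1 : 0 < ln (10 / 9 : R) by rewrite ln_gt0 //; lra.
have l2 : 0 < ln (2 : R) by rewrite ln_gt0 //; lra.
have l0 := le_trans (ltW l2) (ln_half_le u0 u1).
have q0 : 0 <= ln (1 / u) / ln (10 / 9) by rewrite divr_ge0 // ltW.
have /andP[_ t2] := Num.Theory.truncn_itv q0.
rewrite -/(iteration_count u) in t2; move: (iteration_count u) t2 => q t2.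
have p0 : 0 < 10 / 9 :> R by lra.
have : 1 / u <= (10 / 9) ^+ q.
  rewrite -ler_ln ?posrE ?exprn_gt0 ?divr_gt0 // (lnXn _ p0) -[leRHS]mulr_natl.
  by rewrite -(ler_pdivrMr _ _ l1) ltW.
have -> : 9 / 10 = (10 / 9)^-1 :> R by rewrite invf_div.
rewrite exprVn => h.
by rewrite -[leRHS]invrK lef_pV2 ?posrE ?invr_gt0 ?exprn_gt0 // -div1r.
Qed.

(** [M] stands for |A (x - xi)|, which is also the difference of the residuals; the forward error
    [N] costs a further kappa / |A|. *)
Lemma forward_error_arith (a kappa c alpha u g s rho X N M G : R) (i : nat) :
  0 < a -> 1 <= kappa -> 0 <= u -> 0 <= alpha -> 50 * alpha <= c -> 1500 * alpha <= c ->
  0 <= s -> 0 <= rho -> 0 <= X -> 0 <= g -> G = g + c * kappa * u ->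
  M <= 6 * s * (g + 50 * (alpha * u * kappa)) ^+ i * rho +
      1500 * (alpha * u * (a * X + kappa * rho)) ->
  N <= kappa / a * M ->
  N <= 20 * s * kappa * G ^+ i * (rho / a) + c * kappa * u * (X + kappa / a * rho) /\
  M <= 20 * s * G ^+ i * rho + c * u * (a * X + kappa * rho).
Proof.
move=> a0 k1 u0 al0 c50 c1500 s0 r0 X0 g0 GE hM hN.
have k0 : 0 <= kappa by exact: le_trans ler01 k1.
have uk : 0 <= u * kappa by exact: mulr_ge0.
have p0 : 0 <= g + 50 * (alpha * u * kappa).
  by apply: addr_ge0 => //; apply: mulr_ge0 (ler0n _ _) _; rewrite !mulr_ge0.
have pG : g + 50 * (alpha * u * kappa) <= G.
  rewrite GE lerD2l; have := ler_wpM2r uk c50; lra.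
have hM' : M <= 20 * s * G ^+ i * rho + c * u * (a * X + kappa * rho).
  apply: le_trans hM _; apply: lerD.
    apply: ler_wpM2r => //; apply: ler_pM (exprn_ge0 _ p0) _ _.
    - exact: mulr_ge0 (ler0n _ _) s0.
    - by apply: ler_wpM2r => //; rewrite ler_nat.
    - by apply: lerXn2r; rewrite ?nnegrE // (le_trans p0).
  have e0 : 0 <= a * X + kappa * rho by rewrite addr_ge0 // mulr_ge0 // ltW.
  have := ler_wpM2r (mulr_ge0 u0 e0) c1500; lra.
split => //; apply: le_trans hN _.
have ka : 0 <= kappa / a by rewrite divr_ge0 // ltW.
apply: le_trans (ler_wpM2l ka hM') _; rewrite le_eqVlt; apply/orP; left; apply/eqP.
by field; rewrite gt_eqF.
Qed.

Lemma stable_error_arith (a kappa c u s rho X N M G : R) :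
  0 < a -> 1 <= kappa -> 0 <= u -> 0 <= c -> 0 <= s <= 1 ->
  0 <= rho -> 0 <= X -> G <= u -> 0 <= G ->
  N <= 20 * s * kappa * G * (rho / a) + c * kappa * u * (X + kappa / a * rho) ->
  M <= 20 * s * G * rho + c * u * (a * X + kappa * rho) ->
  N <= (c + 20) * kappa * (X + kappa / a * rho) * u /\
  M <= (c + 20) * (a * X + kappa * rho) * u.
Proof.
move=> a0 k1 u0 c0 /andP[s0 s1] r0 X0 Gu G0 hN hM.
have k0 : 0 <= kappa by exact: le_trans ler01 k1.
have rk : rho <= kappa * rho by rewrite ler_peMl.
have sG : s * G <= u.
  by apply: le_trans Gu; rewrite ler_piMl.
have sG0 : 0 <= s * G by rewrite mulr_ge0.
have ra : 0 <= rho / a by rewrite divr_ge0 // ltW.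
split.
- apply: le_trans hN _.
  have -> : (c + 20) * kappa * (X + kappa / a * rho) * u =
    20 * (u * (kappa * (X + kappa * (rho / a)))) + c * kappa * u * (X + kappa / a * rho) by ring.
  rewrite lerD2r.
  have -> : 20 * s * kappa * G * (rho / a) = 20 * ((s * G) * (kappa * (rho / a))) by ring.
  apply: ler_wpM2l (ler0n _ _) _ _ _.
  apply: (ler_pM sG0 (mulr_ge0 k0 ra) sG); apply: (ler_wpM2l k0).
  by rewrite ler_wpDl // ler_peMl.
- apply: le_trans hM _.
  have -> : (c + 20) * (a * X + kappa * rho) * u =
    20 * (u * (a * X + kappa * rho)) + c * u * (a * X + kappa * rho) by ring.
  rewrite lerD2r.
  have -> : 20 * s * G * rho = 20 * (s * G * rho) by ring.
  apply: ler_wpM2l (ler0n _ _) _ _ _; apply: (ler_pM sG0 r0 sG).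
  by apply: le_trans rk _; rewrite lerDr mulr_ge0 // ltW.
Qed.

(** Three monomials dominate: m n zeta for sketching, n^2 d for the QR factorization and q m n for
    the refinements. The orderings 1 <= n <= m and n <= d absorb all others. *)
Lemma cost_monomials (N M D Z Q A B T : R) :
  1 <= N -> N <= M -> N <= D -> 0 <= Z -> 0 <= Q ->
  A <= N * (2 * (M * Z)) -> B <= 1 * (2 * (M * Z)) ->
  T <= A + (N * (2 * D + 4 + N * (4 * D + 1)) + (B +
    (N * (4 * D + 1) + (N * (2 * N + 2) +
    Q * (M * (2 * N) + (M + (N * (2 * M) + (N * (2 * N + 2) + (N * (2 * N + 2) + N))))))))) ->
  T <= 4 * (M * N * Z) + 20 * (N * N * D) + 14 * (Q * (M * N)).
Proof.
move=> N1 NM ND Z0 Q0 hA hB hT.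
have N0 : 0 <= N by exact: le_trans N1.
have M0 : 0 <= M by exact: le_trans NM.
have D1 : 1 <= D by exact: le_trans ND.
have D0 : 0 <= D by exact: le_trans D1.
have MZ : M * Z <= M * N * Z by rewrite ler_wpM2r // ler_peMr.
have e1 : N * D <= N * N * D by rewrite ler_wpM2r // ler_peMl.
have e2 : N * N <= N * N * D by rewrite ler_peMr // mulr_ge0.
have e3 : N <= N * D by rewrite ler_peMr.
have e4 : Q * M <= Q * (M * N) by rewrite ler_wpM2l // ler_peMr.
have e5 : Q * (N * N) <= Q * (M * N) by rewrite ler_wpM2l // ler_wpM2r.
have e6 : Q * N <= Q * (M * N) by rewrite ler_wpM2l // ler_peMl // (le_trans N1).
clear N1 NM ND Z0 Q0 N0 M0 D1 D0; lra.
Qed.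

(** [L] is ln n and [Lam] is ln (n / u). Sketching and refinement go into m n Lam, the factorization
    into n^3 L. *)
Lemma cost_arith (N M D Z Q T L Lam Cd Cz Cq : R) :
  0 <= N -> 0 <= M -> 0 < L -> L <= Lam -> 0 <= Cq -> 0 <= D -> 0 <= Z ->
  0 < N ->
  D <= Cd * (N * L) -> Z <= Cz * L -> Q <= Cq * Lam ->
  T <= 4 * (M * N * Z) + 20 * (N * N * D) + 14 * (Q * (M * N)) ->
  T <= (4 * Cz + 20 * Cd + 14 * Cq) * (M * N * Lam + N ^+ 3 * L).
Proof.
move=> N0 M0 L0 LL Cq0 D0 Z0 Np hD hZ hQ hT.
have Cz0 : 0 <= Cz by rewrite -(pmulr_lge0 _ L0) (le_trans Z0).
have Cd0 : 0 <= Cd by rewrite -(pmulr_lge0 _ (mulr_gt0 Np L0)) (le_trans D0).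
have Lam0 : 0 <= Lam by exact: le_trans (ltW L0) LL.
have MN0 : 0 <= M * N by exact: mulr_ge0.
have x0 : 0 <= M * N * Lam by exact: mulr_ge0.
have y0 : 0 <= N ^+ 3 * L by rewrite mulr_ge0 ?exprn_ge0 // ltW.
have e1 : M * N * Z <= Cz * (M * N * Lam).
  apply: le_trans (ler_wpM2l MN0 hZ) _.
  rewrite [leRHS]mulrCA; apply: ler_wpM2l => //; exact: ler_wpM2l.
have e2 : N * N * D <= Cd * (N ^+ 3 * L).
  apply: le_trans (ler_wpM2l (mulr_ge0 N0 N0) hD) _.
  by rewrite le_eqVlt; apply/orP; left; apply/eqP; ring.
have e3 : Q * (M * N) <= Cq * (M * N * Lam).
  apply: le_trans (ler_wpM2r MN0 hQ) _.
  by rewrite le_eqVlt; apply/orP; left; apply/eqP; ring.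
have e4 : 0 <= Cz * (N ^+ 3 * L) by exact: mulr_ge0.
have e5 : 0 <= Cd * (M * N * Lam) by exact: mulr_ge0.
have e6 : 0 <= Cq * (N ^+ 3 * L) by exact: mulr_ge0.
move: x0 y0 hT e1 e2 e3 e4 e5 e6.
move: (M * N * Z) (N * N * D) (Q * (M * N)) (M * N * Lam) (N ^+ 3 * L).
clear => x1 x2 x3 x4 x5 *; lra.
Qed.

End FinalEstimates.

Theorem theorem6 (R : realType) :
  exists (q : R -> nat) (Cq : R) (Cop : R -> R -> R),
  forall c0 : nat -> nat -> nat -> R, polynomially_bounded c0 ->
  exists c1 c' : nat -> nat -> nat -> R,
    [/\ polynomially_bounded c1, (forall m n d, 0 < c1 m n d)
      & polynomially_bounded c'] /\
    (forall (m n d : nat) (A : 'M[R]_(m, n)) (b : 'cV[R]_m) (x : 'cV[R]_n)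
        (S : 'M[R]_(d, m)) (eps u : R) (fl : fp_arith u)
        (mulS : forall k, 'M[R]_(m, k) -> cost 'M[R]_(d, k)),
      sketching_setup (c0 m n d) A b x S eps u mulS ->
      c1 m n d * cond A * u < 1 ->
      forall i : nat,
      let xi := (iterative_sketching fl mulS A b i).1 in
      let rx := norm2 (resid A b x) in
      norm2 (x - xi) <=
        20 * Num.sqrt eps * cond A * (g_IS eps + c1 m n d * cond A * u) ^+ i
          * (rx / opnorm A)
        + c1 m n d * cond A * u * (norm2 x + cond A / opnorm A * rx) /\
      norm2 (resid A b x - resid A b xi) <=
        20 * Num.sqrt eps * (g_IS eps + c1 m n d * cond A * u) ^+ i * rx
        + c1 m n d * u * (opnorm A * norm2 x + cond A * rx)) /\
    (forall (disp : measure_display) (T : measurableType disp)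
        (P : probability T R) (m n d zeta : nat) (S : T -> 'M[R]_(d, m))
        (Cd Czeta : R),
      sparse_sign_embedding P zeta S ->
      d%:R <= Cd * (n%:R * ln n%:R) ->
      zeta%:R <= Czeta * ln n%:R ->
      forall (w : T) (A : 'M[R]_(m, n)) (b : 'cV[R]_m) (x : 'cV[R]_n)
        (eps u : R) (fl : fp_arith u)
        (mulS : forall k, 'M[R]_(m, k) -> cost 'M[R]_(d, k)),
      sketching_setup (c0 m n d) A b x (S w) eps u mulS ->
      c1 m n d * cond A * u < 1 ->
      g_IS eps + c1 m n d * cond A * u <= 9 / 10 ->
      let run := iterative_sketching fl mulS A b (q u) in
      let rx := norm2 (resid A b x) in
      [/\ norm2 (run.1 - x) <=
            c' m n d * cond A * (norm2 x + cond A / opnorm A * rx) * u,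
          norm2 (resid A b run.1 - resid A b x) <=
            c' m n d * (opnorm A * norm2 x + cond A * rx) * u,
          (q u)%:R <= Cq * ln (1 / u)
        & (forall k (X : 'M[R]_(m, k)),
             ((mulS k X).2 <= (sparse_mulmx fl (S w) X).2)%N) ->
          run.2%:R <= Cop Cd Czeta * (m%:R * n%:R * ln (n%:R / u)
                                      + n%:R ^+ 3 * ln n%:R)]).

Proof.
exists (@iteration_count R), (iteration_rate R),
  (fun Cd Cz => 4 * Cz + 20 * Cd + 14 * iteration_rate R) => c0 [C [k hC]].
pose N m n d : R := (1 + m + n + d)%:R.
(* [C] may be negative, hence its absolute value. The factor 10000 in [c1] makes c1 kappa u < 1
   imply alpha kappa u <= 1/10000 and also exceeds the 50 and 1500 of the error bound. *)
pose alpha m n d : R := `|C| * N m n d ^+ k + 800 * N m n d ^+ 4.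
pose c1 m n d : R := 10000 * alpha m n d.
have N1 m n d : 1 <= N m n d by rewrite ler1n.
have N0 m n d : 0 <= N m n d by exact: le_trans (N1 m n d).
have hc0 m n d : `|c0 m n d| <= `|C| * N m n d ^+ k.
  apply: le_trans (hC m n d) _; apply: ler_wpM2r; first exact: exprn_ge0.
  exact: ler_norm.
have alpha_ge m n d : 800 <= alpha m n d.
  rewrite /alpha ler_wpDl ?mulr_ge0 ?exprn_ge0 //.
  by rewrite ler_peMr ?ler0n // exprn_ege1.
have alpha0 m n d : 0 <= alpha m n d by exact: le_trans (ler0n _ _) (alpha_ge m n d).
have c1_gt0 m n d : 0 < c1 m n d.
  by rewrite /c1 mulr_gt0 ?ltr0n //; apply: lt_le_trans (alpha_ge m n d); rewrite ltr0n.
have c1_poly : polynomially_bounded c1.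
  exists (10000 * (`|C| + 800)), (k + 4)%N => m n d.
  rewrite (ger0_norm (ltW (c1_gt0 m n d))) -/(N m n d) /c1 /alpha -mulrA.
  apply: ler_wpM2l (ler0n _ _) _ _ _; rewrite [leRHS]mulrDl; apply: lerD.
    by rewrite ler_wpM2l // ler_weXn2l // leq_addr.
  by apply: ler_wpM2l (ler0n _ _) _ _ _; rewrite ler_weXn2l // leq_addl.
exists c1, (fun m n d => c1 m n d + 20); split.
  split=> //; have [C' [k' hC']] := c1_poly.
  exists (C' + 20), k' => m n d; apply: le_trans (ler_normD _ _) _.
  rewrite [leRHS]mulrDl; apply: lerD (hC' m n d) _.
  rewrite (ger0_norm (ler0n _ _)) (ler_peMr (ler0n _ _)) //.
  exact: exprn_ege1 (N1 m n d).
have bounds m n d A b x S eps (u : R) (fl : fp_arith u) mulS :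
    @sketching_setup R m n d (c0 m n d) A b x S eps u mulS ->
    c1 m n d * cond A * u < 1 ->
    forall i : nat,
    let xi := (iterative_sketching fl mulS A b i).1 in
    let rx := norm2 (resid A b x) in
    norm2 (x - xi) <=
      20 * Num.sqrt eps * cond A * (g_IS eps + c1 m n d * cond A * u) ^+ i
        * (rx / opnorm A)
      + c1 m n d * cond A * u * (norm2 x + cond A / opnorm A * rx) /\
    norm2 (resid A b x - resid A b xi) <=
      20 * Num.sqrt eps * (g_IS eps + c1 m n d * cond A * u) ^+ i * rx
      + c1 m n d * u * (opnorm A * norm2 x + cond A * rx).
  move=> hs hu i xi rx.
  have [n0 _ rA _ heps _ u0 _ _] := hs.
  have -> : norm2 (resid A b x - resid A b xi) = norm2 (A *m (x - xi)).
    rewrite norm2_subC mulmxBr; congr norm2.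
    by rewrite /resid opprB [LHS]addrC addrA subrK.
  have ha : alpha m n d * cond A * u <= 1 / 10000.
    have p : 0 < 10000 :> R by rewrite ltr0n.
    rewrite (ler_pdivlMr _ _ p); apply: le_trans (ltW hu).
    by rewrite le_eqVlt; apply/orP; left; apply/eqP; rewrite /c1; ring.
  have c50 (y : R) : 0 <= y -> 50 * y <= 10000 * y by move=> y0; apply: ler_wpM2r; rewrite ?ler_nat.
  have c1500 (y : R) : 0 <= y -> 1500 * y <= 10000 * y by move=> y0; apply: ler_wpM2r; rewrite ?ler_nat.
  apply: (forward_error_arith (opnorm_gt0 n0 rA) (cond_ge1 n0 rA) (ltW u0)
    (alpha0 m n d) (c50 _ (alpha0 m n d)) (c1500 _ (alpha0 m n d)) (sqrtr_ge0 _) (norm2_ge0 _) (norm2_ge0 _) (g_IS_ge0 heps) erefl).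
    have aE : alpha m n d = `|C| * N m n d ^+ k + 800 * (1 + m + n + d)%:R ^+ 4 by [].
    exact: (iterates_error fl hs (hc0 m n d) erefl aE ha i).
  exact: norm2_le_cond.
have c1_ge2 m n d : 2 <= c1 m n d.
  by rewrite /c1; have := alpha_ge m n d; move: (alpha m n d); clear => y *; lra.
split; first exact: bounds.
clearbody c1.
move=> disp T P m n d zeta S Cd Cz [hsp _] hd hz w A b x eps u fl mulS hs hu hg run rx.
have [n0 nm rA _ heps hS u0 _ _] := hs.
have a0 := opnorm_gt0 n0 rA; have k1 := cond_ge1 n0 rA.
have /andP[eps0 eps1] := heps.
have eps_lt1 : eps < 1 by clear - eps1; lra.
have s1 : 0 <= Num.sqrt eps <= 1.
  by rewrite sqrtr_ge0 /= -sqrtr1 ler_sqrt ?ltW.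
(* The logarithmic estimates need 1 / u bounded away from 1; this follows from c1 >= 2, kappa >= 1
   and c1 kappa u < 1. *)
have u_half : u <= 1 / 2.
  have h2 : 2 * u <= c1 m n d * cond A * u.
    rewrite ler_wpM2r ?(ltW u0) //; apply: le_trans (_ : c1 m n d * 1 <= _); last first.
      by rewrite ler_wpM2l // ltW.
    by rewrite mulr1.
  by clear - h2 hu; lra.
have [b1 b2] := bounds m n d A b x (S w) eps u fl mulS hs hu (iteration_count u).
have g0 := g_IS_ge0 heps.
have G0 : 0 <= g_IS eps + c1 m n d * cond A * u.
  apply: addr_ge0 g0 _; apply: mulr_ge0 (ltW u0); apply: mulr_ge0 (ltW (c1_gt0 _ _ _)) _.
  exact: le_trans ler01 k1.
have Gu : (g_IS eps + c1 m n d * cond A * u) ^+ iteration_count u <= u.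
  apply: le_trans (iteration_count_pow u0 u_half).
  have p9 : 0 <= 9 / 10 :> R by exact: divr_ge0 (ler0n _ _) (ler0n _ _).
  by apply: lerXn2r hg; rewrite nnegrE.
have [r1 r2] := stable_error_arith a0 k1 (ltW u0) (ltW (c1_gt0 m n d)) s1
  (norm2_ge0 _) (norm2_ge0 _) Gu (exprn_ge0 _ G0) b1 b2.
split.
- by rewrite norm2_subC.
- by rewrite norm2_subC.
- exact: iteration_count_le.
move=> hcost.
have nd := embedding_dim rA eps_lt1 hS.
(* For n = 1 the bound on d would read d <= 0, because ln 1 = 0, against n <= d. Hence ln n > 0. *)
have n2 : (1 < n)%N.
  rewrite ltn_neqAle n0 andbT; apply/eqP => n1.
  move: hd; rewrite -n1 ln1 mulr0 mulr0 lern0 => /eqP d0.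
  by move: nd; rewrite d0 -n1.
have np : 0 < n%:R :> R by rewrite ltr0n.
have L0 : 0 < ln (n%:R : R) by rewrite ln_gt0 // ltr1n.
have lu := ln_half_le u0 u_half.
have l2 : 0 < ln (2 : R) by rewrite ln_gt0 // ltr1n.
have lu0 : 0 <= ln (1 / u) by exact: le_trans (ltW l2) lu.
have LamE : ln (n%:R / u) = ln n%:R + ln (1 / u).
  by rewrite -lnM ?posrE ?divr_gt0 // mulrA mulr1.
apply: (@cost_arith _ n%:R m%:R d%:R zeta%:R (iteration_count u)%:R) => //.
- by rewrite LamE lerDl.
- exact: iteration_rate_ge0.
- apply: le_trans (iteration_count_le u0 u_half) _.
  by rewrite ler_wpM2l ?iteration_rate_ge0 // LamE lerDr ltW.
have cA := leq_trans (hcost n A) (sparse_mulmx_cost fl A (hsp w)).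
have cb := leq_trans (hcost 1%N b) (sparse_mulmx_cost fl b (hsp w)).
have ct := iterative_sketching_cost fl mulS A b (iteration_count u).
rewrite -/run in ct.
apply: (@cost_monomials _ _ _ _ _ _ (mulS n A).2%:R (mulS 1%N b).2%:R) => //.
- by rewrite ler1n.
- by rewrite ler_nat.
- by rewrite ler_nat.
- by move: cA; rewrite -(ler_nat R) !natrM.
- by move: cb; rewrite -(ler_nat R) !natrM.
by move: ct; rewrite -(ler_nat R) !(natrD, natrM).
Qed.
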